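(* Let $K=76$. There exists an integer $N$ such that, for every integer $d\geq N$ and every non-negative real number $t$, the following holds, where $H$ is a hyperplane of $\mathbb{R}^d$ whose distance to the center of $[0,1]^d$ is equal to $t$. The $(d-1)$-dimensional volume of $H\cap[0,1]^d$ is (i) strictly locally maximal when $t$ belongs to $$ \Biggl[0,\gamma^--\frac{K}{d}\Biggr]\cup\Biggl[\gamma^++\frac{K}{d},\sqrt{\frac{\log d}{6}}\Biggr] $$ and $H$ is orthogonal to a diagonal of $[0,1]^d$, and (ii) strictly locally minimal when $t$ belongs to $$ \Biggl[\gamma^-+\frac{K}{d},\gamma^+-\frac{K}{d}\Biggr] $$ and $H$ is orthogonal to a diagonal of $[0,1]^d$.
   Context: The numbers $\gamma^\pm$ are $\gamma^\pm=\frac{1}{2}\sqrt{1\pm\sqrt{2/3}}$ (the non-negative roots of $1-24t^2+48t^4$). Local extremality is understood as follows. The number $t$ is fixed and the volume is considered a function of the hyperplane. By the symmetries of the hypercube, one may consider only the hyperplanes $H_a=\{x\in\mathbb{R}^d:a\cdot x=\sigma(a)/2-t\}$ where $a$ belongs to $\mathbb{S}^{d-1}\cap[0,+\infty[^d$ and $\sigma(a)$ is the sum of the coordinates of $a$. Let $V(a)$ be the $(d-1)$-dimensional volume of $H_a\cap[0,1]^d$. The hyperplane $H_a$ is orthogonal to a diagonal of $[0,1]^d$ (a segment joining two opposite vertices) when all the coordinates of $a$ are equal to $1/\sqrt{d}$ (up to symmetry of the hypercube). The volume is strictly locally maximal (respectively minimal) at $H_a$ if $V(b)<V(a)$ (respectively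 $V(b)>V(a)$) for every $b\neq a$ in some neighborhood of $a$ in $\mathbb{S}^{d-1}\cap[0,+\infty[^d$. *)

(* Defs.v *)
From HB Require Import structures.
From mathcomp Require Import all_boot all_order all_algebra.
From mathcomp Require Import ring lra.
From mathcomp Require Import all_classical all_reals all_analysis.

Set Implicit Arguments.
Unset Strict Implicit.
Unset Printing Implicit Defensive.

Import Order.TTheory GRing.Theory Num.Theory.
Import numFieldNormedType.Exports.

Local Open Scope classical_set_scope.
Local Open Scope ring_scope.

(* Points and normal vectors of R^d are row vectors. The normed structure that
   the library puts on 'rV_d is the one of the sup norm: it is only used for
   its topology, and lengths are always expressed with [dot]. *)

Section Geometry.
Variables (R : realType) (d : nat).
Implicit Types a x v : 'rV[R]_d.

Definition dot a x : R := \sum_(i < d) a 0 i * x 0 i.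

Definition coord_sum a : R := \sum_(i < d) a 0 i.

Definition unit_cube : set 'rV[R]_d :=
  [set x | forall i, 0 <= x 0 i <= 1].

Definition nonneg_sphere : set 'rV[R]_d :=
  [set a | dot a a = 1 /\ forall i, 0 <= a 0 i].

(* As [coord_sum a / 2] is the value of [dot a] at the center of the cube, when
   [a] is a unit vector this hyperplane is at distance [`|t|] of that center. *)
Definition hyperplane (t : R) a : set 'rV[R]_d :=
  [set x | dot a x = coord_sum a / 2 - t].

Definition cube_vertex v : Prop := forall i, v 0 i = 0 \/ v 0 i = 1.

(* The diagonals are the segments from a vertex [v] to the opposite vertex
   [const_mx 1 - v]; a hyperplane is orthogonal to such a segment when its
   normal vector [a] is collinear to the difference of the two vertices. *)
Definition orthogonal_to_diagonal a : Prop :=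
  exists v, cube_vertex v /\ exists k : R, a = k *: ((const_mx 1 - v) - v).

End Geometry.

(* Lebesgue measure of a Borel subset of R^n, as the n-fold product of the
   one-dimensional Lebesgue measure: like the library's binary product, it
   integrates the measure of the sections along the first coordinate. *)
Fixpoint lebesgue_rV (R : realType) (n : nat) : set 'rV[R]_n -> \bar R :=
  match n with
  | 0 => fun A => (\1_A 0)%:E
  | m.+1 => fun A =>
      (\int[@lebesgue_measure R]_x
          lebesgue_rV [set y : 'rV[R]_m | A (row_mx x%:M y : 'rV[R]_(1 + m))])%E
  end.

(* The rows of [E] form an orthonormal basis of the orthogonal of [a]. *)
Definition orthonormal_frame (R : realType) (d : nat) (a : 'rV[R]_d)
    (E : 'M[R]_(d.-1, d)) : Prop :=
  E *m E^T = 1%:M /\ E *m a^T = 0.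

Lemma orthonormal_frame_exists (R : realType) (d : nat) (a : 'rV[R]_d) :
  dot a a = 1 -> exists E, orthonormal_frame a E.
Proof.
case: d a => [|n] a aa1.
  by move: aa1 => /eqP; rewrite /dot big_ord0 eq_sym oner_eq0.
have dotE (x y : 'rV[R]_(1 + n)) : x *m y^T = (dot x y)%:M.
  apply/rowP => i; rewrite ord1 !mxE mulr1n.
  by apply: eq_bigr => j _; rewrite mxE.
(* Householder reflection exchanging [a] and the first basis vector *)
suff [Q [QQ Qa]] : exists Q : 'M[R]_(1 + n),
    Q *m Q^T = 1%:M /\ Q *m a^T = (row_mx 1%:M 0 : 'rV[R]_(1 + n))^T.
  exists (dsubmx Q); split.
    have := congr1 (@drsubmx R 1 n 1 n) QQ.
    rewrite -[Q in LHS]vsubmxK tr_col_mx mul_col_row block_mxKdr => ->.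
    by rewrite (scalar_mx_block 1 n) block_mxKdr.
  have := congr1 (@dsubmx R 1 n 1) Qa.
  by rewrite -[Q in LHS]vsubmxK mul_col_mx col_mxKd tr_row_mx col_mxKd trmx0.
pose e : 'rV[R]_(1 + n) := row_mx 1%:M 0.
have ee1 : e *m e^T = 1%:M.
  by rewrite tr_row_mx mul_row_col trmx1 mulmx1 mul0mx addr0.
have aaT : a *m a^T = 1%:M by rewrite dotE aa1.
have aeT : a *m e^T = e *m a^T.
  by rewrite -[LHS]trmxK trmx_mul trmxK (dotE e a) tr_scalar_mx.
have [->|ae] := eqVneq a e.
  by exists 1%:M; rewrite trmx1 !mul1mx.
pose u := a - e.
pose s := dot u u.
have sE : u *m u^T = s%:M by rewrite dotE.
have s0 : s != 0.
  apply/eqP => /eqP; rewrite /s psumr_eq0 => [/allP h|i _]; last first.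
    by rewrite -expr2 sqr_ge0.
  move/eqP: ae; apply; apply/eqP; rewrite -subr_eq0; apply/eqP/rowP => j.
  rewrite [RHS]mxE; have := h j (mem_index_enum j).
  by rewrite mulf_eq0 orbb => /eqP.
pose c := 2 / s.
pose Q : 'M[R]_(1 + n) := 1%:M - c *: (u^T *m u).
have QT : Q^T = Q by rewrite linearB /= linearZ /= trmx_mul trmxK trmx1.
have uua : u *m u^T = 2%:R *: (u *m a^T).
  rewrite /u linearB /= !(mulmxBl, mulmxBr) aaT ee1 aeT.
  by rewrite scaler_nat mulr2n opprB.
exists Q; split.
  rewrite QT /Q mulmxBl mul1mx (mulmxBr (c *: _)) mulmx1 -scalemxAl -scalemxAr.
  rewrite -mulmxA (mulmxA u) sE mul_scalar_mx -scalemxAr !scalerA.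
  have -> : c * (c * s) = 2 * c by rewrite /c; field.
  by move: (u^T *m u) => M; apply/matrixP => i j; rewrite !mxE; ring.
have ua : u *m a^T = (s / 2)%:M.
  have -> : s / 2 = 2^-1 * s by rewrite mulrC.
  by rewrite -scale_scalar_mx -sE uua scalerA mulVf ?scale1r ?pnatr_eq0.
rewrite /Q mulmxBl mul1mx -scalemxAl -mulmxA ua mul_mx_scalar scalerA.
have -> : c * (s / 2) = 1 by rewrite /c; field.
by rewrite scale1r /u linearB /= opprB addrC subrK.
Qed.

(* (d-1)-dimensional Lebesgue measure of the part of [S] contained in the
   hyperplane through [p] orthogonal to the unit vector [a]: the hyperplane is
   identified isometrically with R^(d-1) by an orthonormal basis. As the
   Lebesgue measure is invariant under isometries, neither the basis nor [p]
   matters. *)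
Definition hyperplane_measure (R : realType) (d : nat) (a p : 'rV[R]_d)
    (S : set 'rV[R]_d) : \bar R :=
  let E := xget 0 [set E | orthonormal_frame a E] in
  lebesgue_rV [set y : 'rV[R]_d.-1 | S (p + y *m E)].

(* For a unit vector [a], the base point is the orthogonal projection of the
   origin on the hyperplane. *)
Definition section_volume (R : realType) (d : nat) (t : R) (a : 'rV[R]_d)
    : \bar R :=
  hyperplane_measure a ((coord_sum a / 2 - t) *: a)
    (hyperplane t a `&` @unit_cube R d).

Definition strict_local_max (R : realType) (T : topologicalType)
    (A : set T) (f : T -> \bar R) (a : T) : Prop :=
  \forall b \near within A (nbhs a), b <> a -> (f b < f a)%E.

Definition strict_local_min (R : realType) (T : topologicalType)
    (A : set T) (f : T -> \bar R) (a : T) : Prop :=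
  \forall b \near within A (nbhs a), b <> a -> (f a < f b)%E.

Definition gamma_minus (R : realType) : R :=
  2^-1 * Num.sqrt (1 - Num.sqrt (2 / 3)).

Definition gamma_plus (R : realType) : R :=
  2^-1 * Num.sqrt (1 + Num.sqrt (2 / 3)).

(* Main.v *)
(* Up to a positive constant, the volume of the section by the hyperplane of unit
   normal b at distance t is the integral over u of
   prod_k sinc (b_k u / 2) * cos (t u). Near the diagonal, change only b_i and
   b_j, keeping b_i^2 + b_j^2. The product of the two corresponding sincs then
   changes by about c u^4, where c has the sign of the variation of b_i b_j, while
   the other factors are close to exp (- u^2 / 24). The volume thus changes by
   about c times the integral of u^4 exp (- u^2 / 24) cos (t u), which is a fixed
   multiple M > 0 of (1 - 24 t^2 + 48 t^4) exp (- 6 t^2), and the error is at most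
   16 c M / d. When t is in one of the stated ranges, this main term dominates the
   error. Finally, any normal vector near the diagonal is led to it by such moves,
   each of which sets one more coordinate to 1 / sqrt d and increases a product
   b_i b_j. *)

Require Import Defs.
From mathcomp Require Import all_boot all_order all_algebra.
From mathcomp Require Import ring lra zify.
From mathcomp Require Import all_classical all_reals all_analysis.
From mathcomp Require Import perm measurable_realfun.
Import Order.TTheory GRing.Theory Num.Theory.
Import numFieldNormedType.Exports.
Local Open Scope classical_set_scope.
Local Open Scope ring_scope.

Set Implicit Arguments.
Unset Strict Implicit.
Unset Printing Implicit Defensive.

(** * Volume of the sections of the cube *)

(** The volume is defined by an arbitrary orthonormal frame and iterated integrals, so a change of
    variables formula, limited to the sets at hand, is needed before the hyperplane can be
    parametrized by all coordinates but the first. The Fourier formula is obtained without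
    inversion: a product of two cardinal sines and a cosine reduces to integrals of (1 - cos (a u))
    / u^2, which are proportional to |a|, and each further coordinate is an average over [0, 1].
    Neither this constant nor the mass of the Gaussian is computed: only signs and ratios matter.
    Finite moves take the place of a second order study at the diagonal. The estimate must then hold
    along the whole path, hence the box of fixed relative size, on the squares of the coordinates,
    that the moves preserve. The constant 16 is 10/9 * (5 + 35/4), read off ratios of Gaussian
    moments, plus a margin for lower order terms. K = 76 is large enough for the main term to exceed
    16 / d at distance K / d from its roots, even with crude rational bounds. At t = sqrt (log d /
    6) the factor exp (- 6 t^2) is 1 / d, of the order of the error. *)

Section affine_substitution.
Context {R : realType}.
Notation mu := (@lebesgue_measure R).

Let ge0_integral_affine_pos (a b : R) (g : R -> \bar R) : 0 < a ->
  measurable_fun [set: R] g -> (forall x, 0 <= g x)%E ->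
  (a%:E * \int[mu]_x g (a * x + b)%R = \int[mu]_x g x)%E.
Proof.
move=> a0 mg g0.
have mphi : measurable_fun [set: R] (fun x : R => a * x + b : measurableTypeR R).
  by apply: measurable_funD => //; exact: measurable_funM.
have aE : 0 <= a by exact: ltW.
pose p := pushforward mu (fun x : R => a * x + b : measurableTypeR R).
have pE : (\int[p]_y g y = \int[mu]_x g (a * x + b)%R)%E.
  by rewrite ge0_integral_pushforward// preimage_setT.
rewrite -pE -[a]/((NngNum aE)%:num) -ge0_integral_mscale//=.
apply: eq_measure_integral => A mA _.
(* It is enough to compare the scaled pushforward with the Lebesgue measure on half-open
   intervals. *)
apply/esym/lebesgue_measure_unique => //= _ [[x y]] _ <-.
rewrite /mscale/= /p /pushforward.
have -> : (fun z : R => a * z + b : measurableTypeR R) @^-1` `]x, y]%classic =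
    `](x - b) / a, (y - b) / a]%classic.
  apply/seteqP; split => z /=; rewrite !in_itv/= ltr_pdivrMr// ler_pdivlMr//.
    by move=> /andP[? ?]; apply/andP; split; nra.
  by move=> /andP[? ?]; apply/andP; split; nra.
rewrite !lebesgue_measure_itv/= !lte_fin.
rewrite ltr_pM2r ?invr_gt0// ltrD2r.
case: ifPn => xy; last by rewrite mule0.
rewrite -!EFinB -EFinM; congr EFin; field.
by rewrite gt_eqF.
Qed.

Lemma ge0_integral_affine (a b : R) (g : R -> \bar R) : a != 0 ->
  measurable_fun [set: R] g -> (forall x, 0 <= g x)%E ->
  (`|a|%:E * \int[mu]_x g (a * x + b)%R = \int[mu]_x g x)%E.
Proof.
move=> a0 mg g0.
have [ap|an] := ltP 0 a; first by rewrite gtr0_norm// ge0_integral_affine_pos.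
have {}an : a < 0 by rewrite lt_neqAle a0.
rewrite ltr0_norm//.
have gN : (\int[mu]_x g (- x)%R = \int[mu]_x g x)%E.
  have mN : measurable_fun [set: R] (-%R : _ -> measurableTypeR R) by [].
  pose p := pushforward mu (-%R : _ -> measurableTypeR R).
  have <- : (\int[p]_y g y = \int[mu]_x g (- x)%R)%E.
    by rewrite ge0_integral_pushforward// preimage_setT.
  by apply: eq_measure_integral => A mA _; exact: lebesgue_measureN.
rewrite -gN.
rewrite -(@ge0_integral_affine_pos (- a) (- b) (fun x => g (- x)))//.
- congr (_ * _)%E; apply: eq_integral => x _; congr g; ring.
- by rewrite oppr_gt0.
- exact: measurableT_comp.
Qed.

End affine_substitution.

(** * Linear changes of variables for affine preimages of the cube *)

Section slab.
Context {R : realType}.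
Notation mu := (@lebesgue_measure R).

Lemma lebesgue_rV_ge0 n (A : set 'rV[R]_n) : (0 <= lebesgue_rV A)%E.
Proof.
elim: n A => [|n ih] A /=; first by rewrite lee_fin indicE.
by apply: integral_ge0 => x _; exact: ih.
Qed.

Lemma lebesgue_rV_set0 n : lebesgue_rV (@set0 'rV[R]_n) = 0%E.
Proof.
elim: n => [|n ih] /=; first by rewrite indic0.
rewrite (_ : (fun x => _) = cst 0%E) ?integral0//.
by apply/funext => x; rewrite -[RHS]ih.
Qed.

(** The ambient dimension [m] is kept apart from the number [n] of rows, so that inductions can
    remove the rows of [N] one by one without changing the cube. *)
Definition cube_fiber n m (N : 'M[R]_(n, m)) (v : 'rV[R]_m) : \bar R :=
  lebesgue_rV [set y : 'rV[R]_n | unit_cube (v + y *m N)].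

Lemma cube_fiber_ge0 n m (N : 'M[R]_(n, m)) v : (0 <= cube_fiber N v)%E.
Proof. exact: lebesgue_rV_ge0. Qed.

Lemma cube_fiberS n m (N : 'M[R]_(1 + n, m)) v :
  cube_fiber N v = (\int[mu]_x cube_fiber (dsubmx N) (v + x *: usubmx N))%E.
Proof.
have rowE (x : R) (y : 'rV_n) :
    row_mx x%:M y *m N = x *: usubmx N + y *m dsubmx N.
  by rewrite -[N in LHS]vsubmxK mul_row_col mul_scalar_mx.
apply: eq_integral => x _; rewrite /cube_fiber; congr lebesgue_rV.
by apply/seteqP; split => y /=; rewrite rowE addrA.
Qed.

(** The parameter space is arbitrary because the induction enlarges it: the variable of the outer
    integral is first added to it, in [T * R], and then integrated away by Tonelli's theorem. *)
Lemma measurable_cube_fiber d (T : measurableType d) n m (N : 'M[R]_(n, m))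
    (f : T -> 'rV[R]_m) : (forall i, measurable_fun [set: T] (fun t => f t 0 i)) ->
  measurable_fun [set: T] (fun t => cube_fiber N (f t)).
Proof.
elim: n N d T f => [|n ih] N d T f mf.
  rewrite /cube_fiber /=.
  pose S := \bigcap_(i in [set: 'I_m]) [set t | 0 <= f t 0 i <= 1].
  have mS : measurable S.
    apply: fin_bigcap_measurable => // i _.
    rewrite (_ : [set t | _] = [set: T] `&` (fun t => f t 0 i) @^-1` `[0, 1]%classic).
      exact: mf.
    by apply/seteqP; split => t /=; rewrite in_itv/= => -[].
  rewrite (_ : (fun t => _) = (fun t => (\1_S t)%:E)).
    by apply/measurable_EFinP; exact: measurable_indic.
  apply/funext => t; congr EFin; rewrite !indicE; congr (nat_of_bool _)%:R.
  apply/idP/idP; rewrite !inE /S /unit_cube /=.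
    by move=> h i _ /=; have := h i; rewrite mul0mx addr0.
  by move=> h i; rewrite mul0mx addr0; exact: h.
under eq_fun do rewrite (@cube_fiberS n).
pose g (tx : T * R) := cube_fiber (dsubmx (N : 'M[R]_(1 + n, m)))
   (f tx.1 + tx.2 *: usubmx (N : 'M[R]_(1 + n, m))).
have := @measurable_fun_fubini_tonelli_F _ _ T (measurableTypeR R) R mu g.
rewrite /fubini_F /g /=; apply; last by move=> x; exact: cube_fiber_ge0.
  apply: (ih _ _ (T * R)%type (fun tx => f tx.1 + tx.2 *: usubmx (N : 'M[R]_(1 + n, m)))) => i.
  rewrite (_ : (fun t => _) = (fun t : T * R => f t.1 0 i + t.2 * usubmx (N : 'M[R]_(1 + n, m)) 0 i)).
    apply: measurable_funD.
      exact: (measurableT_comp (mf i)).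
    by apply: measurable_funM => //.
  by apply/funext => t; rewrite !mxE.
Qed.

Lemma measurable_cube_fiber_line n m (N : 'M[R]_(n, m)) (v w : 'rV[R]_m) :
  measurable_fun [set: R] (fun x : R => cube_fiber N (v + x *: w)).
Proof.
apply: (@measurable_cube_fiber _ R n m N (fun x => v + x *: w)) => i.
rewrite (_ : (fun t => _) = (fun t : R => v 0 i + t * w 0 i)).
  by apply: measurable_funD => //; exact: measurable_funM.
by apply/funext => t; rewrite !mxE.
Qed.

Lemma mulmx_hsub n m (w : 'rV[R]_(1 + n)) (N : 'M[R]_(1 + n, m)) :
  w *m N = lsubmx w 0 0 *: usubmx N + rsubmx w *m dsubmx N.
Proof.
rewrite -[w in LHS]hsubmxK -[N in LHS]vsubmxK mul_row_col.
by rewrite [lsubmx w in LHS]mx11_scalar mul_scalar_mx.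
Qed.

Lemma cube_fiber_translate n m (N : 'M[R]_(n, m)) v (w : 'rV[R]_n) :
  cube_fiber N (v + w *m N) = cube_fiber N v.
Proof.
elim: n N v w => [|n ih] N v w; first by rewrite (thinmx0 w) mul0mx addr0.
rewrite [LHS](@cube_fiberS n) [RHS](@cube_fiberS n).
set U := usubmx _; set D := dsubmx _.
have wE : w *m N = lsubmx (w : 'rV_(1 + n)) 0 0 *: U + rsubmx (w : 'rV_(1 + n)) *m D.
  exact: mulmx_hsub.
rewrite wE; set a := lsubmx _ 0 0.
rewrite -(@ge0_integral_affine R 1 a (fun x => cube_fiber D (v + x *: U))).
- rewrite normr1 mul1e; apply: eq_integral => x _.
  rewrite -[RHS](ih D _ (rsubmx (w : 'rV_(1 + n)))); congr cube_fiber.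
  by rewrite mul1r scalerDl -!addrA (addrC (x *: U)) -addrA.
- exact: oner_neq0.
- exact: measurable_cube_fiber_line.
- by move=> x; exact: cube_fiber_ge0.
Qed.

(** The change of variables formula for [M], restricted to affine preimages of cubes. Quantifying
    over all [N] lets it be applied to a product [B *m N], hence composed. *)
Definition scales_fibers n (M : 'M[R]_n) := forall m (N : 'M[R]_(n, m)) v,
  (`|\det M|%:E * cube_fiber (M *m N) v = cube_fiber N v)%E.

(** Undoes a row operation [A] without inverting it: the formula for [A] is applied to [B *m N]. *)
Lemma scales_fibers_cancel n (A B : 'M[R]_n) :
  scales_fibers A -> scales_fibers (A *m B) -> scales_fibers B.
Proof.
move=> gA gAB m N v.
by rewrite -gA muleA -EFinM -normrM mulmxA mulrC -det_mulmx gAB.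
Qed.

(** At a fixed first variable [x], the row [u] only translates the fiber along the rows that remain,
    which has no effect; [M] acts on these rows and [a] dilates [x]. *)
Lemma scales_fibers_ublock n (a : R) (u : 'rV[R]_n) (M : 'M[R]_n) :
  a != 0 -> scales_fibers M ->
  scales_fibers (block_mx a%:M u 0 M : 'M[R]_(1 + n)).
Proof.
move=> a0 gM m N v.
rewrite det_ublock det_scalar1 normrM [LHS]muleC.
rewrite [LHS]muleC EFinM -muleA (@cube_fiberS n) (@cube_fiberS n _ N).
rewrite -ge0_integralZl//=; last 2 first.
- exact: measurable_cube_fiber_line.
- by move=> x _; exact: cube_fiber_ge0.
rewrite -[RHS](ge0_integral_affine 0 a0); last 2 first.
- exact: measurable_cube_fiber_line.
- by move=> x; exact: cube_fiber_ge0.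
congr (_ * _)%E; apply: eq_integral => x _.
rewrite -[N in LHS]vsubmxK mul_block_col mul0mx add0r col_mxKu col_mxKd gM.
rewrite mul_scalar_mx scalerDr addrA scalemxAl cube_fiber_translate.
by rewrite addr0 scalerA [x * a]mulrC.
Qed.

Lemma cube_fiber_swap n m (P Q : 'rV[R]_m) (D : 'M[R]_(n, m)) v :
  cube_fiber (col_mx P (col_mx Q D) : 'M[R]_(1 + (1 + n), m)) v =
  cube_fiber (col_mx Q (col_mx P D) : 'M[R]_(1 + (1 + n), m)) v.
Proof.
have E (A B : 'rV[R]_m) :
    cube_fiber (col_mx A (col_mx B D) : 'M[R]_(1 + (1 + n), m)) v =
    (\int[mu]_x \int[mu]_y cube_fiber D (v + x *: A + y *: B))%E.
  rewrite (@cube_fiberS (1 + n)) col_mxKu col_mxKd; apply: eq_integral => x _.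
  by rewrite (@cube_fiberS n) col_mxKu col_mxKd.
rewrite !E.
pose g (z : measurableTypeR R * measurableTypeR R) := cube_fiber D (v + z.1 *: P + z.2 *: Q).
transitivity (\int[mu]_y \int[mu]_x g (x, y))%E.
  apply: (@fubini_tonelli _ _ _ _ R mu mu g) => [|x]; last exact: cube_fiber_ge0.
  apply: measurable_cube_fiber => i.
  rewrite (_ : (fun t => _) = (fun z : measurableTypeR R * measurableTypeR R =>
      v 0 i + z.1 * P 0 i + z.2 * Q 0 i)).
    by apply: measurable_funD; [apply: measurable_funD|] => //; exact: measurable_funM.
  by apply/funext => z; rewrite !mxE.
apply: eq_integral => x _; apply: eq_integral => y _.
by rewrite /g /= addrAC.
Qed.

Lemma scales_fibers_tperm n :
  scales_fibers (tperm_mx 0 (lift 0 0) : 'M[R]_(1 + (1 + n))).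
Proof.
move=> m N v.
rewrite det_perm normrX normrN1 expr1n mul1e.
rewrite -xrowE -[N]vsubmxK -[dsubmx N]vsubmxK.
move: (usubmx N) (usubmx (dsubmx N)) (dsubmx (dsubmx N)) => P Q D.
suff -> : xrow 0 (lift 0 0) (col_mx P (col_mx Q D)) = col_mx Q (col_mx P D).
  exact: cube_fiber_swap.
apply/matrixP => i j; rewrite mxE.
have col0 (A B : 'rV[R]_m) :
    (col_mx A (col_mx B D) : 'M[R]_(1 + (1 + n), m)) 0 j = A 0 j.
  have -> : 0 = lshift (1 + n) (0 : 'I_1) by exact/val_inj.
  by rewrite col_mxEu.
have col1 (A B : 'rV[R]_m) :
    (col_mx A (col_mx B D) : 'M[R]_(1 + (1 + n), m)) (lift 0 0) j = B 0 j.
  have -> : lift (0 : 'I_n.+2) 0 = rshift 1 (lshift n (0 : 'I_1)) by exact/val_inj.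
  by rewrite col_mxEd col_mxEu.
have col2 (A B : 'rV[R]_m) k :
    (col_mx A (col_mx B D) : 'M[R]_(1 + (1 + n), m)) (lift 0 (lift 0 k)) j = D k j.
  have -> : lift (0 : 'I_n.+2) (lift (0 : 'I_n.+1) k) = rshift 1 (rshift 1 k).
    exact/val_inj.
  by rewrite !col_mxEd.
case: (unliftP 0 i) => [i'|] ->; last by rewrite tpermL col0 col1.
case: (unliftP 0 i') => [i2|] ->; last by rewrite tpermR col0 col1.
rewrite tpermD; last 2 first.
- by rewrite neq_lift.
- by rewrite (inj_eq lift_inj) neq_lift.
by rewrite !col2.
Qed.

Lemma block_elimination n (M : 'M[R]_(1 + n)) (B : 'M[R]_n) (u : 'rV[R]_n) (c : 'cV[R]_n) :
  B *m dlsubmx M = c -> u *m c = - ulsubmx M ->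
  block_mx 1%:M u 0 1%:M *m (block_mx 1%:M 0 0 B *m M) =
  block_mx 0 (ursubmx M + u *m (B *m drsubmx M)) c (B *m drsubmx M).
Proof.
move=> Bc uc; rewrite -{1}(submxK M) !mulmx_block !mul1mx !mul0mx !add0r !addr0.
by rewrite Bc uc subrr.
Qed.

Lemma dlsubmx_xrow01 n (r : R) X Y :
  @dlsubmx _ 1 (1 + n) 1 (1 + n) (xrow 0 (lift 0 0)
    (block_mx 0 X (col_mx r%:M (0 : 'cV[R]_n)) Y : 'M[R]_(1 + (1 + n)))) = 0.
Proof.
apply/matrixP => i j; rewrite [RHS]mxE mxE mxE mxE.
have E0 : 0 = lshift (1 + n) (0 : 'I_1) by exact/val_inj.
have Ej : lshift (1 + n) j = lshift (1 + n) (0 : 'I_1) by rewrite ord1.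
pose M : 'M[R]_(1 + (1 + n)) := block_mx 0 X (col_mx r%:M 0) Y.
have Edl (k : 'I_n) : M (rshift 1 (rshift 1 k)) (lshift (1 + n) 0) = 0.
  by rewrite block_mxEdl col_mxEd mxE.
have Eul : M (lshift (1 + n) 0) (lshift (1 + n) 0) = 0 by rewrite block_mxEul mxE.
rewrite Ej; case: (unliftP 0 i) => [k|] ->.
  rewrite tpermD; last 2 first.
  - by rewrite -val_eqE.
  - by rewrite -val_eqE.
  have -> : lift (0 : 'I_(1 + n)) k = rshift 1 k by exact/val_inj.
  exact: Edl.
have -> : rshift 1 (0 : 'I_(1 + n)) = lift 0 0 by exact/val_inj.
rewrite tpermR {1}E0; exact: Eul.
Qed.

(* By induction on n. If M is not block upper triangular, elimination in its
   first column followed by a swap of the first two rows makes it so. *)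
Lemma scales_fibers_unitmx n (M : 'M[R]_n) : M \in unitmx -> scales_fibers M.
Proof.
elim: n M => [|n ih] M Mu.
  move=> m N v; rewrite (flatmx0 N) mulmx0 det_mx00 normr1 mul1e.
  by congr cube_fiber; exact: flatmx0.
have case0 (A : 'M[R]_(1 + n)) : A \in unitmx -> dlsubmx A = 0 -> scales_fibers A.
  move=> Au l0.
  move: Au; rewrite unitmxE -{1}(submxK A) l0 det_ublock unitrM => /andP[].
  rewrite {1}[ulsubmx A]mx11_scalar det_scalar1 unitfE => a0 Du.
  have -> : A = block_mx (ulsubmx A 0 0)%:M (ursubmx A) 0 (drsubmx A).
    by rewrite -mx11_scalar -l0 submxK.
  exact: (scales_fibers_ublock (ursubmx A) a0 (ih _ Du)).
have [l0|l0] := eqVneq (@dlsubmx _ 1 n 1 n M) 0; first exact: case0.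
case: n ih M Mu case0 l0 => [|n] ih M Mu case0 l0.
  by case/eqP: l0; exact: flatmx0.
set l := dlsubmx _ in l0.
(* The rank factorization of the nonzero column [l] provides an invertible [B] that sends it to a
   column whose only nonzero entry [r] comes first. *)
pose B := invmx (col_ebase l).
have Bu : B \in unitmx by rewrite unitmx_inv col_ebase_unit.
have lr : \rank l = 1%N.
  by apply/eqP; rewrite eqn_leq rank_leq_col lt0n mxrank_eq0.
have Bl : B *m l = pid_mx 1 *m row_ebase l.
  have le := mulmx_ebase l; rewrite lr in le.
  have -> : B *m l = B *m (col_ebase l *m pid_mx 1 *m row_ebase l) by rewrite le.
  by rewrite !mulmxA mulVmx ?mul1mx// col_ebase_unit.
have pE : pid_mx 1 *m row_ebase l = col_mx (row_ebase l 0 0)%:M 0 :> 'cV[R]_(1 + n).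
  by rewrite (@pid_mx_col _ n 1) mul_col_mx mul1mx mul0mx -mx11_scalar.
set r := row_ebase l 0 0 in pE.
have r0 : r != 0.
  by have := row_ebase_unit l; rewrite unitmxE [row_ebase l]mx11_scalar det_scalar1 unitfE.
have {pE}Bl := etrans Bl pE.
pose a := @ulsubmx _ 1 (1 + n) 1 (1 + n) M 0 0.
pose P : 'M[R]_(1 + (1 + n)) := block_mx 1%:M 0 0 B.
(* This multiple of the pivot row clears the corner [a], so that after the swap [r] is alone in the
   first column. *)
pose u : 'rV[R]_(1 + n) := row_mx (- a / r)%:M 0.
pose Q : 'M[R]_(1 + (1 + n)) := block_mx 1%:M u 0 1%:M.
have gP : scales_fibers P by apply: scales_fibers_ublock (oner_neq0 _) _; exact: ih.
have gQ : scales_fibers Q.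
  by apply: scales_fibers_ublock (oner_neq0 _) _; apply: ih; exact: unitmx1.
have Pu : P \in unitmx.
  by move: Bu; rewrite !unitmxE det_ublock det1 mul1r.
have Qu : Q \in unitmx by rewrite unitmxE det_ublock !det1 mulr1 unitr1.
pose S : 'M[R]_(1 + (1 + n)) := tperm_mx 0 (lift 0 0).
have Su : S \in unitmx by exact: unitmx_perm.
apply: (scales_fibers_cancel gP); apply: (scales_fibers_cancel gQ).
apply: (scales_fibers_cancel (@scales_fibers_tperm n)).
apply: case0; first by rewrite !unitmx_mul Su Qu Pu Mu.
have uc : u *m col_mx r%:M 0 = - @ulsubmx _ 1 (1 + n) 1 (1 + n) M.
  rewrite mul_row_col mul0mx addr0 -scalar_mxM mulfVK//.
  by rewrite [ulsubmx _]mx11_scalar raddfN.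
rewrite (block_elimination Bl uc) -xrowE; exact: dlsubmx_xrow01.
Qed.

End slab.

(** * From the hyperplane section to a slab of a cube of lower dimension *)

Section section_volume.
Context {R : realType}.
Notation mu := (@lebesgue_measure R).

(** Up to sign, an entry of an orthogonal matrix is its own cofactor. Here [T] is the identity with
    [b] as first column: its determinant is [b 0 0], and [Q *m T] is block triangular with the minor
    as last block. *)
Lemma orthonormal_frame_minor n (b : 'rV[R]_(1 + n)) (E : 'M[R]_(n, 1 + n)) :
  dot b b = 1 -> E *m E^T = 1%:M -> E *m b^T = 0 ->
  `|\det (rsubmx E)| = `|b 0 0|.
Proof.
move=> bb EE Eb.
have bbT : b *m b^T = 1%:M.
  apply/matrixP => i j; rewrite !ord1 !mxE -bb.
  by apply: eq_bigr => k _; rewrite mxE.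
have bET : b *m E^T = 0.
  by rewrite -[LHS]trmxK trmx_mul trmxK Eb trmx0.
pose Q : 'M[R]_(1 + n) := col_mx b E.
have QQ : Q *m Q^T = 1%:M.
  by rewrite tr_col_mx mul_col_row bbT bET Eb EE -scalar_mx_block.
have dQ : `|\det Q| = 1.
  have := congr1 determinant QQ; rewrite det_mulmx det_tr det1 => /eqP.
  rewrite -expr2 sqrf_eq1 => /orP[] /eqP ->; by rewrite ?normrN normr1.
pose T : 'M[R]_(1 + n) := block_mx (b 0 0)%:M 0 (rsubmx b)^T 1%:M.
have QT : Q *m T = block_mx 1%:M (rsubmx b) 0 (rsubmx E).
  have TE : T = row_mx b^T (col_mx 0 1%:M).
    rewrite /T block_mxEh; congr row_mx.
    rewrite -[b in RHS](@hsubmxK _ 1 1 n) tr_row_mx; congr col_mx.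
    by apply/matrixP => i j; rewrite !ord1 !mxE mulr1n; congr (b _ _); exact/val_inj.
  rewrite TE /Q mul_col_row bbT Eb; congr block_mx.
    by rewrite -{1}[b](@hsubmxK _ 1 1 n) mul_row_col mulmx0 mulmx1 add0r.
  by rewrite -{1}[E](@hsubmxK _ n 1 n) mul_row_col mulmx0 mulmx1 add0r.
have := congr1 (fun A => `|\det A|) QT.
by rewrite det_mulmx normrM dQ mul1r det_lblock det_scalar1 det1 mulr1 det_ublock det1 mul1r.
Qed.

(** Nothing is known of the frame picked by [xget], but it differs from the parametrization of the
    hyperplane as a graph over the last coordinates by the square matrix [rsubmx E], of determinant
    [b 0 0] up to sign. The two base points differ by a vector of the direction of the hyperplane,
    absorbed by translation. *)
Lemma section_volume_fiber n (t : R) (b : 'rV[R]_(1 + n)) :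
  dot b b = 1 -> b 0 0 != 0 ->
  (`|b 0 0|%R%:E * section_volume t b)%E =
  cube_fiber (row_mx (- (b 0 0)^-1 *: (rsubmx b)^T) 1%:M)
    (row_mx ((coord_sum b / 2 - t) / b 0 0)%:M 0 : 'rV[R]_(1 + n)).
Proof.
move=> bb b0; rewrite /section_volume /hyperplane_measure.
set s := coord_sum b / 2 - t.
set E := xget _ _.
have [EE Eb] : orthonormal_frame b E.
  exact: (xgetPex 0 (orthonormal_frame_exists bb)).
have dotE (x : 'rV[R]_(1 + n)) : dot b x = (x *m b^T) 0 0.
  by rewrite mxE; apply: eq_bigr => k _; rewrite mxE mulrC.
have -> : [set y | (hyperplane t b `&` unit_cube (d:=1 + n)) (s *: b + y *m E)] =
    [set y : 'rV[R]_n | unit_cube (s *: b + y *m E)].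
  apply/seteqP; split => y /=; first by case.
  move=> h; split => //.
  rewrite /hyperplane /= dotE mulmxDl -mulmxA Eb mulmx0 addr0 -scalemxAl mxE.
  by rewrite -dotE bb mulr1.
rewrite -/(cube_fiber E (s *: b)).
set N := row_mx _ _.
have bE : b = row_mx (b 0 0)%:M (rsubmx b).
  rewrite -[LHS](@hsubmxK _ 1 1 n); congr row_mx.
  by rewrite [LHS]mx11_scalar mxE; congr (b _ _)%:M; exact/val_inj.
have EN : E = rsubmx E *m N.
  rewrite /N mul_mx_row mulmx1 -[LHS](@hsubmxK _ n 1 n); congr row_mx.
  rewrite -scalemxAr.
  move: Eb; rewrite {1}bE -{1}[E](@hsubmxK _ n 1 n) tr_row_mx mul_row_col.
  rewrite tr_scalar_mx mul_mx_scalar => /eqP; rewrite addr_eq0 => /eqP h.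
  by rewrite scaleNr -scalerN -h scalerA mulVf// scale1r.
have sE : s *: b = row_mx (s / b 0 0)%:M 0 + (s *: rsubmx b) *m N.
  have rb : rsubmx b *m (rsubmx b)^T = (1 - b 0 0 ^+ 2)%:M.
    have : b *m b^T = 1%:M.
      by rewrite -bb; apply/matrixP => i j; rewrite !ord1 -dotE !mxE mulr1n.
    rewrite {1 2}bE tr_row_mx mul_row_col tr_scalar_mx -scalar_mxM => /eqP.
    rewrite addrC eq_sym -subr_eq eq_sym => /eqP ->.
    by rewrite -expr2 raddfB.
  rewrite /N mul_mx_row mulmx1 add_row_mx add0r {1}bE scale_row_mx; congr row_mx.
  rewrite -scalemxAl -scalemxAr rb !scale_scalar_mx -raddfD/=; congr (_%:M).
  by field.
rewrite -(orthonormal_frame_minor bb EE Eb) sE {2}EN.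
have Mu : rsubmx E \in unitmx.
  by rewrite unitmxE unitfE -normr_eq0 (orthonormal_frame_minor bb EE Eb) normr_eq0.
rewrite (scales_fibers_unitmx Mu); exact: cube_fiber_translate.
Qed.

(* When w = b 0 0 and r is the rest of b, these are the points y of the cube of
   dimension n that lift to the hyperplane dot b x = tau with a first coordinate
   in [0, 1]. *)
Definition cube_slab (w : R) n (r : 'rV[R]_n) (tau : R) : \bar R :=
  lebesgue_rV [set y : 'rV[R]_n | unit_cube y /\ 0 <= tau - dot r y <= w].

Lemma cube_slab0 w (r : 'rV[R]_0) tau :
  cube_slab w r tau = (\1_(`[0, w]%classic : set R) tau)%:E.
Proof.
rewrite /cube_slab /= !indicE; congr ((nat_of_bool _)%:R%:E).
apply/idP/idP; rewrite !inE /= in_itv/= /dot big_ord0 subr0; first by case.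
by split => // -[].
Qed.

Lemma cube_slabS w n (r : 'rV[R]_(1 + n)) tau :
  cube_slab w r tau =
  (\int[mu]_(x in `[0%R, 1%R]) cube_slab w (rsubmx r) (tau - r 0 0 * x)%R)%E.
Proof.
rewrite [RHS]integral_mkcond; apply: eq_integral => x _.
have dotE (y : 'rV[R]_n) : dot r (row_mx x%:M y) = r 0 0 * x + dot (rsubmx r) y.
  rewrite /dot big_split_ord big_ord1; congr (_ + _).
    by rewrite row_mxEl mxE mulr1n; congr (r _ _ * _); exact/val_inj.
  by apply: eq_bigr => i _; rewrite row_mxEr mxE.
have cubeE (y : 'rV[R]_n) : unit_cube (row_mx x%:M y : 'rV_(1 + n)) <->
    0 <= x <= 1 /\ unit_cube y.
  split => [h|[hx hy] i].
    split; first by have := h (lshift n 0); rewrite row_mxEl mxE mulr1n.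
    by move=> i; have := h (rshift 1 i); rewrite row_mxEr.
  rewrite -(splitK i); case: (fintype.split i) => j /=.
    by rewrite row_mxEl mxE ord1 mulr1n.
  by rewrite row_mxEr; exact: hy.
rewrite patchE; case: ifPn => x01.
  have {}x01 : 0 <= x <= 1 by move: x01; rewrite inE/= in_itv/=.
  congr lebesgue_rV; apply/seteqP; split => y /=.
    by rewrite dotE opprD addrA => -[/cubeE[_ ?] ?].
  by move=> [yc ?]; rewrite dotE opprD addrA; split => //; apply/cubeE.
rewrite -[RHS](@lebesgue_rV_set0 R n); congr lebesgue_rV.
apply/seteqP; split => y //= -[/cubeE[x01' _] _].
by move: x01; rewrite notin_setE/= in_itv/= x01'.
Qed.

Lemma section_volume_slab n (t : R) (b : 'rV[R]_(1 + n)) :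
  dot b b = 1 -> 0 < b 0 0 ->
  ((b 0 0)%R%:E * section_volume t b)%E =
  cube_slab (b 0 0) (rsubmx b) (coord_sum b / 2 - t).
Proof.
move=> bb b0.
rewrite -[X in (X%:E * _)%E](gtr0_norm b0) (section_volume_fiber _ bb) ?gt_eqF//.
rewrite /cube_fiber /cube_slab; congr lebesgue_rV.
set s := coord_sum b / 2 - t; set r := rsubmx b.
have E (y : 'rV[R]_n) : row_mx (s / b 0 0)%:M 0 + y *m row_mx (- (b 0 0)^-1 *: r^T) 1%:M
    = row_mx ((s - dot r y) / b 0 0)%:M y :> 'rV[R]_(1 + n).
  rewrite mul_mx_row mulmx1 add_row_mx add0r; congr row_mx.
  apply/matrixP => i j; rewrite !ord1 -scalemxAr !mxE !mulr1n -/s [RHS]mulrBl mulNr.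
  congr (_ - _); rewrite mulrC; congr (_ * _).
  by apply: eq_bigr => k _; rewrite !mxE mulrC.
apply/seteqP; split => y /=; rewrite E.
  move=> h; split; first by move=> i; have := h (rshift 1 i); rewrite row_mxEr.
  have := h (lshift n 0); rewrite row_mxEl mxE mulr1n.
  by rewrite ler_pdivlMr// mul0r ler_pdivrMr// mul1r.
move=> [hy hs] i; rewrite -(splitK i); case: (fintype.split i) => j /=.
  by rewrite row_mxEl mxE ord1 mulr1n ler_pdivlMr// mul0r ler_pdivrMr// mul1r.
by rewrite row_mxEr; exact: hy.
Qed.

End section_volume.

(** * Products of two cardinal sines *)

Section calculus.
Context {R : realType}.
Implicit Types (f g df dg : R -> R) (x z a b : R).

Lemma le_increment f g df dg a b : a <= b ->
  (forall x, a < x < b -> is_derive x 1 f (df x)) ->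
  (forall x, a < x < b -> is_derive x 1 g (dg x)) ->
  {within `[a, b], continuous f} -> {within `[a, b], continuous g} ->
  (forall x, a < x < b -> df x <= dg x) -> f b - f a <= g b - g a.
Proof.
rewrite le_eqVlt => /predU1P[<-|ab] hf hg cf cg h; first by rewrite !subrr.
have hfg x : x \in `]a, b[ -> is_derive x 1 (g - f) (dg x - df x).
  by rewrite in_itv/= => xab; have := hf _ xab; have := hg _ xab => ? ?; exact: is_deriveB.
have cgf : {within `[a, b], continuous (g - f)}.
  by move=> x; apply: cvgB; [exact: cg|exact: cf].
have [c cab /= E] := MVT ab hfg cgf.
have : 0 <= (g - f) b - (g - f) a.
  rewrite E mulr_ge0 ?subr_ge0 ?(ltW ab)//; apply: h.
  by move: cab; rewrite in_itv.
rewrite !fctE; lra.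
Qed.

Lemma le_increment_derivable f g df dg a b : a <= b ->
  (forall x, is_derive x 1 f (df x)) -> (forall x, is_derive x 1 g (dg x)) ->
  (forall x, a < x < b -> df x <= dg x) -> f b - f a <= g b - g a.
Proof.
move=> ab hf hg; apply: le_increment => //.
  by apply: continuous_subspaceT => x; apply: differentiable_continuous; apply/derivable1_diffP; case: (hf x).
by apply: continuous_subspaceT => x; apply: differentiable_continuous; apply/derivable1_diffP; case: (hg x).
Qed.

(** The Taylor bounds that follow are obtained from one another by integration from 0, starting with
    the boundedness of the cosine. *)
Lemma le_from0 f g df dg x : 0 <= x -> f 0 = g 0 ->
  (forall z, is_derive z 1 f (df z)) -> (forall z, is_derive z 1 g (dg z)) ->
  (forall z, 0 < z -> df z <= dg z) -> f x <= g x.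
Proof.
move=> x0 fg0 hf hg h.
have := @le_increment_derivable f g df dg 0 x x0 hf hg.
by rewrite fg0 lerD2r; apply => z /andP[z0 _]; exact: h.
Qed.

Local Ltac derive := let z := fresh "z" in
  move=> z; apply: is_derive_eq; rewrite /GRing.scale/=; by (field || reflexivity).

Lemma sin_le_id x : 0 <= x -> sin x <= x.
Proof.
move=> x0; apply: (@le_from0 sin id cos (fun=> 1) x) => //; try derive.
- by rewrite sin0.
Qed.

Lemma sin_ge_opp x : 0 <= x -> - x <= sin x.
Proof.
move=> x0; apply: (@le_from0 (fun z => - z) sin (fun=> - 1) cos x) => //; try derive.
- by rewrite sin0 oppr0.
- by move=> z _; exact: cos_geN1.
Qed.

Lemma cos_ge2 x : 0 <= x -> 1 - x ^+ 2 / 2 <= cos x.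
Proof.
move=> x0; apply: (@le_from0 (fun z => 1 - z ^+ 2 / 2) cos (fun z => - z) (fun z => - sin z) x) => //; try derive.
- by rewrite cos0 expr0n/= mul0r subr0.
- by move=> z z0; rewrite lerN2 sin_le_id// ltW.
Qed.

Lemma sin_ge3 x : 0 <= x -> x - x ^+ 3 / 6 <= sin x.
Proof.
move=> x0; apply: (@le_from0 (fun z => z - z ^+ 3 / 6) sin (fun z => 1 - z ^+ 2 / 2) cos x) => //; try derive.
- by rewrite sin0 expr0n/= mul0r subr0.
- by move=> z z0; rewrite cos_ge2// ltW.
Qed.

Lemma cos_le4 x : 0 <= x -> cos x <= 1 - x ^+ 2 / 2 + x ^+ 4 / 24.
Proof.
move=> x0; apply: (@le_from0 cos (fun z => 1 - z ^+ 2 / 2 + z ^+ 4 / 24)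
  (fun z => - sin z) (fun z => - (z - z ^+ 3 / 6)) x) => //; try derive.
- by rewrite cos0 !expr0n/= !mul0r subr0 addr0.
- by move=> z z0; rewrite lerN2 sin_ge3// ltW.
Qed.

Lemma sin_le5 x : 0 <= x -> sin x <= x - x ^+ 3 / 6 + x ^+ 5 / 120.
Proof.
move=> x0; apply: (@le_from0 sin (fun z => z - z ^+ 3 / 6 + z ^+ 5 / 120)
  cos (fun z => 1 - z ^+ 2 / 2 + z ^+ 4 / 24) x) => //; try derive.
- by rewrite sin0 !expr0n/= !mul0r subr0 addr0.
- by move=> z z0; rewrite cos_le4// ltW.
Qed.

(* Up to a power of z, bessel1 and bessel2 are the spherical Bessel functions
   j1 and j2, the next ones after sinc = j0. *)
Definition bessel1 x : R := sin x - x * cos x.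
Definition bessel2 x : R := (3 - x ^+ 2) * sin x - 3 * x * cos x.

#[local] Instance is_derive_bessel1 z : is_derive z 1 bessel1 (z * sin z).
Proof. by rewrite /bessel1; move: z; derive. Qed.

#[local] Instance is_derive_bessel2 z : is_derive z 1 bessel2 (z * bessel1 z).
Proof. by rewrite /bessel2 /bessel1; move: z; derive. Qed.

Lemma bessel1_0 : bessel1 0 = 0.
Proof. by rewrite /bessel1 sin0 mul0r subr0. Qed.

Lemma bessel2_0 : bessel2 0 = 0.
Proof. by rewrite /bessel2 sin0 !mulr0 mul0r subr0. Qed.

Lemma bessel1_le x : 0 <= x -> bessel1 x <= x ^+ 3 / 3.
Proof.
move=> x0; apply: (@le_from0 bessel1 (fun z => z ^+ 3 / 3) (fun z => z * sin z) (fun z => z ^+ 2) x) => //; try derive.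
- by rewrite bessel1_0 !expr0n/= mul0r.
- by move=> z z0; rewrite expr2 ler_pM2l// sin_le_id// ltW.
Qed.

Lemma bessel1_ge_opp x : 0 <= x -> - (x ^+ 3 / 3) <= bessel1 x.
Proof.
move=> x0; apply: (@le_from0 (fun z => - (z ^+ 3 / 3)) bessel1 (fun z => - z ^+ 2) (fun z => z * sin z) x) => //; try derive.
- by rewrite bessel1_0 !expr0n/= mul0r oppr0.
- by move=> z z0; rewrite expr2 -mulrN ler_pM2l// sin_ge_opp// ltW.
Qed.

Lemma bessel1_ge x : 0 <= x -> x ^+ 3 / 3 - x ^+ 5 / 30 <= bessel1 x.
Proof.
move=> x0; apply: (@le_from0 (fun z => z ^+ 3 / 3 - z ^+ 5 / 30) bessel1
   (fun z => z * (z - z ^+ 3 / 6)) (fun z => z * sin z) x) => //; try derive.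
- by rewrite bessel1_0 !expr0n/= !mul0r subr0.
- by move=> z z0; rewrite ler_pM2l// sin_ge3// ltW.
Qed.

Lemma bessel2_le x : 0 <= x -> bessel2 x <= x ^+ 5 / 15.
Proof.
move=> x0; apply: (@le_from0 bessel2 (fun z => z ^+ 5 / 15) (fun z => z * bessel1 z) (fun z => z * (z ^+ 3 / 3)) x) => //; try derive.
- by rewrite bessel2_0 !expr0n/= mul0r.
- by move=> z z0; rewrite ler_pM2l// bessel1_le// ltW.
Qed.

Lemma bessel2_ge_opp x : 0 <= x -> - (x ^+ 5 / 15) <= bessel2 x.
Proof.
move=> x0; apply: (@le_from0 (fun z => - (z ^+ 5 / 15)) bessel2 (fun z => z * - (z ^+ 3 / 3)) (fun z => z * bessel1 z) x) => //; try derive.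
- by rewrite bessel2_0 !expr0n/= mul0r oppr0.
- by move=> z z0; rewrite ler_pM2l// bessel1_ge_opp// ltW.
Qed.

Lemma bessel2_ge x : 0 <= x -> x ^+ 5 / 15 - x ^+ 7 / 210 <= bessel2 x.
Proof.
move=> x0; apply: (@le_from0 (fun z => z ^+ 5 / 15 - z ^+ 7 / 210) bessel2
   (fun z => z * (z ^+ 3 / 3 - z ^+ 5 / 30)) (fun z => z * bessel1 z) x) => //; try derive.
- by rewrite bessel2_0 !expr0n/= !mul0r subr0.
- by move=> z z0; rewrite ler_pM2l// bessel1_ge// ltW.
Qed.

End calculus.

Section pair.
Context {R : realType}.
Implicit Types (f g df dg : R -> R) (x z a b y S D m M : R).

Lemma is_derive_comp_sqrt f x (d : R) : 0 < x -> is_derive (Num.sqrt x) 1 f d ->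
  is_derive x 1 (fun y : R => f (Num.sqrt y)) (d / (2 * Num.sqrt x)).
Proof.
move=> x0 hf.
have hs : is_derive x 1 (@Num.sqrt R) ((2 * Num.sqrt x)^-1) by exact: is_derive1_sqrt.
apply: is_derive_eq.
by rewrite /GRing.scale/= mulrC.
Qed.

(* z |-> sqrt_besselk (z ^+ 2) is the spherical Bessel function jk divided by z ^+ k, and
   each of these functions is -2 times the derivative of the previous one. *)
Definition sqrt_bessel0 x : R := sin (Num.sqrt x) / Num.sqrt x.
Definition sqrt_bessel1 x : R := bessel1 (Num.sqrt x) / Num.sqrt x ^+ 3.
Definition sqrt_bessel2 x : R := bessel2 (Num.sqrt x) / Num.sqrt x ^+ 5.

Lemma is_derive_cos_sqrt x : 0 < x ->
  is_derive x 1 (fun y : R => cos (Num.sqrt y)) (- sqrt_bessel0 x / 2).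
Proof.
move=> x0; have s0 : Num.sqrt x != 0 by rewrite gt_eqF// sqrtr_gt0.
apply: is_derive_eq (is_derive_comp_sqrt x0 (is_derive_cos (Num.sqrt x))) _.
by rewrite /sqrt_bessel0; field.
Qed.

Lemma is_derive_sqrt_bessel0 x : 0 < x -> is_derive x 1 sqrt_bessel0 (- sqrt_bessel1 x / 2).
Proof.
move=> x0; have s0 : Num.sqrt x != 0 by rewrite gt_eqF// sqrtr_gt0.
have h : is_derive (Num.sqrt x) 1 (fun z : R => sin z / z)
    (- bessel1 (Num.sqrt x) / Num.sqrt x ^+ 2).
  have hV : is_derive (Num.sqrt x) 1 (fun z : R => z^-1) (- (Num.sqrt x) ^- 2 *: 1).
    exact: (@is_deriveV _ id).
  by apply: is_derive_eq; rewrite /bessel1 /GRing.scale/=; field.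
apply: is_derive_eq (is_derive_comp_sqrt x0 h) _.
by rewrite /sqrt_bessel1; field.
Qed.

Lemma is_derive_sqrt_bessel1 x : 0 < x -> is_derive x 1 sqrt_bessel1 (- sqrt_bessel2 x / 2).
Proof.
move=> x0; have s0 : Num.sqrt x != 0 by rewrite gt_eqF// sqrtr_gt0.
have h1 := is_derive_bessel1 (Num.sqrt x).
have h : is_derive (Num.sqrt x) 1 (fun z : R => bessel1 z / z ^+ 3)
    (- bessel2 (Num.sqrt x) / Num.sqrt x ^+ 4).
  have hV : is_derive (Num.sqrt x) 1 (fun z : R => (z ^+ 3)^-1)
      (- (Num.sqrt x ^+ 3) ^- 2 *: (3 * Num.sqrt x ^+ 2)).
    apply: is_deriveV; first by rewrite expf_neq0.
    by apply: is_derive_eq; rewrite /GRing.scale/=; ring.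
  by apply: is_derive_eq; rewrite /bessel1 /bessel2 /GRing.scale/=; field.
apply: is_derive_eq (is_derive_comp_sqrt x0 h) _.
by rewrite /sqrt_bessel2; field.
Qed.

(** The value 1/15 is the limit at 0. The first lower bound yields the main term for small
    frequencies; the second one serves in the tail, where the first is useless. *)
Lemma sqrt_bessel2_bounds x : 0 < x ->
  [/\ (1 - x / 14) / 15 <= sqrt_bessel2 x, - 1 / 15 <= sqrt_bessel2 x & sqrt_bessel2 x <= 1 / 15].
Proof.
move=> x0; have s0 : 0 < Num.sqrt x by rewrite sqrtr_gt0.
have xE : x = Num.sqrt x ^+ 2 by rewrite sqr_sqrtr// ltW.
rewrite /sqrt_bessel2; set z := Num.sqrt x in s0 xE *; rewrite {}xE.
split.
- rewrite ler_pdivlMr ?exprn_gt0//; apply: le_trans (bessel2_ge (ltW s0)).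
  by rewrite le_eqVlt; apply/orP; left; apply/eqP; field.
- rewrite ler_pdivlMr ?exprn_gt0//; apply: le_trans (bessel2_ge_opp (ltW s0)).
  by rewrite le_eqVlt; apply/orP; left; apply/eqP; field.
- rewrite ler_pdivrMr ?exprn_gt0//; apply: le_trans (bessel2_le (ltW s0)) _.
  by rewrite le_eqVlt; apply/orP; left; apply/eqP; field.
Qed.

Lemma le_increment_closed f g df dg a b : a <= b ->
  (forall x, a <= x <= b -> is_derive x 1 f (df x)) ->
  (forall x, a <= x <= b -> is_derive x 1 g (dg x)) ->
  (forall x, a < x < b -> df x <= dg x) -> f b - f a <= g b - g a.
Proof.
move=> ab hf hg; apply: le_increment => //.
- by move=> x /andP[ax xb]; apply: hf; rewrite !ltW.
- by move=> x /andP[ax xb]; apply: hg; rewrite !ltW.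
- apply: derivable_within_continuous => x; rewrite in_itv/= => xab.
  by case: (hf x xab).
- apply: derivable_within_continuous => x; rewrite in_itv/= => xab.
  by case: (hg x xab).
Qed.

Section bounds.
Variables (S m M : R).
(** With [m] and [M] abstract, the same integrations serve twice: with [m] equal to 1 - S / 14 for
    the main term, and to - 1 for the tail. *)
Hypothesis sqrt_bessel2mM : forall x, 0 < x < S -> m / 15 <= sqrt_bessel2 x <= M / 15.

Let sqrt_bessel1_diff x y : 0 < x -> x <= y -> y < S ->
  m / 30 * (y - x) <= sqrt_bessel1 x - sqrt_bessel1 y <= M / 30 * (y - x).
Proof.
move=> x0 xy yS.
have hN z : x <= z <= y -> is_derive z 1 (fun z : R => - sqrt_bessel1 z) (sqrt_bessel2 z / 2).
  move=> /andP[xz zy].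
  have h := is_derive_sqrt_bessel1 (lt_le_trans x0 xz).
  by apply: is_derive_eq; field.
have hl (c z : R) : x <= z <= y -> is_derive z 1 (fun z : R => c * z) c.
  by move=> _; apply: is_derive_eq; rewrite /GRing.scale/=; ring.
have kz z : x < z < y -> m / 15 <= sqrt_bessel2 z <= M / 15.
  by move=> /andP[xz zy]; apply: sqrt_bessel2mM; rewrite (lt_trans x0 xz) (lt_trans zy yS).
apply/andP; split.
  have := @le_increment_closed _ _ (fun=> m / 30) _ _ _ xy (hl (m / 30)) hN.
  have h z : x < z < y -> m / 30 <= sqrt_bessel2 z / 2 by move=> /kz /andP[? ?]; lra.
  by move=> /(_ h); lra.
have := @le_increment_closed _ _ _ (fun=> M / 30) _ _ xy hN (hl (M / 30)).
have h z : x < z < y -> sqrt_bessel2 z / 2 <= M / 30 by move=> /kz /andP[? ?]; lra.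
by move=> /(_ h); lra.
Qed.

(* If S = 2 (x ^+ 2 + y ^+ 2) and D = 4 x y, this is cos (x - y) - cos (x + y), that
   is 2 sin x sin y, and therefore sinc x * sinc y = 2 cos_gap D / D. *)
Definition cos_gap D : R := cos (Num.sqrt ((S - D) / 2)) - cos (Num.sqrt ((S + D) / 2)).
Definition cos_gap1 D : R := (sqrt_bessel0 ((S - D) / 2) + sqrt_bessel0 ((S + D) / 2)) / 4.
Definition cos_gap2 D : R := (sqrt_bessel1 ((S - D) / 2) - sqrt_bessel1 ((S + D) / 2)) / 16.

Lemma is_derive_affine (c e : R) f x (d : R) : is_derive ((c + e * x)) 1 f d ->
  is_derive x 1 (fun y : R => f (c + e * y)) (e * d).
Proof.
move=> h; apply: is_derive_eq; by rewrite /GRing.scale/=; ring.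
Qed.

Let affm D : (S - D) / 2 = S / 2 + (- 2^-1) * D. Proof. by field. Qed.
Let affp D : (S + D) / 2 = S / 2 + (2^-1) * D. Proof. by field. Qed.

Lemma is_derive_cos_gap D : - S < D < S -> is_derive D 1 cos_gap (cos_gap1 D).
Proof.
move=> /andP[D1 D2].
have p1 : 0 < (S - D) / 2 by lra.
have p2 : 0 < (S + D) / 2 by lra.
have h1 := is_derive_cos_sqrt p1; have h2 := is_derive_cos_sqrt p2.
rewrite affm in h1; rewrite affp in h2.
have := is_deriveB (is_derive_affine h1) (is_derive_affine h2).
have -> : (fun y : R => cos (Num.sqrt (S / 2 + (- 2^-1) * y))) -
   (fun y : R => cos (Num.sqrt (S / 2 + 2^-1 * y))) = cos_gap.
  by apply/funext => y; rewrite /cos_gap affm affp.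
by move=> h; apply: is_derive_eq h _; rewrite /cos_gap1 affm affp; field.
Qed.

Lemma is_derive_cos_gap1 D : - S < D < S -> is_derive D 1 cos_gap1 (cos_gap2 D).
Proof.
move=> /andP[D1 D2].
have p1 : 0 < (S - D) / 2 by lra.
have p2 : 0 < (S + D) / 2 by lra.
have h1 := is_derive_sqrt_bessel0 p1; have h2 := is_derive_sqrt_bessel0 p2.
rewrite affm in h1; rewrite affp in h2.
have h3 := is_deriveD (is_derive_affine h1) (is_derive_affine h2).
have h4 : is_derive D 1 ((fun=> 4^-1) * ((fun y : R => sqrt_bessel0 (S / 2 + (- 2^-1) * y)) +
   (fun y : R => sqrt_bessel0 (S / 2 + 2^-1 * y)))) (4^-1 * (- 2^-1 * (- sqrt_bessel1 (S / 2 + - 2^-1 * D) / 2) +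
          2^-1 * (- sqrt_bessel1 (S / 2 + 2^-1 * D) / 2))).
  by apply: is_derive_eq; rewrite /GRing.scale/=; ring.
move: h4.
have -> : (fun=> 4^-1) * ((fun y : R => sqrt_bessel0 (S / 2 + (- 2^-1) * y)) +
   (fun y : R => sqrt_bessel0 (S / 2 + 2^-1 * y))) = cos_gap1.
  by apply/funext => y; rewrite /cos_gap1 affm affp mulrC.
by move=> h; apply: is_derive_eq h _; rewrite /cos_gap2 affm affp; field.
Qed.

(** The derivative of [cos_gap D / D] is [T D / D ^+ 2]. As [T] vanishes at 0 and has derivative
    [D * cos_gap2 D], it is of order [D ^+ 3]. *)
Let T D := D * cos_gap1 D - cos_gap D.

Let T_bounds D : 0 <= D < S -> m / 1440 * D ^+ 3 <= T D <= M / 1440 * D ^+ 3.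
Proof.
move=> /andP[D0 DS].
have hT z : 0 <= z <= D -> is_derive z 1 T (z * cos_gap2 z).
  move=> /andP[z0 zD].
  have zS : - S < z < S by apply/andP; split; lra.
  have h1 := is_derive_cos_gap zS; have h2 := is_derive_cos_gap1 zS.
  by apply: is_derive_eq; rewrite /GRing.scale/=; ring.
have hl (c z : R) : 0 <= z <= D -> is_derive z 1 (fun z : R => c * z ^+ 3) (c * 3 * z ^+ 2).
  by move=> _; apply: is_derive_eq; rewrite /GRing.scale/=; ring.
have T0 : T 0 = 0 by rewrite /T /cos_gap mul0r subr0 addr0 subrr subr0.
have hd z : 0 < z < D -> m / 480 * z <= cos_gap2 z <= M / 480 * z.
  move=> /andP[z0 zD]; rewrite /cos_gap2.
  have /andP[] : m / 30 * ((S + z) / 2 - (S - z) / 2) <=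
    sqrt_bessel1 ((S - z) / 2) - sqrt_bessel1 ((S + z) / 2) <= M / 30 * ((S + z) / 2 - (S - z) / 2).
    by apply: sqrt_bessel1_diff; lra.
  move=> ? ?; apply/andP; split; lra.
apply/andP; split.
  have := @le_increment_closed _ _ _ _ _ _ D0 (hl (m / 1440)) hT.
  have h z : 0 < z < D -> m / 1440 * 3 * z ^+ 2 <= z * cos_gap2 z.
    move=> zD; have /andP[h _] := hd z zD; move: zD => /andP[z0 _].
    have : z * (m / 480 * z) <= z * cos_gap2 z by rewrite ler_pM2l.
    by apply: le_trans; rewrite le_eqVlt; apply/orP; left; apply/eqP; field.
  by move=> /(_ h); rewrite T0 expr0n/= mulr0 !subr0.
have := @le_increment_closed _ _ _ _ _ _ D0 hT (hl (M / 1440)).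
have h z : 0 < z < D -> z * cos_gap2 z <= M / 1440 * 3 * z ^+ 2.
  move=> zD; have /andP[_ h] := hd z zD; move: zD => /andP[z0 _].
  have : z * cos_gap2 z <= z * (M / 480 * z) by rewrite ler_pM2l.
  by move=> /le_trans; apply; rewrite le_eqVlt; apply/orP; left; apply/eqP; field.
by move=> /(_ h); rewrite T0 expr0n/= mulr0 !subr0.
Qed.

(** The case [D' = S] is that of two equal coordinates, met when a move ends on the diagonal. The
    square root is not differentiable there, hence derivatives inside the interval and mere
    continuity at its ends. *)
Lemma cos_gap_quotient_increment D D' : 0 < D -> D <= D' -> D' <= S ->
  m / 2880 * (D' ^+ 2 - D ^+ 2) <= cos_gap D' / D' - cos_gap D / D <= M / 2880 * (D' ^+ 2 - D ^+ 2).
Proof.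
move=> D0 DD' D'S.
have hA z : D < z < D' -> is_derive z 1 (fun z : R => cos_gap z / z) (T z / z ^+ 2).
  move=> /andP[z1 z2].
  have zS : - S < z < S by apply/andP; split; lra.
  have z0 : z != 0 by rewrite gt_eqF// (lt_trans D0).
  have h1 := is_derive_cos_gap zS.
  have hV : is_derive z 1 (fun z : R => z^-1) (- z ^- 2 *: 1) by exact: (@is_deriveV _ id).
  by apply: is_derive_eq; rewrite /T /GRing.scale/=; field.
have hl (c z : R) : D < z < D' -> is_derive z 1 (fun z : R => c * z ^+ 2) (c * 2 * z).
  by move=> _; apply: is_derive_eq; rewrite /GRing.scale/=; ring.
have cl (c : R) : {within `[D, D'], continuous (fun z : R => c * z ^+ 2)}.
  apply: continuous_subspaceT => x; apply: cvgM; first exact: cvg_cst.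
  exact: exprn_continuous.
have cb : continuous cos_gap.
  move=> x; apply: cvgB.
    apply: (@continuous_comp _ _ _ (fun D => Num.sqrt ((S - D) / 2)) cos); last exact: continuous_cos.
    apply: (@continuous_comp _ _ _ (fun D => (S - D) / 2) Num.sqrt); last exact: sqrt_continuous.
    by apply: cvgM; [apply: cvgB; [exact: cvg_cst|exact: cvg_id]|exact: cvg_cst].
  apply: (@continuous_comp _ _ _ (fun D => Num.sqrt ((S + D) / 2)) cos); last exact: continuous_cos.
  apply: (@continuous_comp _ _ _ (fun D => (S + D) / 2) Num.sqrt); last exact: sqrt_continuous.
  by apply: cvgM; [apply: cvgD; [exact: cvg_cst|exact: cvg_id]|exact: cvg_cst].
have cA : {within `[D, D'], continuous (fun z : R => cos_gap z / z)}.
  apply: continuous_in_subspaceT => x; rewrite inE/= in_itv/= => /andP[xD _].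
  apply: cvgM; first exact: cb.
  by apply: cvgV; [rewrite gt_eqF// (lt_le_trans D0)|exact: cvg_id].
apply/andP; split.
  have := @le_increment _ _ _ _ _ _ _ DD' (hl (m / 2880)) hA (cl _) cA.
  have h z : D < z < D' -> m / 2880 * 2 * z <= T z / z ^+ 2.
    move=> /andP[z1 z2].
    have z0 : 0 < z by exact: lt_trans z1.
    have /andP[h _] : m / 1440 * z ^+ 3 <= T z <= M / 1440 * z ^+ 3.
      by apply: T_bounds; rewrite (ltW z0) (lt_le_trans z2).
    rewrite ler_pdivlMr ?exprn_gt0//; apply: le_trans h.
    by rewrite le_eqVlt; apply/orP; left; apply/eqP; field.
  by move=> /(_ h); rewrite mulrBr.
have := @le_increment _ _ _ _ _ _ _ DD' hA (hl (M / 2880)) cA (cl _).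
have h z : D < z < D' -> T z / z ^+ 2 <= M / 2880 * 2 * z.
  move=> /andP[z1 z2].
  have z0 : 0 < z by exact: lt_trans z1.
  have /andP[_ h] : m / 1440 * z ^+ 3 <= T z <= M / 1440 * z ^+ 3.
    by apply: T_bounds; rewrite (ltW z0) (lt_le_trans z2).
  rewrite ler_pdivrMr ?exprn_gt0//; apply: le_trans h _.
  by rewrite le_eqVlt; apply/orP; left; apply/eqP; field.
by move=> /(_ h); rewrite mulrBr.
Qed.

End bounds.

End pair.

Section sinc.
Context {R : realType}.
Implicit Types (x y u : R).

(* As 0^-1 = 0, the second summand vanishes at 0. *)
Definition sinc x : R := (x == 0)%:R + sin x / x.

Lemma sinc0 : sinc 0 = 1.
Proof. by rewrite /sinc eqxx invr0 mulr0 addr0. Qed.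

Lemma sincE x : x != 0 -> sinc x = sin x / x.
Proof. by rewrite /sinc => /negPf ->; rewrite add0r. Qed.

Lemma sincN x : sinc (- x) = sinc x.
Proof. by rewrite /sinc oppr_eq0 sinN invrN mulrNN. Qed.

Lemma sincM x : sinc x * x = sin x.
Proof.
have [->|x0] := eqVneq x 0; first by rewrite sin0 mulr0.
by rewrite sincE// divfK.
Qed.

Lemma normr_sin_le x : `|sin x| <= `|x|.
Proof.
have h (y : R) : 0 <= y -> `|sin y| <= y by move=> y0; rewrite ler_norml sin_ge_opp// sin_le_id.
case: (ger0P x) => x0; first exact: h.
by rewrite -normrN -sinN; apply: h; rewrite oppr_ge0 ltW.
Qed.

Lemma normr_sinc_le1 x : `|sinc x| <= 1.
Proof.
have [->|x0] := eqVneq x 0; first by rewrite sinc0 normr1.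
by rewrite sincE// normf_div ler_pdivrMr ?normr_gt0// mul1r normr_sin_le.
Qed.

Lemma normr_sinc_leV x : x != 0 -> `|sinc x| <= `|x|^-1.
Proof.
move=> x0; rewrite sincE// normf_div -[leRHS]mul1r ler_pM2r ?invr_gt0 ?normr_gt0//.
exact: sin_max.
Qed.

Lemma sinc_ge x : 1 - x ^+ 2 / 6 <= sinc x.
Proof.
have h (y : R) : 0 <= y -> 1 - y ^+ 2 / 6 <= sinc y.
  rewrite le_eqVlt => /predU1P[<-|y0]; first by rewrite sinc0 expr0n/= mul0r subr0.
  rewrite sincE ?gt_eqF// ler_pdivlMr//; apply: le_trans (sin_ge3 (ltW y0)).
  by rewrite le_eqVlt; apply/orP; left; apply/eqP; field.
case: (ger0P x) => x0; first exact: h.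
by rewrite -sincN -sqrrN; apply: h; rewrite oppr_ge0 ltW.
Qed.

Lemma sinc_le x : sinc x <= 1 - x ^+ 2 / 6 + x ^+ 4 / 120.
Proof.
have h (y : R) : 0 <= y -> sinc y <= 1 - y ^+ 2 / 6 + y ^+ 4 / 120.
  rewrite le_eqVlt => /predU1P[<-|y0].
    by rewrite sinc0 !expr0n/= !mul0r subr0 addr0.
  rewrite sincE ?gt_eqF// ler_pdivrMr//; apply: le_trans (sin_le5 (ltW y0)) _.
  by rewrite le_eqVlt; apply/orP; left; apply/eqP; field.
case: (ger0P x) => x0; first exact: h.
have := h (- x); rewrite sincN sqrrN (_ : (- x) ^+ 4 = x ^+ 4); last by ring.
by apply; rewrite oppr_ge0 ltW.
Qed.

Lemma continuous_sinc : continuous sinc.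
Proof.
move=> x; have [->|x0] := eqVneq x 0.
  apply/cvgrPdist_le => e e0; near=> y.
  rewrite sinc0 ger0_norm; last first.
    by rewrite subr_ge0; apply: le_trans (normr_sinc_le1 y); exact: ler_norm.
  apply: (@le_trans _ _ (y ^+ 2 / 6)); first by have := sinc_ge y; lra.
  have y1 : `|y| < 1 by near: y; apply/nbhs_ballP; exists 1 => //= y; rewrite /ball/= sub0r normrN.
  have ye : `|y| < e by near: y; apply/nbhs_ballP; exists e => //= y; rewrite /ball/= sub0r normrN.
  rewrite -real_normK ?num_real//; have := normr_ge0 y; nra.
have : {for x, continuous (fun y : R => sin y / y)}.
  by apply: cvgM; [exact: continuous_sin|apply: cvgV; [exact: x0|exact: cvg_id]].
rewrite /continuous_at sincE//; apply: cvg_trans; apply: near_eq_cvg.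
near=> y; rewrite sincE//.
near: y; apply/nbhs_ballP; exists `|x|; rewrite /= ?normr_gt0// => y.
rewrite /ball/=; by apply: contraTneq => ->; rewrite subr0 ltxx.
Unshelve. all: by end_near. Qed.

Lemma sinc_mul x y : x != 0 -> y != 0 ->
  sinc x * sinc y = (cos (x - y) - cos (x + y)) / (2 * x * y).
Proof.
move=> x0 y0; rewrite !sincE// cosB cosD; field.
by rewrite x0 y0.
Qed.

Let cos_sqrt_sqr x : cos (Num.sqrt (x ^+ 2)) = cos x.
Proof. by rewrite sqrtr_sqr cos_norm. Qed.

(** Both pairs share [S], here [s * u ^+ 2], so only [D] moves, from [b1 * b2 * u ^+ 2] to
    [b3 * b4 * u ^+ 2]. The constant 1440 is 15 * 2 * 16 * 3: the limit of [sqrt_bessel2] at 0, the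
    factors in the derivatives and the integration of a square. The last integration divides by 2,
    which the factor of [2 * cos_gap D / D] cancels. *)
Lemma sinc_pair_increment (b1 b2 b3 b4 s u : R) :
  0 < b1 -> 0 < b2 -> 0 < b3 -> 0 < b4 ->
  b1 ^+ 2 + b2 ^+ 2 = 2 * s -> b3 ^+ 2 + b4 ^+ 2 = 2 * s -> b1 * b2 <= b3 * b4 ->
  let g := ((b3 * b4) ^+ 2 - (b1 * b2) ^+ 2) / 1440 * u ^+ 4 in
  let delta := sinc (b3 * u / 2) * sinc (b4 * u / 2) -
               sinc (b1 * u / 2) * sinc (b2 * u / 2) in
  [/\ (1 - s * u ^+ 2 / 14) * g <= delta, delta <= g & - g <= delta].
Proof.
move=> b10 b20 b30 b40 s12 s34 b1234 g delta.
have [u0|u0] := eqVneq u 0.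
  by rewrite /g /delta u0 !expr0n/= !mulr0 !mul0r !sinc0 subrr oppr0 lexx.
pose S := s * u ^+ 2.
have u20 : 0 < u ^+ 2 by rewrite exprn_even_gt0.
have S0 : 0 < S by apply: mulr_gt0 => //; nra.
have E (x y : R) : 0 < x -> 0 < y -> x ^+ 2 + y ^+ 2 = 2 * s ->
    sinc (x * u / 2) * sinc (y * u / 2) = 2 * (cos_gap S (x * y * u ^+ 2) / (x * y * u ^+ 2)).
  move=> x0 y0 sxy; rewrite sinc_mul; last 2 first.
  - by rewrite !mulf_neq0// ?invr_neq0 ?pnatr_eq0 ?gt_eqF.
  - by rewrite !mulf_neq0// ?invr_neq0 ?pnatr_eq0 ?gt_eqF.
  rewrite /cos_gap /S.
  have -> : (s * u ^+ 2 - x * y * u ^+ 2) / 2 = (x * u / 2 - y * u / 2) ^+ 2.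
    have -> : s = (x ^+ 2 + y ^+ 2) / 2 by rewrite sxy; field.
    by field.
  have -> : (s * u ^+ 2 + x * y * u ^+ 2) / 2 = (x * u / 2 + y * u / 2) ^+ 2.
    have -> : s = (x ^+ 2 + y ^+ 2) / 2 by rewrite sxy; field.
    by field.
  rewrite !cos_sqrt_sqr; field.
  by rewrite u0 !gt_eqF.
have deltaE : delta = 2 * (cos_gap S (b3 * b4 * u ^+ 2) / (b3 * b4 * u ^+ 2) -
    cos_gap S (b1 * b2 * u ^+ 2) / (b1 * b2 * u ^+ 2)).
  by rewrite /delta !E// mulrBr.
have D0 : 0 < b1 * b2 * u ^+ 2 by rewrite mulr_gt0// mulr_gt0.
have DD' : b1 * b2 * u ^+ 2 <= b3 * b4 * u ^+ 2 by rewrite ler_pM2r.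
have D'S : b3 * b4 * u ^+ 2 <= S.
  rewrite ler_pM2r//; have := sqr_ge0 (b3 - b4); nra.
have gE : g = 2 * (((b3 * b4 * u ^+ 2) ^+ 2 - (b1 * b2 * u ^+ 2) ^+ 2) / 2880).
  by rewrite /g; field.
have H1 := @cos_gap_quotient_increment _ S (1 - S / 14) 1.
have H2 := @cos_gap_quotient_increment _ S (- 1) 1.
have /H1/(_ _ _ D0 DD' D'S)/andP[h1 h2] : forall x : R, 0 < x < S -> (1 - S / 14) / 15 <= sqrt_bessel2 x <= 1 / 15.
  move=> x /andP[x0 xS]; have [k1 _ ->] := sqrt_bessel2_bounds x0; rewrite andbT.
  by apply: le_trans k1; move: xS; clear; lra.
have /H2/(_ _ _ D0 DD' D'S)/andP[h3 _] : forall x : R, 0 < x < S -> - 1 / 15 <= sqrt_bessel2 x <= 1 / 15.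
  by move=> x /andP[x0 xS]; have [_ -> ->] := sqrt_bessel2_bounds x0.
rewrite deltaE gE -/S; move: h1 h2 h3.
set A := _ / _ - _; set Q := _ ^+ 2 - _.
move: A Q (2880^-1 : R) => A Q k h1 h2 h3; clearbody S; clear -h1 h2 h3.
by split; lra.
Qed.

End sinc.

(** * The Fourier formula *)

Section cauchy_decay.
Context {R : realType}.
Notation mu := (@lebesgue_measure R).
Implicit Types (f g : R -> R) (x u : R).

Lemma integrable_oneDsqrV : mu.-integrable setT (EFin \o (fun x : R => (1 + x ^+ 2)^-1)).
Proof.
have c : continuous (fun x : R => (1 + x ^+ 2)^-1) := @continuous_oneDsqrV R.
have p x : 0 <= (1 + x ^+ 2)^-1 by rewrite invr_ge0 addr_ge0// sqr_ge0.
apply/integrableP; split.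
  by apply/measurable_EFinP; exact: continuous_measurable_fun.
rewrite (_ : (fun x => _) = (fun x : R => ((1 + x ^+ 2)^-1)%:E)); last first.
  by apply/funext => x /=; rewrite ger0_norm.
rewrite ge0_symfun_integralT//; last by move=> x /=; rewrite sqrrN.
rewrite (_ : [set x | _] = `[0, +oo[%classic); last first.
  by apply/seteqP; split => x/=; rewrite in_itv/= andbT.
by have /= -> := @integral0y_oneDsqr R; rewrite -EFinM ltry.
Qed.

(** Stronger than integrability on purpose: it also forces the limit 0 at infinity that integration
    by parts requires. Products of two cardinal sines and Gaussians times powers satisfy it. *)
Definition cauchy_decay f :=
  measurable_fun [set: R] f /\ exists C : R, forall x, `|f x| <= C / (1 + x ^+ 2).

Lemma cauchy_decay_integrable f : cauchy_decay f -> mu.-integrable setT (EFin \o f).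
Proof.
move=> [mf [C fC]].
apply: (@le_integrable _ _ _ mu setT _ _ (fun x => (C%:E * ((1 + x ^+ 2)^-1)%:E)%E)) => //.
- exact/measurable_EFinP.
- move=> x _ /=; rewrite lee_fin; apply: le_trans (fC x) _.
  exact: ler_norm.
- exact: (integrableZl measurableT C integrable_oneDsqrV).
Qed.

Lemma cauchy_decayM f g (B : R) : cauchy_decay f -> measurable_fun [set: R] g ->
  (forall x, `|g x| <= B) -> cauchy_decay (fun x => f x * g x).
Proof.
move=> [mf [C fC]] mg gB; split; first exact: measurable_funM.
exists (C * B) => x; rewrite normrM mulrAC.
by apply: ler_pM.
Qed.

Lemma cauchy_decayD f g : cauchy_decay f -> cauchy_decay g ->
  cauchy_decay (fun x => f x + g x).
Proof.
move=> [mf [C fC]] [mg [D gD]]; split; first exact: measurable_funD.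
exists (C + D) => x; rewrite mulrDl; apply: le_trans (ler_normD _ _) _.
exact: lerD.
Qed.

Lemma cauchy_decayZ f (k : R) : cauchy_decay f -> cauchy_decay (fun x => k * f x).
Proof.
move=> [mf [C fC]]; split; first exact: measurable_funM.
by exists (`|k| * C) => x; rewrite normrM -mulrA ler_wpM2l.
Qed.

Lemma cauchy_decayB f g : cauchy_decay f -> cauchy_decay g ->
  cauchy_decay (fun x => f x - g x).
Proof.
move=> hf hg; have := cauchy_decayD hf (cauchy_decayZ (- 1) hg).
by under eq_fun do rewrite mulN1r.
Qed.

Lemma cauchy_decay_norm f : cauchy_decay f -> cauchy_decay (fun x => `|f x|).
Proof.
move=> [mf [C fC]]; split; first exact: measurableT_comp.
by exists C => x; rewrite normr_id.
Qed.

Lemma cauchy_decay_le f g : cauchy_decay f -> measurable_fun [set: R] g ->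
  (forall x, `|g x| <= `|f x|) -> cauchy_decay g.
Proof.
by move=> [mf [C fC]] mg gf; split=> //; exists C => x; exact: le_trans (gf x) _.
Qed.

Lemma cauchy_decay_Fubini f (G : R -> R -> R) : cauchy_decay f ->
  measurable_fun [set: R * R] (fun z => G z.1 z.2) ->
  (forall x u, `|G x u| <= 1) ->
  (\int[mu]_(x in `[0%R, 1%R]) (\int[mu]_u (f u * G x u))%:E)%E =
  (\int[mu]_u (f u * \int[mu]_(x in `[0, 1]) G x u))%:E.
Proof.
move=> hf mG G1.
have [mf [C fC]] := hf.
have mG1 u : measurable_fun [set: R] (G ^~ u).
  by apply: (@measurableT_comp _ _ _ _ _ _ (fun z : R * R => G z.1 z.2) _ (fun x => (x, u))) => //; exact: measurable_fun_pair.
have mG2 x : measurable_fun [set: R] (G x).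
  by apply: (@measurableT_comp _ _ _ _ _ _ (fun z : R * R => G z.1 z.2) _ (fun u => (x, u))) => //; exact: measurable_fun_pair.
have dG x : cauchy_decay (fun u => f u * G x u) by exact: (cauchy_decayM hf (mG2 x) (G1 x)).
pose I01 : R -> R := \1_(`[0, 1]%classic : set R).
have mI : measurable_fun [set: R] I01 by exact: measurable_indic.
pose F (z : measurableTypeR R * measurableTypeR R) : \bar R := (I01 z.1 * (f z.2 * G z.1 z.2))%:E.
have mF : measurable_fun setT F.
  apply/measurable_EFinP; apply: measurable_funM; first exact: (measurableT_comp mI).
  by apply: measurable_funM => //; exact: (measurableT_comp mf).
have EI (h : R -> R) (x : R) : (I01 x * h x)%:E = ((EFin \o h) \_ `[0%R, 1%R]%classic) x.
  rewrite /I01 indicE patchE; case: ifPn => _; first by rewrite mul1r.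
  by rewrite mul0r.
have intF : (mu \x mu)%E.-integrable setT F.
  apply: (proj2 (@integrable12ltyP _ _ (measurableTypeR R) (measurableTypeR R) R mu mu F mF)).
  apply: (@le_lt_trans _ _ (\int[mu]_(x in `[0%R, 1%R]) (\int[mu]_u `|f u|)%:E)%E).
    rewrite [leRHS]integral_mkcond; apply: ge0_le_integral => //.
    - by move=> x _; exact: integral_ge0.
    - apply: (measurable_fun_fubini_tonelli_F (abse \o F)) => //=.
      exact: measurableT_comp.
    - apply/(measurable_restrictT _ _).1 => //.
    - move=> x _; rewrite patchE /F /= /I01 indicE; case: ifPn => _ /=; last first.
        by under eq_integral do rewrite mul0r normr0; rewrite integral0.
      have fin := cauchy_decay_integrable (cauchy_decay_norm hf).
      rewrite /Rintegral fineK; last exact: integrable_fin_num.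
      apply: ge0_le_integral => //.
      + by apply/measurable_EFinP; apply: measurableT_comp => //; apply: measurable_funM => //; exact: (dG x).1.
      + by apply/measurable_EFinP; apply: measurableT_comp.
      + move=> u _; rewrite lee_fin mul1r normrM -[leRHS]mulr1; exact: ler_pM.
  by rewrite integral_cst//= lebesgue_measure_itv/= lte01 oppr0 adde0 mule1 ltry.
have := Fubini intF; rewrite /F/= => H.
have L x : (\int[mu]_y (I01 x * (f y * G x y))%:E)%E =
    ((fun x => (\int[mu]_u (f u * G x u))%:E) \_ `[0%R, 1%R]%classic) x.
  rewrite /I01 indicE patchE; case: ifPn => _; last first.
    by under eq_integral do rewrite mul0r; rewrite integral0.
  under eq_integral do rewrite mul1r.
  by rewrite /Rintegral fineK//; exact: (integrable_fin_num measurableT (cauchy_decay_integrable (dG x))).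
have iG u : mu.-integrable `[0, 1]%classic (EFin \o (G ^~ u)).
  apply: measurable_bounded_integrable => //.
  - by rewrite /= lebesgue_measure_itv/= lte01 oppr0 adde0 ltry.
  - exact: measurable_funS (mG1 u).
  - exists 1; split => // t t1 z _; exact: le_trans (G1 _ _) (ltW t1).
have Rr u : (\int[mu]_x (I01 x * (f u * G x u))%:E)%E =
    (f u * \int[mu]_(x in `[0, 1]) G x u)%:E.
  under eq_integral do rewrite (EI (fun x => f u * G x u)).
  rewrite -integral_mkcond.
  under eq_integral do rewrite /= EFinM.
  rewrite integralZl//; last exact: iG.
  by rewrite -[X in (_ * X)%E]fineK; last exact: integrable_fin_num (iG u).
have fn := integrable_fin_num measurableT (integrable_fubini_F intF).
rewrite /fubini_F /F /= H in fn.
rewrite integral_mkcond.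
under eq_integral do rewrite -L.
move: fn; rewrite H; under eq_integral do rewrite Rr.
by move=> fn; rewrite /Rintegral fineK.
Qed.

End cauchy_decay.

Section fourier.
Context {R : realType}.
Notation mu := (@lebesgue_measure R).
Implicit Types (x u w r t : R).

(** The induction step of the Fourier formula: averaging over one more coordinate multiplies the
    integrand by a cardinal sine and moves the phase to the middle of the segment. *)
Lemma Rintegral_cos_affine (A r u : R) : 0 < r ->
  \int[mu]_(x in `[0, 1]) cos ((A - r * x) * u) = sinc (r * u / 2) * cos ((A - r / 2) * u).
Proof.
move=> r0; have [->|u0] := eqVneq u 0.
  under eq_Rintegral do rewrite mulr0 cos0.
  rewrite Rintegral_cst//= lebesgue_measure_itv/= lte01/= ?oppr0 ?adde0 ?addr0/=.
  by rewrite !mulr0 mul0r sinc0 cos0.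
have ru0 : r * u != 0 by rewrite mulf_neq0// gt_eqF.
rewrite /Rintegral (@continuous_FTC2 _ _ (fun x => - sin ((A - r * x) * u) / (r * u)))//=.
- rewrite sincE; last by rewrite mulf_neq0// invr_neq0.
  have -> : (A - r * 1) * u = (A - r / 2) * u - r * u / 2 by field.
  have -> : (A - r * 0) * u = (A - r / 2) * u + r * u / 2 by field.
  rewrite sinB sinD; field.
  by rewrite u0 gt_eqF.
- apply: continuous_subspaceT => x.
  apply: (@continuous_comp _ _ _ (fun x => (A - r * x) * u) cos); last exact: continuous_cos.
  apply: cvgM; last exact: cvg_cst.
  by apply: cvgB; [exact: cvg_cst|apply: cvgM; [exact: cvg_cst|exact: cvg_id]].
- have c : continuous (fun x => - sin ((A - r * x) * u) / (r * u)).
    move=> x; apply: cvgM; last exact: cvg_cst.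
    apply: cvgN; apply: (@continuous_comp _ _ _ (fun x => (A - r * x) * u) sin); last exact: continuous_sin.
    apply: cvgM; last exact: cvg_cst.
    by apply: cvgB; [exact: cvg_cst|apply: cvgM; [exact: cvg_cst|exact: cvg_id]].
  split.
  + by move=> x _; apply: ex_derive.
  + by apply: cvg_at_right_filter; exact: c.
  + by apply: cvg_at_left_filter; exact: c.
- move=> x _; rewrite derive1E.
  have h : is_derive x 1 (fun x => - sin ((A - r * x) * u) / (r * u)) (cos ((A - r * x) * u)).
    apply: is_derive_eq; rewrite /GRing.scale/=; field.
    by rewrite u0 gt_eqF.
  exact: derive_val.
Qed.

(** The function (1 - cos u) / u^2, extended by its limit at 0: a Fejer kernel on the line. *)
Definition fejer u : R := sinc (u / 2) ^+ 2 / 2.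

Lemma fejerE u : fejer u * u ^+ 2 = 1 - cos u.
Proof.
rewrite /fejer; have := sincM (u / 2); set s := sinc _ => h.
have -> : s ^+ 2 / 2 * u ^+ 2 = 2 * (s * (u / 2)) ^+ 2 by field.
rewrite h; have -> : cos u = cos (u / 2 + u / 2) by congr cos; field.
by rewrite cosD -!expr2 sin2cos2; ring.
Qed.

Lemma continuous_sinc_dilate (c : R) : continuous (fun u => sinc (c * u / 2)).
Proof.
move=> x; apply: (@continuous_comp _ _ _ (fun u => c * u / 2) sinc); last exact: continuous_sinc.
by apply: cvgM; [apply: cvgM; [exact: cvg_cst|exact: cvg_id]|exact: cvg_cst].
Qed.

Lemma measurable_sinc_dilate (c : R) : measurable_fun [set: R] (fun u => sinc (c * u / 2)).
Proof. by apply: continuous_measurable_fun; exact: continuous_sinc_dilate. Qed.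

Lemma cauchy_decay_sinc2 (a b : R) : 0 < a -> 0 < b ->
  cauchy_decay (fun u => sinc (a * u / 2) * sinc (b * u / 2)).
Proof.
move=> a0 b0; split.
  by apply: measurable_funM; exact: measurable_sinc_dilate.
exists (1 + 4 / (a * b)) => u; rewrite ler_pdivlMr; last by rewrite ltr_pwDl// sqr_ge0.
rewrite normrM mulrDr mulr1; apply: lerD.
  by rewrite -[leRHS]mulr1; apply: ler_pM => //; exact: normr_sinc_le1.
have -> : `|sinc (a * u / 2)| * `|sinc (b * u / 2)| * u ^+ 2 =
   4 / (a * b) * (`|sinc (a * u / 2) * (a * u / 2)| * `|sinc (b * u / 2) * (b * u / 2)|).
  have n2 : `|2^-1 : R| = 2^-1 by rewrite ger0_norm// invr_ge0.
  rewrite !normrM -(real_normK (num_real u)) n2 (gtr0_norm a0) (gtr0_norm b0).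
  by field; rewrite !gt_eqF.
rewrite -[leRHS]mulr1; apply: ler_pM => //.
- by rewrite divr_ge0// mulr_ge0// ltW.
- by rewrite !sincM -[leRHS]mulr1; apply: ler_pM => //; exact: sin_max.
Qed.

Lemma cauchy_decay_fejer : cauchy_decay fejer.
Proof.
have := cauchy_decayZ 2^-1 (@cauchy_decay_sinc2 1 1 ltr01 ltr01).
move=> h; apply: (cauchy_decay_le h).
  apply: measurable_funM => //; apply: measurable_funX.
  by have := measurable_sinc_dilate 1; under eq_fun do rewrite mul1r.
by move=> x; rewrite /fejer mul1r expr2 mulrC.
Qed.

(** Its value is pi, but only its positivity is used. *)
Definition fejer_mass : R := \int[mu]_u fejer u.

Lemma fejer_mass_gt0 : 0 < fejer_mass.
Proof.
apply: (@lt_le_trans _ _ (8^-1)); first by rewrite invr_gt0.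
have mi : mu.-integrable setT (EFin \o (fun u => 8^-1 * (\1_(`[0, 1]%classic : set R) u))).
  apply: (@eq_integrable _ _ _ mu setT measurableT
     (fun u => (8^-1)%:E * (\1_(`[0, 1]%classic : set R) u)%:E)%E) => //.
  by apply: integrableZl => //; exact: integrable_indic_itv.
apply: (@le_trans _ _ (\int[mu]_u (8^-1 * (\1_(`[0, 1]%classic : set R) u)))).
  rewrite RintegralZl//; last exact: integrable_indic_itv.
  rewrite /Rintegral integral_indic//= setIT lebesgue_measure_itv/= lte01.
  by rewrite oppr0 adde0/= mulr1.
apply: le_Rintegral => //.
  exact: (cauchy_decay_integrable cauchy_decay_fejer).
move=> u _; rewrite indicE; case: (boolP (u \in _)) => [|_] /=; last first.
  by rewrite mulr0 /fejer divr_ge0// sqr_ge0.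
rewrite inE/= in_itv/= mulr1 => /andP[u0 u1].
have h := sinc_ge (u / 2).
have h2 : 2^-1 <= sinc (u / 2) by apply: le_trans h; nra.
rewrite /fejer; nra.
Qed.

(** Since [a ^+ 2 * fejer (a * u)] is (1 - cos (a u)) / u^2, this represents absolute values as
    integrals over frequencies, in place of Fourier inversion. *)
Lemma Rintegral_fejer_dilate (a : R) :
  \int[mu]_u (a ^+ 2 * fejer (a * u)) = `|a| * fejer_mass.
Proof.
have [->|a0] := eqVneq a 0.
  under eq_Rintegral do rewrite expr0n/= mul0r.
  by rewrite Rintegral_cst// mul0r normr0 mul0r.
have f0 (x : R) : 0 <= fejer x by rewrite /fejer divr_ge0// sqr_ge0.
have ch : cauchy_decay (fun u => fejer (a * u)).
  have aa : 0 < `|a| by rewrite normr_gt0.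
  have := cauchy_decayZ 2^-1 (cauchy_decay_sinc2 aa aa).
  move=> h; apply: (cauchy_decay_le h).
    apply: measurable_funM => //; apply: measurable_funX.
    exact: measurable_sinc_dilate.
  move=> x; have -> : sinc (`|a| * x / 2) = sinc (a * x / 2).
    by case: (ger0P a) => // _; rewrite !mulNr sincN.
  by rewrite /fejer expr2 mulrC.
rewrite RintegralZl//; last exact: (cauchy_decay_integrable ch).
rewrite /fejer_mass /Rintegral.
have mf : measurable_fun [set: R] (EFin \o fejer).
  by apply/measurable_EFinP; exact: cauchy_decay_fejer.1.
have <- := @ge0_integral_affine R a 0 (EFin \o fejer) a0 mf (fun x => f0 x).
have fin := integrable_fin_num measurableT (cauchy_decay_integrable ch).
under [in RHS]eq_integral do rewrite /= addr0.
rewrite fineM//= mulrA -[X in X * _ = _](real_normK (num_real a)) -expr2.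
by [].
Qed.

End fourier.

Section fourier_slab.
Context {R : realType}.
Notation mu := (@lebesgue_measure R).
Implicit Types (x u w t tau : R).

(** Times [u ^+ 2], the left side is 4 sin (w u / 2) sin (r u / 2) cos (tau u), a signed sum of four
    cosines. The signs add up to 0, so each cosine may be replaced by the opposite of 1 - cos, which
    [fejer] controls at 0. *)
Lemma sinc_sinc_cos_fejer (w r tau u : R) :
  w * r * (sinc (w * u / 2) * sinc (r * u / 2) * cos (tau * u)) =
  ((w + r) / 2 + tau) ^+ 2 * fejer (((w + r) / 2 + tau) * u)
  + ((w + r) / 2 - tau) ^+ 2 * fejer (((w + r) / 2 - tau) * u)
  - ((w - r) / 2 + tau) ^+ 2 * fejer (((w - r) / 2 + tau) * u)
  - ((w - r) / 2 - tau) ^+ 2 * fejer (((w - r) / 2 - tau) * u).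
Proof.
have [->|u0] := eqVneq u 0.
  by rewrite !mulr0 !mul0r /fejer !mul0r sinc0 cos0 expr1n; field.
have u2 : u ^+ 2 != 0 by rewrite expf_neq0.
apply: (mulIf u2).
have E (a : R) : a ^+ 2 * fejer (a * u) * u ^+ 2 = 1 - cos (a * u).
  by rewrite -fejerE; ring.
have E4 (a b c e : R) : (a ^+ 2 * fejer (a * u) + b ^+ 2 * fejer (b * u)
    - c ^+ 2 * fejer (c * u) - e ^+ 2 * fejer (e * u)) * u ^+ 2 =
    cos (c * u) + cos (e * u) - cos (a * u) - cos (b * u).
  by rewrite mulrBl mulrBl mulrDl !E; ring.
rewrite E4.
have -> : w * r * (sinc (w * u / 2) * sinc (r * u / 2) * cos (tau * u)) * u ^+ 2 =
  4 * (sinc (w * u / 2) * (w * u / 2)) * (sinc (r * u / 2) * (r * u / 2)) * cos (tau * u).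
  by field.
rewrite !sincM.
have -> : ((w + r) / 2 + tau) * u = (w * u / 2 + r * u / 2) + tau * u by field.
have -> : ((w + r) / 2 - tau) * u = (w * u / 2 + r * u / 2) - tau * u by field.
have -> : ((w - r) / 2 + tau) * u = (w * u / 2 - r * u / 2) + tau * u by field.
have -> : ((w - r) / 2 - tau) * u = (w * u / 2 - r * u / 2) - tau * u by field.
by rewrite !(cosD, sinD, cosN, sinN); ring.
Qed.

Lemma Rintegral_sinc_sinc_cos (w r tau : R) : 0 < w -> 0 < r ->
  w * r * \int[mu]_u (sinc (w * u / 2) * sinc (r * u / 2) * cos (tau * u)) =
  fejer_mass * (`|(w + r) / 2 + tau| + `|(w + r) / 2 - tau| -
                `|(w - r) / 2 + tau| - `|(w - r) / 2 - tau|).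
Proof.
move=> w0 r0.
have cd (a : R) : cauchy_decay (fun u => a ^+ 2 * fejer (a * u)).
  have [->|a0] := eqVneq a 0.
    have := cauchy_decayZ 0 (@cauchy_decay_fejer R).
    by under eq_fun do rewrite mul0r; under [in X in _ -> X]eq_fun do rewrite expr0n/= mul0r.
  have aa : 0 < `|a| by rewrite normr_gt0.
  have h := cauchy_decayZ (a ^+ 2 / 2) (cauchy_decay_sinc2 aa aa).
  apply: (cauchy_decay_le h).
    apply: measurable_funM => //; apply: measurable_funM => //; apply: measurable_funX.
    exact: measurable_sinc_dilate.
  move=> x; have -> : sinc (`|a| * x / 2) = sinc (a * x / 2).
    by case: (ger0P a) => // _; rewrite !mulNr sincN.
  rewrite le_eqVlt; apply/orP; left; apply/eqP; congr (`|_|).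
  by rewrite /fejer; field.
have ccd (a : R) := cauchy_decay_integrable (cd a).
have mcos : measurable_fun [set: R] (fun u => cos (tau * u)).
  by apply: continuous_measurable_fun => x; apply: continuous_comp;
    [apply: cvgM; [exact: cvg_cst|exact: cvg_id]|exact: continuous_cos].
rewrite -RintegralZl//; last first.
  apply: cauchy_decay_integrable; apply: (cauchy_decayM (cauchy_decay_sinc2 w0 r0) mcos) => x.
  exact: cos_max.
under eq_Rintegral do rewrite sinc_sinc_cos_fejer.
have c1 := cauchy_decayD (cd ((w + r) / 2 + tau)) (cd ((w + r) / 2 - tau)).
have c2 := cauchy_decayB c1 (cd ((w - r) / 2 + tau)).
rewrite RintegralB//; last exact: cauchy_decay_integrable.
rewrite RintegralB//; last exact: cauchy_decay_integrable.
rewrite RintegralD// !Rintegral_fejer_dilate; ring.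
Qed.

(** A trapezoid as a function of [tau], written with the four absolute values that
    [Rintegral_sinc_sinc_cos] produces. *)
Lemma slab_length (w r tau : R) : 0 < w -> 0 < r ->
  (\int[mu]_(x in `[0%R, 1%R]) (\1_(`[0, w]%classic : set R) (tau - r * x))%:E)%E =
  ((`|tau| + `|w + r - tau| - `|w - tau| - `|r - tau|) / (2 * r))%:E.
Proof.
move=> w0 r0.
pose lo : R := Num.max 0 ((tau - w) / r); pose hi : R := Num.min 1 (tau / r).
transitivity (\int[mu]_x (\1_(`[lo, hi]%classic : set R) x)%:E)%E.
  rewrite integral_mkcond; apply: eq_integral => x _.
  rewrite patchE !indicE !mem_setE /= !in_itv/= /lo /hi ge_max le_min.
  rewrite ler_pdivrMr// ler_pdivlMr//.
  case: ifPn => x01.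
    move: x01 => /andP[-> ->] /=.
    congr ((nat_of_bool _)%:R%:E); apply/andP/andP => -[? ?]; split; nra.
  move: x01; rewrite negb_and => /orP[] /negPf ->.
    by [].
  by rewrite /= andbF.
rewrite integral_indic//= setIT lebesgue_measure_itv/= lte_fin.
have rn0 : r != 0 by rewrite gt_eqF.
have loE : lo * r = Num.max 0 (tau - w) by rewrite /lo maxr_pMl ?ltW// mul0r divfK.
have hiE : hi * r = Num.min r tau by rewrite /hi minr_pMl ?ltW// mul1r divfK.
have -> : (lo < hi) = (Num.max 0 (tau - w) < Num.min r tau) by rewrite -loE -hiE ltr_pM2r.
have -> : (hi%:E - lo%:E)%E = ((Num.min r tau - Num.max 0 (tau - w)) / r)%:E.
  by rewrite -EFinB -loE -hiE -mulrBl mulfK.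
suff E : (if Num.max 0 (tau - w) < Num.min r tau then Num.min r tau - Num.max 0 (tau - w) else 0)
    = (`|tau| + `|w + r - tau| - `|w - tau| - `|r - tau|) / 2.
  have -> : (`|tau| + `|w + r - tau| - `|w - tau| - `|r - tau|) / (2 * r) =
    (`|tau| + `|w + r - tau| - `|w - tau| - `|r - tau|) / 2 / r by field.
  by rewrite -E; case: ifPn => // _; rewrite mul0r.
clear -w0 r0.
case: (leP 0 (tau - w)) => h1; case: (leP r tau) => h2; case: ifPn; rewrite -?leNgt => h3;
case: (ger0P tau) => h4; case: (ger0P (w + r - tau)) => h5;
case: (ger0P (w - tau)) => h6; case: (ger0P (r - tau)) => h7; lra.
Qed.

(** The induction for the Fourier formula starts with one coordinate besides [w]: with none, the
    integrand would be a single cardinal sine times a cosine, which is not absolutely integrable. *)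
Lemma cube_slab1 (w : R) (r : 'rV[R]_1) tau : 0 < w -> 0 < r 0 0 ->
  cube_slab w r tau = (w / (2 * fejer_mass) *
    \int[mu]_u (sinc (w * u / 2) * sinc (r 0 0 * u / 2) *
       cos ((tau - (w + r 0 0) / 2) * u)))%:E.
Proof.
move=> w0 r0; rewrite (@cube_slabS _ w 0).
under eq_integral do rewrite cube_slab0.
rewrite slab_length//; congr EFin.
have F0 := @fejer_mass_gt0 R.
have rn0 : r 0 0 != 0 by rewrite gt_eqF.
apply: (@mulfI _ (2 * fejer_mass * r 0 0)).
  by rewrite !mulf_neq0// ?pnatr_eq0 ?gt_eqF.
have := Rintegral_sinc_sinc_cos (tau - (w + r 0 0) / 2) w0 r0.
set J := Rintegral _ _ _ => h.
have -> : 2 * fejer_mass * r 0 0 * (w / (2 * fejer_mass) * J) = w * r 0 0 * J.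
  by field; rewrite gt_eqF.
rewrite h.
have -> : (w + r 0 0) / 2 + (tau - (w + r 0 0) / 2) = tau by ring.
have -> : (w + r 0 0) / 2 - (tau - (w + r 0 0) / 2) = w + r 0 0 - tau by field.
have -> : (w - r 0 0) / 2 + (tau - (w + r 0 0) / 2) = - (r 0 0 - tau) by field.
have -> : (w - r 0 0) / 2 - (tau - (w + r 0 0) / 2) = w - tau by field.
rewrite normrN; field.
by [].
Qed.

Lemma measurable_prod_sinc n (r : 'I_n -> R) :
  measurable_fun [set: R] (fun u => \prod_(i < n) sinc (r i * u / 2)).
Proof.
elim: n r => [|n ih] r.
  by under eq_fun do rewrite big_ord0; exact: measurable_cst.
under eq_fun do rewrite big_ord_recl.
apply: measurable_funM; first exact: measurable_sinc_dilate.
exact: (ih (fun i => r (lift ord0 i))).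
Qed.

Lemma normr_prod_sinc_le1 n (r : 'I_n -> R) u :
  `|\prod_(i < n) sinc (r i * u / 2)| <= 1.
Proof.
rewrite normr_prod; apply: prodr_ile1 => i _.
by rewrite normr_ge0 normr_sinc_le1.
Qed.

Lemma cauchy_decay_prod_sinc n (r : 'I_n.+2 -> R) : (forall i, 0 < r i) ->
  cauchy_decay (fun u => \prod_(i < n.+2) sinc (r i * u / 2)).
Proof.
move=> r0.
have h := cauchy_decayM (cauchy_decay_sinc2 (r0 ord0) (r0 (lift ord0 ord0)))
  (measurable_prod_sinc (fun i : 'I_n => r (lift ord0 (lift ord0 i))))
  (normr_prod_sinc_le1 (fun i : 'I_n => r (lift ord0 (lift ord0 i)))).
by under eq_fun do rewrite !big_ord_recl mulrA.
Qed.

Lemma measurable_cos_dilate (c : R) : measurable_fun [set: R] (fun u => cos (c * u)).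
Proof.
apply: continuous_measurable_fun => x; apply: continuous_comp; last exact: continuous_cos.
by apply: cvgM; [exact: cvg_cst|exact: cvg_id].
Qed.

Lemma cube_slab_fourier n (w : R) (r : 'rV[R]_n.+1) tau :
  0 < w -> (forall i, 0 < r 0 i) ->
  cube_slab w r tau = (w / (2 * fejer_mass) *
    \int[mu]_u (sinc (w * u / 2) * \prod_(i < n.+1) sinc (r 0 i * u / 2) *
       cos ((tau - (w + coord_sum r) / 2) * u)))%:E.
Proof.
move=> w0; elim: n r tau => [|n ih] r tau r0.
  rewrite cube_slab1//; congr (_ * _)%:E; rewrite /coord_sum big_ord1.
  by apply: eq_Rintegral => u _; rewrite big_ord1.
set k := w / _; rewrite (@cube_slabS _ w n.+1).
pose r' := @rsubmx _ 1 1 n.+1 r.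
have r'E i : r' 0 i = r 0 (lift ord0 i) by rewrite mxE; congr (r _ _); exact/val_inj.
have r'0 i : 0 < r' 0 i by rewrite r'E.
under eq_integral do rewrite ih//.
pose P u := sinc (w * u / 2) * \prod_(i < n.+1) sinc (r' 0 i * u / 2).
pose A := tau - (w + coord_sum r') / 2.
have dP : cauchy_decay P.
  pose b (i : 'I_n.+2) := if unlift ord0 i is Some j then r' 0 j else w.
  have b0 i : 0 < b i by rewrite /b; case: unlift.
  have := cauchy_decay_prod_sinc b0.
  under eq_fun do rewrite big_ord_recl; rewrite /P /b unlift_none.
  by under eq_fun do under eq_bigr do rewrite liftK.
have dPG x : cauchy_decay (fun u => P u * cos ((A - r 0 0 * x) * u)).
  exact: (cauchy_decayM dP (measurable_cos_dilate _) (fun u => cos_max _)).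
transitivity (\int[mu]_(x in `[0%R, 1%R]) (\int[mu]_u (k * P u * cos ((A - r 0 0 * x) * u)))%:E)%E.
  apply: eq_integral => x _; congr EFin.
  rewrite -RintegralZl//; last first.
    have := cauchy_decay_integrable (dPG x).
    rewrite /P /A /r' => h; apply: eq_integrable h => // u _ /=.
    by congr (_ * cos (_ * _))%:E; ring.
  by apply: eq_Rintegral => u _; rewrite /P /A mulrA; congr (_ * cos (_ * _)); ring.
have mG : measurable_fun [set: R * R] (fun z => cos ((A - r 0 0 * z.1) * z.2)).
  apply: (@measurableT_comp _ _ _ _ _ _ (@cos R)) => //.
    by apply: continuous_measurable_fun; exact: continuous_cos.
  apply: measurable_funM => //; apply: measurable_funB => //.
  by apply: measurable_funM.
rewrite (@cauchy_decay_Fubini R _ (fun x u => cos ((A - r 0 0 * x) * u))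
  (cauchy_decayZ k dP) mG (fun x u => cos_max _)).
congr EFin.
have prE u : \prod_(i < n.+2) sinc (r 0 i * u / 2) =
    sinc (r 0 0 * u / 2) * \prod_(i < n.+1) sinc (r' 0 i * u / 2).
  by rewrite big_ord_recl; congr (_ * _); apply: eq_bigr => i _; rewrite r'E.
have -> : tau - (w + coord_sum r) / 2 = A - r 0 0 / 2.
  rewrite /A /coord_sum big_ord_recl.
  have -> : \sum_(i < n.+1) r' 0 i = \sum_(i < n.+1) r 0 (lift ord0 i).
    by apply: eq_bigr => i _; rewrite r'E.
  by field.
rewrite -RintegralZl//; last first.
  apply: cauchy_decay_integrable.
  have b0 : forall i : 'I_n.+2, 0 < r 0 i by [].
  have h := cauchy_decayM (cauchy_decayM (cauchy_decay_prod_sinc b0) (measurable_sinc_dilate w)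
    (fun u => normr_sinc_le1 _)) (measurable_cos_dilate (A - r 0 0 / 2)) (fun u => cos_max _).
  by under eq_fun do rewrite [sinc _ * _]mulrC.
apply: eq_Rintegral => u _.
by rewrite Rintegral_cos_affine// prE /P; set c := cos _; ring.
Qed.

(* The constant is the same for all b: only its sign matters. *)
Lemma section_volume_fourier n (t : R) (b : 'rV[R]_n.+2) :
  dot b b = 1 -> (forall i, 0 < b 0 i) ->
  section_volume t b = ((2 * fejer_mass)^-1 *
    \int[mu]_u (\prod_(i < n.+2) sinc (b 0 i * u / 2) * cos (t * u)))%:E.
Proof.
move=> bb b0.
have b00 : 0 < b 0 0 := b0 0.
have := @section_volume_slab R n.+1 t b bb b00.
have rE i : (@rsubmx _ 1 1 n.+1 b) 0 i = b 0 (lift ord0 i).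
  by rewrite mxE; congr (b _ _); exact/val_inj.
rewrite cube_slab_fourier//; last by move=> i; rewrite rE.
have sE : coord_sum b = b 0 0 + coord_sum (@rsubmx _ 1 1 n.+1 b).
  rewrite /coord_sum big_ord_recl; congr (_ + _).
  by apply: eq_bigr => i _; rewrite rE.
have -> : coord_sum b / 2 - t - (b 0 0 + coord_sum (@rsubmx _ 1 1 n.+1 b)) / 2 = - t.
  by rewrite sE; field.
have -> : \int[mu]_u (sinc (b 0 0 * u / 2) *
     \prod_(i < n.+1) sinc ((@rsubmx _ 1 1 n.+1 b) 0 i * u / 2) * cos (- t * u)) =
   \int[mu]_u (\prod_(i < n.+2) sinc (b 0 i * u / 2) * cos (t * u)).
  apply: eq_Rintegral => u _; rewrite mulNr cosN [in RHS]big_ord_recl; congr (_ * _ * _).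
  by apply: eq_bigr => i _; rewrite rE.
move=> h.
have -> : section_volume t b = ((b 0 0)^-1%:E * ((b 0 0)%:E * section_volume t b))%E.
  by rewrite muleA -EFinM mulVf ?mul1e// gt_eqF.
rewrite h -EFinM mulrA; congr (_ * _)%:E; field.
by rewrite !gt_eqF// fejer_mass_gt0.
Qed.

End fourier_slab.

(** * Gaussian integrals *)

Section gaussian.
Context {R : realType}.
Notation mu := (@lebesgue_measure R).
Implicit Types (f F : R -> R) (x u t : R).

(** Dominated convergence along the intervals [- n - 1, n + 1]: the decay of [F] kills the boundary
    terms. *)
Lemma Rintegral_derivative_eq0 F f :
  (forall x, is_derive x 1 F (f x)) -> continuous f -> cauchy_decay f ->
  cauchy_decay F -> \int[mu]_x f x = 0.
Proof.
move=> dF cf hf [_ [C FC]].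
have intf := cauchy_decay_integrable hf.
pose D (n : nat) : set R := `[- n.+1%:R, n.+1%:R]%classic.
pose f_ n := (EFin \o f) \_ (D n).
have mf : measurable_fun [set: R] (EFin \o f) by apply/measurable_EFinP; exact: hf.1.
have cF : continuous F.
  by move=> x; apply: differentiable_continuous; apply/derivable1_diffP; case: (dF x).
have H1 n : (\int[mu]_x f_ n x = (F n.+1%:R - F (- n.+1%:R))%:E)%E.
  rewrite /f_ -integral_mkcond (@continuous_FTC2 _ _ F)//=.
  - by rewrite (@lt_trans _ _ 0)// ?oppr_lt0 ltr0n.
  - exact: continuous_subspaceT.
  - split.
    + by move=> x _; case: (dF x).
    + by apply: cvg_at_right_filter; exact: cF.
    + by apply: cvg_at_left_filter; exact: cF.
  - by move=> x _; rewrite derive1E; case: (dF x).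
have mf_ n : measurable_fun [set: R] (f_ n).
  apply/(measurable_restrictT _ _).1; [exact: measurable_itv|exact: measurable_funTS mf].
have cv : {ae mu, forall x, setT x -> f_ ^~ x @ \oo --> (EFin \o f) x}.
  apply: aeW => x _; apply: cvg_near_cst; near=> n.
  rewrite /f_ patchE ifT// inE /D/= in_itv/= -ler_norml.
  have : `|x| <= n%:R by near: n; exact: nbhs_infty_ger.
  by move=> /le_trans; apply; rewrite ler_nat.
have dom : {ae mu, forall x n, setT x -> (`|f_ n x| <= `|(EFin \o f) x|)%E}.
  by apply: aeW => x n _; rewrite /f_ patchE; case: ifPn => // _; rewrite abse0.
have [_ _] := @dominated_convergence _ _ R mu setT measurableT f_ (EFin \o f)
   _ mf_ mf cv (integrable_abse intf) dom.
under eq_fun do rewrite H1.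
move=> H.
have H0 : (F n.+1%:R - F (- n.+1%:R))%:E @[n --> \oo] --> (0%:E : \bar R).
  apply: cvg_EFin; first exact: nearW.
  have C0 : 0 <= C by have := FC 0; rewrite expr0n/= addr0 divr1; exact: le_trans.
  have lim0 : 2 * C * n.+1%:R^-1 @[n --> \oo] --> (0 : R).
    rewrite -[X in _ --> X](mulr0 (2 * C)); apply: cvgM; first exact: cvg_cst.
    exact: cvg_harmonic.
  apply: norm_cvg0; apply: squeeze_cvgr (cvg_cst 0) lim0.
  near=> n; rewrite normr_ge0 /=; apply: le_trans (ler_normB _ _) _.
  have b (y : R) : y ^+ 2 = n.+1%:R ^+ 2 -> `|F y| <= C * n.+1%:R^-1.
    move=> yE; apply: le_trans (FC y) _; rewrite ler_wpM2l// lef_pV2 ?posrE//.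
      rewrite yE; have : (1 : R) <= n.+1%:R by rewrite ler1n.
      by move: n.+1%:R => N N1; nra.
    by rewrite ltr_pwDl// sqr_ge0.
  apply: le_trans (lerD (b n.+1%:R erefl) (b (- n.+1%:R) (sqrrN _))) _.
  by rewrite -mulrA mulr_natl mulr2n.
have E : (\int[mu]_x (EFin \o f) x)%E = 0%:E.
  exact: (cvg_unique _ H H0).
by rewrite /Rintegral E.
Unshelve. all: by end_near. Qed.

(* The limit of sinc (u / (2 sqrt d)) ^+ d as d goes to infinity. *)
Definition gauss u : R := expR (- u ^+ 2 / 24).

Lemma continuous_gauss : continuous gauss.
Proof.
move=> x; apply: (@continuous_comp _ _ _ (fun u => - u ^+ 2 / 24) expR); last exact: continuous_expR.
by apply: cvgM; [apply: cvgN; exact: exprn_continuous|exact: cvg_cst].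
Qed.

Lemma gauss_ge0 u : 0 <= gauss u. Proof. exact: expR_ge0. Qed.

Lemma cauchy_decay_gaussX k : cauchy_decay (fun u => u ^+ k * gauss u).
Proof.
have c : continuous (fun u => u ^+ k * gauss u).
  by move=> x; apply: cvgM; [exact: exprn_continuous|exact: continuous_gauss].
split; first exact: continuous_measurable_fun.
(* The factor 4 bounds [y ^+ k * (1 + y ^+ 2)] by a multiple of [1 + (y ^+ 2) ^+ k.+1]; the
   factorial comes from one term of the exponential series at [y ^+ 2 / 24]. *)
exists (4 * (1 + 24 ^+ k.+1 * k.+1`!%:R)) => u.
have p : 0 < 1 + u ^+ 2 by rewrite ltr_pwDl// sqr_ge0.
rewrite ler_pdivlMr// normrM normrX (ger0_norm (gauss_ge0 _)) mulrAC.
have [y0 yE] : 0 <= `|u| /\ u ^+ 2 = `|u| ^+ 2 by rewrite normr_ge0 real_normK ?num_real.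
rewrite /gauss yE; move: `|u| y0 => y y0.
have le4 : y ^+ k * (1 + y ^+ 2) <= 4 * (1 + (y ^+ 2) ^+ k.+1).
  have [y1|y1] := leP y 1.
    have h1 : y ^+ k <= 1 by exact: exprn_ile1.
    have h2 : y ^+ 2 <= 1 by exact: exprn_ile1.
    have h3 : 0 <= y ^+ k by exact: exprn_ge0.
    have h4 : 0 <= (y ^+ 2) ^+ k.+1 by rewrite exprn_ge0// sqr_ge0.
    have h5 := sqr_ge0 y; nra.
  have h1 : y ^+ k <= (y ^+ 2) ^+ k.
    by rewrite -exprM ler_weXn2l// ?(ltW y1)// leq_pmull.
  have h2 : 1 <= y ^+ 2 by rewrite exprn_ege1// ltW.
  have h3 : 0 <= y ^+ k by exact: exprn_ge0.
  rewrite [(y ^+ 2) ^+ k.+1]exprS; nra.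
apply: le_trans (ler_wpM2r (expR_ge0 _) le4) _.
rewrite -mulrA ler_pM2l// mulrDl mul1r; apply: lerD.
  rewrite expR_le1 mulNr oppr_le0 divr_ge0//; exact: sqr_ge0.
rewrite mulNr expRN ler_pdivrMr ?expR_gt0//.
have h := @expR_ge1Dxn R (y ^+ 2 / 24) k (divr_ge0 (sqr_ge0 y) (ler0n _ 24)).
have f0 : 0 < k.+1`!%:R :> R by rewrite ltr0n fact_gt0.
apply: (@le_trans _ _ (24 ^+ k.+1 * k.+1`!%:R * ((y ^+ 2 / 24) ^+ k.+1 / k.+1`!%:R))).
  rewrite le_eqVlt; apply/orP; left; apply/eqP.
  by rewrite expr_div_n; field; rewrite gt_eqF//= expf_neq0// pnatr_eq0.
by rewrite ler_pM2l//; apply: le_trans h; rewrite lerDr.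
Qed.

Definition gauss_cos k t : R := \int[mu]_u (u ^+ k * gauss u * cos (t * u)).
Definition gauss_sin k t : R := \int[mu]_u (u ^+ k * gauss u * sin (t * u)).

Let continuous_trig (trig : R -> R) t : continuous trig -> continuous (fun u => trig (t * u)).
Proof.
move=> c x; apply: continuous_comp; last exact: c.
by apply: cvgM; [exact: cvg_cst|exact: cvg_id].
Qed.

Let continuous_gaussX k : continuous (fun u => u ^+ k * gauss u).
Proof. by move=> x; apply: cvgM; [exact: exprn_continuous|exact: continuous_gauss]. Qed.

Lemma cauchy_decay_gauss_cos k t : cauchy_decay (fun u => u ^+ k * gauss u * cos (t * u)).
Proof.
apply: (cauchy_decayM (cauchy_decay_gaussX k)) => [|u]; last exact: cos_max.
by apply: continuous_measurable_fun; exact: (continuous_trig (@continuous_cos R)).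
Qed.

Lemma cauchy_decay_gauss_sin k t : cauchy_decay (fun u => u ^+ k * gauss u * sin (t * u)).
Proof.
apply: (cauchy_decayM (cauchy_decay_gaussX k)) => [|u]; last exact: sin_max.
by apply: continuous_measurable_fun; exact: (continuous_trig (@continuous_sin R)).
Qed.

Let is_derive_gauss u : is_derive u 1 gauss (- u / 12 * gauss u).
Proof. by apply: is_derive_eq; rewrite /gauss /GRing.scale/=; field. Qed.

(** Integration by parts, from the derivative [- u / 12 * gauss u] of [gauss]. When [k] is 0, the
    meaningless exponent [k.-1] comes with the coefficient 0. *)
Lemma gauss_parts k (A dA : R -> R) (B : R) :
  (forall x, is_derive x 1 A (dA x)) -> continuous dA ->
  (forall x, `|A x| <= B) -> (forall x, `|dA x| <= B) ->
  \int[mu]_u (u ^+ k.+1 * gauss u * A u) =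
  12 * (k%:R * \int[mu]_u (u ^+ k.-1 * gauss u * A u) + \int[mu]_u (u ^+ k * gauss u * dA u)).
Proof.
move=> derA cdA AB dAB.
have cA : continuous A.
  by move=> x; apply: differentiable_continuous; apply/derivable1_diffP; case: (derA x).
have mA := continuous_measurable_fun cA.
have mdA := continuous_measurable_fun cdA.
have dcA j : cauchy_decay (fun u => u ^+ j * gauss u * A u).
  exact: cauchy_decayM (cauchy_decay_gaussX j) mA AB.
have dcdA : cauchy_decay (fun u => u ^+ k * gauss u * dA u).
  exact: cauchy_decayM (cauchy_decay_gaussX k) mdA dAB.
pose f u := k%:R * (u ^+ k.-1 * gauss u * A u) + u ^+ k * gauss u * dA u
   - 12^-1 * (u ^+ k.+1 * gauss u * A u).
have d1 := cauchy_decayZ k%:R (dcA k.-1).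
have d2 := cauchy_decayD d1 dcdA.
have d3 := cauchy_decayZ 12^-1 (dcA k.+1).
have cf : continuous f.
  move=> x; apply: cvgB; first apply: cvgD.
  - apply: cvgM; first exact: cvg_cst.
    by apply: cvgM; [exact: continuous_gaussX|exact: cA].
  - by apply: cvgM; [exact: continuous_gaussX|exact: cdA].
  - apply: cvgM; first exact: cvg_cst.
    by apply: cvgM; [exact: continuous_gaussX|exact: cA].
have dF x : is_derive x 1 (fun u => u ^+ k * gauss u * A u) (f x).
  have hX : is_derive x 1 (fun u : R => u ^+ k) (k%:R * x ^+ k.-1).
    have := @is_deriveX R R id k x 1 1 (is_derive_id x 1).
    rewrite (_ : id ^+ k = (fun u : R => u ^+ k)); last by apply/funext => u; rewrite exprfctE.
    by move=> h; apply: is_derive_eq h _; rewrite /GRing.scale/= mulr1.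
  have hg := is_derive_gauss x; have hA := derA x.
  apply: is_derive_eq; rewrite /f /GRing.scale/= !exprS.
  by set e := x ^+ k.-1; set e' := x ^+ k; field.
have := Rintegral_derivative_eq0 dF cf (cauchy_decayB d2 d3) (dcA k).
rewrite /f RintegralB//; [|exact: cauchy_decay_integrable..].
rewrite RintegralD//; [|exact: cauchy_decay_integrable..].
rewrite !RintegralZl//; [|exact: cauchy_decay_integrable..].
set I1 := Rintegral _ _ _; set I2 := Rintegral _ _ _; set I3 := Rintegral _ _ _.
by set a := k%:R * I1 => h; move: h; lra.
Qed.

Lemma gauss_cosS k t :
  gauss_cos k.+1 t = 12 * (k%:R * gauss_cos k.-1 t - t * gauss_sin k t).
Proof.
have h1 x : is_derive x 1 (fun u => cos (t * u)) (- t * sin (t * x)).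
  by apply: is_derive_eq; rewrite /GRing.scale/=; ring.
have h2 : continuous (fun x => - t * sin (t * x)).
  move=> x; apply: cvgM; first exact: cvg_cst.
  exact: (continuous_trig (@continuous_sin R)).
have h3 x : `|cos (t * x)| <= 1 + `|t|.
  by apply: le_trans (cos_max _) _; rewrite lerDl.
have h4 x : `|- t * sin (t * x)| <= 1 + `|t|.
  rewrite normrM ?normrN; apply: (@le_trans _ _ (`|t| * 1)).
    by rewrite ler_wpM2l// sin_max.
  by rewrite mulr1 lerDr.
rewrite /gauss_cos (gauss_parts k h1 h2 h3 h4).
congr (12 * (_ + _)); rewrite -?mulNr /gauss_sin -RintegralZl//; last first.
  exact: cauchy_decay_integrable (cauchy_decay_gauss_sin _ _).
by apply: eq_Rintegral => u _; ring.
Qed.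

Lemma gauss_sinS k t :
  gauss_sin k.+1 t = 12 * (k%:R * gauss_sin k.-1 t + t * gauss_cos k t).
Proof.
have h1 x : is_derive x 1 (fun u => sin (t * u)) (t * cos (t * x)).
  by apply: is_derive_eq; rewrite /GRing.scale/=; ring.
have h2 : continuous (fun x => t * cos (t * x)).
  move=> x; apply: cvgM; first exact: cvg_cst.
  exact: (continuous_trig (@continuous_cos R)).
have h3 x : `|sin (t * x)| <= 1 + `|t|.
  by apply: le_trans (sin_max _) _; rewrite lerDl.
have h4 x : `|t * cos (t * x)| <= 1 + `|t|.
  rewrite normrM ?normrN; apply: (@le_trans _ _ (`|t| * 1)).
    by rewrite ler_wpM2l// cos_max.
  by rewrite mulr1 lerDr.
rewrite /gauss_sin (gauss_parts k h1 h2 h3 h4).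
congr (12 * (_ + _)); rewrite -?mulNr /gauss_cos -RintegralZl//; last first.
  exact: cauchy_decay_integrable (cauchy_decay_gauss_cos _ _).
by apply: eq_Rintegral => u _; ring.
Qed.

Lemma is_derive_gauss_cos0 t : is_derive t 1 (gauss_cos 0) (- gauss_sin 1 t).
Proof.
pose f (t u : R) := u ^+ 0 * gauss u * cos (t * u).
have df (t0 u : R) : is_derive t0 1 (f ^~ u) (- (u ^+ 1 * gauss u * sin (t0 * u))).
  by apply: is_derive_eq; rewrite /GRing.scale/=; ring.
have It : (`]t - 1, t + 1[%classic : set R) t.
  by rewrite /= in_itv/=; apply/andP; split; lra.
have intf (x : R) : (`]t - 1, t + 1[%classic : set R) x -> mu.-integrable setT (EFin \o f x).
  by move=> _; exact: cauchy_decay_integrable (cauchy_decay_gauss_cos 0 x).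
have derf x y : (`]t - 1, t + 1[%classic : set R) x -> setT y -> derivable (f ^~ y) x 1.
  by move=> _ _; case: (df x y).
have dE x y : partial1of2 f x y = - (y ^+ 1 * gauss y * sin (x * y)).
  by rewrite partial1of2E; case: (df x y).
pose G u : R := `|u ^+ 1 * gauss u|.
have G0 u : 0 <= G u by exact: normr_ge0.
have intG : mu.-integrable setT (EFin \o G).
  exact: cauchy_decay_integrable (cauchy_decay_norm (cauchy_decay_gaussX 1)).
have Gub x y : (`]t - 1, t + 1[%classic : set R) x -> setT y -> `|partial1of2 f x y| <= G y.
  move=> _ _; rewrite dE normrN normrM -[leRHS]mulr1.
  by rewrite ler_wpM2l// sin_max.
apply: DeriveDef.
  exact: (derivable_under_integral measurableT It intf derf G0 intG Gub).
rewrite -derive1E (differentiation_under_integral measurableT It intf derf G0 intG Gub).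
rewrite /gauss_sin -mulN1r -RintegralZl//; last first.
  exact: cauchy_decay_integrable (cauchy_decay_gauss_sin _ _).
by apply: eq_Rintegral => u _; rewrite dE mulN1r.
Qed.

(** It is sqrt (24 pi), but it factors out of both the main term and the bound on the error, so only
    its sign matters. *)
Definition gauss_mass : R := \int[mu]_u gauss u.

Lemma gauss_cos0_mass : gauss_cos 0 0 = gauss_mass.
Proof. by apply: eq_Rintegral => u _; rewrite expr0 mul1r mul0r cos0 mulr1. Qed.

(** By parts, [gauss_sin 1 t] is [12 * t * gauss_cos 0 t], so [gauss_cos 0] solves y' = - 12 t y. *)
Lemma gauss_cos0E t : gauss_cos 0 t = gauss_mass * expR (- 6 * t ^+ 2).
Proof.
have h x : is_derive x 1 (fun t => gauss_cos 0 t * expR (6 * t ^+ 2)) 0.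
  have h1 := is_derive_gauss_cos0 x.
  apply: is_derive_eq; rewrite /GRing.scale/= gauss_sinS mul0r add0r.
  by set E := expR _; ring.
have := @is_derive_0_is_cst R _ t 0 h.
rewrite expr0n/= mulr0 expR0 mulr1 gauss_cos0_mass => <-.
by rewrite -mulrA -expRD mulNr subrr expR0 mulr1.
Qed.

(** The quartic is the Hermite polynomial of degree 4 up to scaling, and 432 = 3 * 12^2 is the
    fourth moment of the centered normal law of variance 12. *)
Lemma gauss_cos4E t : gauss_cos 4 t =
  432 * gauss_mass * (1 - 24 * t ^+ 2 + 48 * t ^+ 4) * expR (- 6 * t ^+ 2).
Proof.
rewrite gauss_cosS gauss_cosS gauss_sinS gauss_sinS gauss_cosS gauss_sinS /= gauss_cos0E.
by set E := expR _; ring.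
Qed.

Lemma gauss_moment k : \int[mu]_u (u ^+ k * gauss u) = gauss_cos k 0.
Proof. by apply: eq_Rintegral => u _; rewrite mul0r cos0 mulr1. Qed.

Lemma gauss_moment6 : \int[mu]_u (u ^+ 6 * gauss u) = 60 * (432 * gauss_mass).
Proof.
rewrite gauss_moment gauss_cosS mul0r subr0 gauss_cos4E.
by rewrite !expr0n/= !mulr0 expR0; ring.
Qed.

Lemma gauss_moment8 : \int[mu]_u (u ^+ 8 * gauss u) = 84 * (60 * (432 * gauss_mass)).
Proof.
by rewrite gauss_moment gauss_cosS mul0r subr0 -gauss_moment gauss_moment6 mulrA -natrM.
Qed.

Lemma gauss_mass_gt0 : 0 < gauss_mass.
Proof.
apply: (@lt_le_trans _ _ (expR (- 1 / 24))); first exact: expR_gt0.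
have mi : mu.-integrable setT (EFin \o (fun u => expR (- 1 / 24) * (\1_(`[0, 1]%classic : set R) u))).
  apply: (@eq_integrable _ _ _ mu setT measurableT
     (fun u => (expR (- 1 / 24))%:E * (\1_(`[0, 1]%classic : set R) u)%:E)%E) => //.
  by apply: integrableZl => //; exact: integrable_indic_itv.
apply: (@le_trans _ _ (\int[mu]_u (expR (- 1 / 24) * (\1_(`[0, 1]%classic : set R) u)))).
  rewrite RintegralZl//; last exact: integrable_indic_itv.
  rewrite /Rintegral integral_indic//= setIT lebesgue_measure_itv/= lte01.
  by rewrite oppr0 adde0/= mulr1.
apply: le_Rintegral => //.
  have := cauchy_decay_integrable (cauchy_decay_gaussX 0).
  by under eq_fun do rewrite expr0 mul1r.
move=> u _; rewrite indicE; case: (boolP (u \in _)) => [|_] /=; last first.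
  by rewrite mulr0 gauss_ge0.
rewrite inE/= in_itv/= mulr1 => /andP[u0 u1].
by rewrite /gauss ler_expR; nra.
Qed.

End gaussian.

(** * Moving two coordinates of the normal vector *)

Section pointwise.
Context {R : realType}.
Implicit Types (x y u : R).

(** At [y = x ^+ 2 / 6] the coefficient 3/10 becomes exactly the 1/120 of [sinc_le]. The bound 2/5
    ensures that 1 - z is at least 3/5, the slope needed in [step]. *)
Lemma expRN_ge y : 0 <= y <= 2 / 5 -> 1 - y + 3 / 10 * y ^+ 2 <= expR (- y).
Proof.
move=> /andP[y0 y1].
have d1 (x : R) : is_derive x 1 (fun z : R => expR (- z)) (- expR (- x)).
  by apply: is_derive_eq; rewrite /GRing.scale/=; ring.
have step x : 0 <= x <= 2 / 5 -> expR (- x) <= 1 - 3 / 5 * x.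
  move=> /andP[x0 x1].
  have d2 (z : R) : is_derive z 1 (fun z : R => 1 - 3 / 5 * z) (- (3 / 5)).
    by apply: is_derive_eq; rewrite /GRing.scale/=; ring.
  have := @le_increment_derivable _ _ _ _ _ _ _ x0 d1 d2.
  rewrite oppr0 expR0 mulr0 subr0 => h.
  suff : expR (- x) - 1 <= 1 - 3 / 5 * x - 1 by lra.
  apply: h => z /andP[z0 zx]; rewrite lerN2.
  have := @expR_ge1Dx R (- z); lra.
have d2 (z : R) : is_derive z 1 (fun z : R => 1 - z + 3 / 10 * z ^+ 2) (- (1 - 3 / 5 * z)).
  by apply: is_derive_eq; rewrite /GRing.scale/=; field.
have := @le_increment_derivable _ _ _ _ _ _ _ y0 d2 d1.
rewrite oppr0 expR0 expr0n/= mulr0 !addr0 => h.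
suff : 1 - y + 3 / 10 * y ^+ 2 - 1 <= expR (- y) - 1 by lra.
apply: h => z /andP[z0 zx]; rewrite lerN2; apply: step.
by apply/andP; split; lra.
Qed.

Lemma sinc_le_expR x : x ^+ 2 <= 12 / 5 -> sinc x <= expR (- (x ^+ 2 / 6)).
Proof.
move=> x2; apply: le_trans (sinc_le x) _.
apply: le_trans (expRN_ge _); last first.
  by apply/andP; split; [rewrite divr_ge0// sqr_ge0|lra].
by rewrite le_eqVlt; apply/orP; left; apply/eqP; field.
Qed.

Lemma oneB_ge_expR y : 0 <= y <= 1 -> expR (- y) * (1 - y ^+ 2) <= 1 - y.
Proof.
move=> /andP[y0 y1].
have -> : 1 - y ^+ 2 = (1 + y) * (1 - y) by ring.
rewrite mulrA -[leRHS]mul1r ler_wpM2r ?subr_ge0//.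
rewrite expRN mulrC ler_pdivrMr ?expR_gt0// mul1r.
exact: expR_ge1Dx.
Qed.

(** The Weierstrass product inequality. *)
Lemma prod_oneB_ge (I : finType) (P : pred I) (z : I -> R) :
  (forall k, P k -> 0 <= z k <= 1) ->
  1 - \sum_(k | P k) z k <= \prod_(k | P k) (1 - z k).
Proof.
move=> z01.
suff [] : [/\ 1 - \sum_(k | P k) z k <= \prod_(k | P k) (1 - z k),
   0 <= \prod_(k | P k) (1 - z k) & \prod_(k | P k) (1 - z k) <= 1] by [].
apply: (big_ind2 (fun s p => [/\ 1 - s <= p, 0 <= p & p <= 1 :> R])).
- by rewrite subr0 lexx ler01.
- move=> s p s' p' [h1 h2 h3] [h4 h5 h6]; split; [nra|exact: mulr_ge0|].
  exact: mulr_ile1.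
- by move=> k /z01 /andP[? ?]; split; lra.
Qed.

Lemma prod_sinc_ge (I : finType) (P : pred I) (x : I -> R) :
  (forall k, P k -> x k ^+ 2 <= 6) ->
  expR (- \sum_(k | P k) x k ^+ 2 / 6) * (1 - \sum_(k | P k) (x k ^+ 2 / 6) ^+ 2)
  <= \prod_(k | P k) sinc (x k).
Proof.
move=> x6.
have y01 k : P k -> 0 <= x k ^+ 2 / 6 <= 1.
  by move=> /x6 h; rewrite divr_ge0 ?sqr_ge0//= ler_pdivrMr// mul1r.
apply: (@le_trans _ _ (\prod_(k | P k) (1 - x k ^+ 2 / 6))); last first.
  apply: ler_prod => k /y01 /andP[h1 h2]; rewrite subr_ge0 h2 /=.
  exact: sinc_ge.
apply: (@le_trans _ _ (\prod_(k | P k) (expR (- (x k ^+ 2 / 6)) * (1 - (x k ^+ 2 / 6) ^+ 2)))).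
  rewrite big_split/= -sumrN expR_sum ler_wpM2l//.
    by apply: prodr_ge0 => k _; exact: expR_ge0.
  apply: prod_oneB_ge => k /y01 /andP[h1 h2].
  by rewrite exprn_ge0//= exprn_ile1.
apply: ler_prod => k /y01 h; rewrite oneB_ge_expR// andbT.
move: h => /andP[h1 h2]; rewrite mulr_ge0 ?expR_ge0// subr_ge0.
exact: exprn_ile1.
Qed.

Lemma prod_sinc_le (I : finType) (P : pred I) (x : I -> R) :
  (forall k, P k -> x k ^+ 2 <= 12 / 5) ->
  0 <= \prod_(k | P k) sinc (x k) <= expR (- \sum_(k | P k) x k ^+ 2 / 6).
Proof.
move=> xs.
have s0 k : P k -> 0 <= sinc (x k).
  by move=> /xs h; apply: le_trans (sinc_ge (x k)); lra.
rewrite prodr_ge0//= -sumrN expR_sum; apply: ler_prod => k Pk.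
by rewrite s0//= sinc_le_expR// xs.
Qed.

(** The threshold is the least value of [(b k * u / 2) ^+ 2] when [d%:R * b k ^+ 2] is at least
    99/100 and [u ^+ 2] at least [d%:R]. Any bound below 1 would make the tail geometrically
    small. *)
Lemma normr_sinc_le_rho x : 99 / 400 <= x ^+ 2 -> `|sinc x| <= 49 / 50.
Proof.
move=> x2; have [x4|x4] := leP (x ^+ 2) 4.
  have h1 := sinc_ge x; have h2 := sinc_le x.
  have e : x ^+ 4 = x ^+ 2 * x ^+ 2 by ring.
  rewrite ler_norml; apply/andP; split; first by lra.
  apply: le_trans h2 _; rewrite e; nra.
have x0 : x != 0 by apply: contraTneq x4 => ->; rewrite expr0n/= -leNgt.
apply: le_trans (normr_sinc_leV x0) _.
rewrite invf_ple ?posrE ?normr_gt0//.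
apply: (@le_trans _ _ 2); first by lra.
by rewrite -(ler_pXn2r (n := 2))// ?nnegrE// real_normK ?num_real// ltW; lra.
Qed.

End pointwise.

(** * Pointwise comparison with the Gaussian *)

Section pair_remainder.
Context {R : realType}.
Variables (d : nat) (b : 'I_d -> R) (i j : 'I_d).
Hypothesis d8 : (8 < d)%N.
Hypothesis ij : i != j.
Hypothesis b0 : forall k, 0 < b k.
Hypothesis box : forall k, 99 / 100 <= d%:R * b k ^+ 2 <= 101 / 100.
Hypothesis b1 : \sum_k b k ^+ 2 = 1.

Definition other_sinc (u : R) := \prod_(k | (k != i) && (k != j)) sinc (b k * u / 2).

Let D : R := d%:R.
Let D0 : 0 < D. Proof. by rewrite ltr0n (leq_trans _ d8). Qed.
Let s : R := (b i ^+ 2 + b j ^+ 2) / 2.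

Let s_le : D * s <= 101 / 100.
Proof. by rewrite /s; have := box i; have := box j; rewrite -/D => /andP[? ?] /andP[? ?]; lra. Qed.

Let s_ge0 : 0 <= s.
Proof. by rewrite /s; have := sqr_ge0 (b i); have := sqr_ge0 (b j); lra. Qed.

Let sum_other : \sum_(k | (k != i) && (k != j)) b k ^+ 2 = 1 - 2 * s.
Proof.
move: b1; rewrite (bigD1 i)//= (bigD1 j)/=; last by rewrite eq_sym.
by rewrite /s; lra.
Qed.

Let xE k u : (b k * u / 2) ^+ 2 = b k ^+ 2 * u ^+ 2 / 4. Proof. by field. Qed.

(** The relative error has three sources, each of order 1 / d at fixed [u]: the correction [a] for
    the moving pair, the gap [E] between the Gaussian of the other coordinates and the full one, and
    the fourth order terms [Z] of the other cardinal sines. *)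
Lemma other_sinc_near (c u delta : R) : 0 <= c -> u ^+ 2 <= D ->
  (1 - s * u ^+ 2 / 14) * (c * u ^+ 4) <= delta -> delta <= c * u ^+ 4 ->
  `|delta * other_sinc u - c * (u ^+ 4 * gauss u)| <=
  c * (10 / 9 * (u ^+ 6 * gauss u / 12 + u ^+ 8 * gauss u / 576) / D).
Proof.
move=> c0 uD dge dle.
have u20 : 0 <= u ^+ 2 by exact: sqr_ge0.
have bu k : b k ^+ 2 * u ^+ 2 <= 101 / 100.
  have /andP[_ h] := box k; apply: le_trans h; rewrite mulrC ler_wpM2r//.
  exact: sqr_ge0.
have x2 k : (b k * u / 2) ^+ 2 <= 12 / 5 by rewrite xE; have := bu k; lra.
have x6 k : (b k * u / 2) ^+ 2 <= 6 by have := x2 k; lra.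
have /andP[q0 qle] := prod_sinc_le (P := fun k => (k != i) && (k != j)) (fun k _ => x2 k).
have qge := prod_sinc_ge (P := fun k => (k != i) && (k != j)) (fun k _ => x6 k).
rewrite -/(other_sinc u) in q0 qle qge.
set Z := \sum_(k | _) (_ / 6) ^+ 2 in qge.
(* The squares of the other coordinates add up to [1 - 2 * s], so their Gaussian is [gauss u] times
   [expR E]. *)
pose E := s * u ^+ 2 / 12.
have YE : expR (- \sum_(k | (k != i) && (k != j)) (b k * u / 2) ^+ 2 / 6) = gauss u * expR E.
  rewrite /gauss -expRD; congr expR.
  have -> : \sum_(k | (k != i) && (k != j)) (b k * u / 2) ^+ 2 / 6 =
      (\sum_(k | (k != i) && (k != j)) b k ^+ 2) * (u ^+ 2 / 24).
    by rewrite mulr_suml; apply: eq_bigr => k _; field.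
  by rewrite sum_other /E; field.
rewrite YE in qle qge.
have Z0 : 0 <= Z by apply: sumr_ge0 => k _; exact: sqr_ge0.
have w0 : 0 <= u ^+ 4 / 576 by apply: divr_ge0; [exact: exprn_even_ge0|exact: ler0n].
have Zle : Z <= 101 / 100 * (u ^+ 4 / 576) / D.
  rewrite ler_pdivlMr// /Z mulr_suml.
  have h k : ((b k * u / 2) ^+ 2 / 6) ^+ 2 * D <= 101 / 100 * (u ^+ 4 / 576) * b k ^+ 2.
    have -> : ((b k * u / 2) ^+ 2 / 6) ^+ 2 * D = (D * b k ^+ 2) * (b k ^+ 2 * (u ^+ 4 / 576)) by field.
    have -> : 101 / 100 * (u ^+ 4 / 576) * b k ^+ 2 = 101 / 100 * (b k ^+ 2 * (u ^+ 4 / 576)) by ring.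
    apply: ler_wpM2r; last by have /andP[] := box k.
    by apply: mulr_ge0; [exact: sqr_ge0|exact: w0].
  apply: (le_trans (ler_sum _ (fun k _ => h k))).
  rewrite -mulr_sumr sum_other -[leRHS]mulr1; apply: ler_wpM2l.
    by apply: mulr_ge0 w0; rewrite divr_ge0.
  by rewrite lerBlDr lerDl mulr_ge0.
have Ele : E <= 101 / 100 * (u ^+ 2 / 12) / D.
  rewrite ler_pdivlMr// /E; have -> : s * u ^+ 2 / 12 * D = D * s * (u ^+ 2 / 12) by ring.
  by rewrite ler_wpM2r ?s_le// divr_ge0.
have E0 : 0 <= E by rewrite /E divr_ge0// mulr_ge0.
have E1 : E <= 101 / 1200.
  apply: le_trans Ele _; rewrite ler_pdivrMr//; lra.
have e1 : 1 <= expR E by rewrite -expR0 ler_expR.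
have e2 : expR E * (1 - E) <= 1.
  have := @expR_ge1Dx R (- E); rewrite expRN => h.
  rewrite mulrC -ler_pdivlMr ?expR_gt0// mul1r; lra.
have e3 : expR E - 1 <= 11 / 10 * E by nra.
have e4 : expR E <= 11 / 10 by nra.
have g0 := gauss_ge0 u.
have u40 : 0 <= u ^+ 4 by rewrite exprn_even_ge0.
pose a := s * u ^+ 2 / 14.
have aE : a <= E.
  by rewrite /a /E; have := mulr_ge0 s_ge0 u20; lra.
have a0 : 0 <= a by rewrite /a divr_ge0// mulr_ge0.
rewrite -/a in dge.
have main : `|delta * other_sinc u - c * u ^+ 4 * gauss u| <= c * u ^+ 4 * (gauss u * (11 / 10 * (E + Z))).
  have cu0 : 0 <= c * u ^+ 4 by exact: mulr_ge0.
  move: q0 qle qge; set q := other_sinc u => q0 qle qge.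
  rewrite ler_norml; apply/andP; split.
    apply: (@le_trans _ _ ((1 - a) * (c * u ^+ 4) * q - c * u ^+ 4 * gauss u)); last first.
      by rewrite lerD2r ler_wpM2r.
    have h1 : gauss u * expR E * (1 - Z - a) <= (1 - a) * q by nra.
    have h2 : gauss u * (expR E * (1 - Z - a) - 1) <= (1 - a) * q - gauss u by nra.
    have h3 : - (11 / 10 * (E + Z)) <= expR E * (1 - Z - a) - 1 by nra.
    have h4 : gauss u * - (11 / 10 * (E + Z)) <= (1 - a) * q - gauss u.
      by apply: le_trans h2; rewrite ler_wpM2l.
    have -> : (1 - a) * (c * u ^+ 4) * q - c * u ^+ 4 * gauss u = c * u ^+ 4 * ((1 - a) * q - gauss u) by ring.
    have -> : - (c * u ^+ 4 * (gauss u * (11 / 10 * (E + Z)))) = c * u ^+ 4 * (gauss u * - (11 / 10 * (E + Z))) by ring.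
    by rewrite ler_wpM2l.
  apply: (@le_trans _ _ (c * u ^+ 4 * q - c * u ^+ 4 * gauss u)).
    by rewrite lerD2r ler_wpM2r.
  rewrite -mulrBr ler_wpM2l//.
  apply: (@le_trans _ _ (gauss u * (expR E - 1))); first by rewrite mulrBr mulr1 lerD2r.
  by rewrite ler_wpM2l//; lra.
rewrite mulrA; apply: le_trans main _.
have -> : c * (10 / 9 * (u ^+ 6 * gauss u / 12 + u ^+ 8 * gauss u / 576) / D) =
   c * u ^+ 4 * (gauss u * (10 / 9 * (u ^+ 2 / 12 + u ^+ 4 / 576) / D)) by ring.
move: w0 Zle Ele; set w := u ^+ 4 / 576; set v := u ^+ 2 / 12 => w0 Zle Ele.
have v0 : 0 <= v by apply: divr_ge0.
have iD : 0 < D^-1 by rewrite invr_gt0.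
apply: ler_wpM2l; first exact: mulr_ge0.
apply: ler_wpM2l => //.
(* The constant 10/9 is 11/10 * 101/100 rounded up. *)
have fin (E' Z' p q : R) : 0 <= p -> 0 <= q -> E' <= 101 / 100 * p ->
    Z' <= 101 / 100 * q -> 11 / 10 * (E' + Z') <= 10 / 9 * (p + q).
  by move=> *; lra.
have -> : 10 / 9 * (v + w) / D = 10 / 9 * (v / D + w / D) by ring.
apply: fin.
- by apply: mulr_ge0 v0 (ltW iD).
- by apply: mulr_ge0 w0 (ltW iD).
- by have -> : 101 / 100 * (v / D) = 101 / 100 * v / D by ring.
- by have -> : 101 / 100 * (w / D) = 101 / 100 * w / D by ring.
Qed.

(** Every factor is at most 49/50 and at most the inverse of its argument. Six of the d - 2 factors
    are spent on decay, so that [u ^+ 4] times the product decays like u^-2; the others give the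
    geometric factor. As 4 * 100/99 < 41/10, the latter bound is uniform in [k]. *)
Lemma other_sinc_far u : D <= u ^+ 2 ->
  `|other_sinc u| <= (49 / 50) ^+ (d - 8) * (41 / 10 * D / u ^+ 2) ^+ 3.
Proof.
move=> uD.
have u20 : 0 < u ^+ 2 by exact: lt_le_trans uD.
have u0 : u != 0 by apply: contraTneq u20 => ->; rewrite expr0n/= ltxx.
pose m2 : R := 41 / 10 * D / u ^+ 2.
have m20 : 0 <= m2.
  apply: divr_ge0 (ltW u20); apply: mulr_ge0 (ltW D0).
  by apply: divr_ge0; exact: ler0n.
pose m : R := Num.min (49 / 50) (Num.sqrt m2).
have m0 : 0 <= m by rewrite /m le_min sqrtr_ge0 andbT divr_ge0.
have mle k : `|sinc (b k * u / 2)| <= m.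
  have /andP[h1 h2] := box k.
  rewrite /m le_min; apply/andP; split.
    apply: normr_sinc_le_rho; rewrite xE.
    suff : 99 / 100 <= b k ^+ 2 * u ^+ 2 by lra.
    by apply: le_trans h1 _; rewrite mulrC ler_wpM2l// sqr_ge0.
  have x0 : b k * u / 2 != 0 by rewrite !mulf_neq0// ?invr_neq0 ?pnatr_eq0// gt_eqF.
  apply: le_trans (normr_sinc_leV x0) _.
  rewrite -[leLHS]gtr0_norm ?invr_gt0 ?normr_gt0// -sqrtr_sqr ler_wsqrtr//.
  rewrite exprVn real_normK ?num_real// xE /m2.
  rewrite -[leLHS]mul1r ler_pdivrMr; last by rewrite divr_gt0// mulr_gt0// exprn_gt0.
  have -> : 41 / 10 * D / u ^+ 2 * (b k ^+ 2 * u ^+ 2 / 4) = 41 / 40 * (D * b k ^+ 2).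
    by field.
  rewrite -/D in h1; lra.
have cardJ : #|[pred k : 'I_d | (k != i) && (k != j)]| = (d - 2)%N.
  have := cardC (pred2 i j); rewrite card2 ij card_ord => /= E.
  have -> : #|[pred k : 'I_d | (k != i) && (k != j)]| = #|[predC pred2 i j]|.
    by apply: eq_card => k; rewrite !inE negb_or.
  by rewrite -[in RHS]E addKn.
rewrite /other_sinc normr_prod.
apply: (@le_trans _ _ (\prod_(k | (k != i) && (k != j)) m)).
  by apply: ler_prod => k _; rewrite normr_ge0 mle.
rewrite prodr_const cardJ.
have -> : (d - 2 = (d - 8) + 6)%N by have := d8; lia.
rewrite exprD; apply: ler_pM; rewrite ?exprn_ge0//.
  by apply: lerXn2r; rewrite ?nnegrE ?divr_ge0// /m ge_min lexx.
rewrite -/m2 -[X in _ <= X ^+ 3](sqr_sqrtr m20) -exprM.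
by apply: lerXn2r; rewrite ?nnegrE ?sqrtr_ge0// /m ge_min lexx orbT.
Qed.

(* The first summand accounts for the replacement of sincs by Gaussians when
   u ^+ 2 <= d; the other two bound the tails of the Gaussian and of the sincs. *)
Definition pair_error u : R :=
  10 / 9 * (u ^+ 6 * gauss u / 12 + u ^+ 8 * gauss u / 576) / D
  + u ^+ 8 * gauss u / D ^+ 2
  + 140 * D ^+ 3 * (49 / 50) ^+ (d - 8) / (1 + u ^+ 2).

Lemma other_sinc_pair (c u delta : R) : 0 <= c ->
  (1 - s * u ^+ 2 / 14) * (c * u ^+ 4) <= delta -> delta <= c * u ^+ 4 ->
  - (c * u ^+ 4) <= delta ->
  `|delta * other_sinc u - c * (u ^+ 4 * gauss u)| <= c * pair_error u.
Proof.
move=> c0 dge dle dge'.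
have g0 := gauss_ge0 u.
have e6 : 0 <= u ^+ 6 * gauss u by rewrite mulr_ge0// exprn_even_ge0.
have e8 : 0 <= u ^+ 8 * gauss u by rewrite mulr_ge0// exprn_even_ge0.
have u20 : 0 <= u ^+ 2 by exact: sqr_ge0.
have t1 : 0 <= 10 / 9 * (u ^+ 6 * gauss u / 12 + u ^+ 8 * gauss u / 576) / D.
  apply: divr_ge0; last exact: ltW D0.
  apply: mulr_ge0; first by rewrite divr_ge0.
  by apply: addr_ge0; apply: divr_ge0; rewrite ?ler0n.
have t2 : 0 <= u ^+ 8 * gauss u / D ^+ 2 by rewrite divr_ge0// exprn_ge0// ltW.
have t3 : 0 <= 140 * D ^+ 3 * (49 / 50) ^+ (d - 8) / (1 + u ^+ 2).
  by rewrite divr_ge0 ?addr_ge0// mulr_ge0 ?exprn_ge0// ?mulr_ge0// ?exprn_ge0// ?divr_ge0// ltW.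
have [uD|uD] := leP (u ^+ 2) D.
  apply: le_trans (other_sinc_near c0 uD dge dle) _.
  by rewrite ler_wpM2l// /pair_error; lra.
have {}uD := ltW uD.
have ug0 : 0 < u ^+ 2 by exact: lt_le_trans uD.
have D1 : 1 <= D by rewrite ler1n (leq_trans _ d8).
apply: le_trans (ler_normB _ _) _.
have u40 : 0 <= u ^+ 4 by rewrite exprn_even_ge0.
(* In the tail, [u ^+ 4 / D ^+ 2] is at least 1. *)
have h1 : `|c * (u ^+ 4 * gauss u)| <= c * (u ^+ 8 * gauss u / D ^+ 2).
  rewrite ger0_norm; last by apply: mulr_ge0 c0 _; exact: mulr_ge0.
  apply: ler_wpM2l => //; rewrite ler_pdivlMr ?exprn_gt0//.
  have -> : u ^+ 8 * gauss u = u ^+ 4 * gauss u * (u ^+ 2) ^+ 2 by ring.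
  apply: ler_wpM2l; first exact: mulr_ge0.
  by rewrite ler_pXn2r ?nnegrE// ltW.
(* 140 is 70 * 2, where 70 bounds (41/10)^3 and 2 bounds [(1 + u ^+ 2) / u ^+ 2]. *)
have h2 : `|delta * other_sinc u| <= c * (140 * D ^+ 3 * (49 / 50) ^+ (d - 8) / (1 + u ^+ 2)).
  rewrite normrM.
  have dn : `|delta| <= c * u ^+ 4 by rewrite ler_norml dge' dle.
  apply: (le_trans (ler_pM (normr_ge0 _) (normr_ge0 _) dn (other_sinc_far uD))).
  rewrite -[leLHS]mulrA; apply: ler_wpM2l => //; rewrite ler_pdivlMr; last by lra.
  have rho0 : 0 <= (49 / 50 : R) ^+ (d - 8) by rewrite exprn_ge0// divr_ge0.
  have -> : u ^+ 4 * ((49 / 50) ^+ (d - 8) * (41 / 10 * D / u ^+ 2) ^+ 3) * (1 + u ^+ 2) =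
    (49 / 50) ^+ (d - 8) * (D ^+ 3 * ((41 / 10) ^+ 3 * ((1 + u ^+ 2) / u ^+ 2))).
    by field; rewrite -sqrf_eq0 gt_eqF.
  have -> : 140 * D ^+ 3 * (49 / 50) ^+ (d - 8) = (49 / 50) ^+ (d - 8) * (D ^+ 3 * 140) by ring.
  apply: ler_wpM2l => //; apply: ler_wpM2l; first by rewrite exprn_ge0// ltW.
  have r2 : (1 + u ^+ 2) / u ^+ 2 <= 2 by rewrite ler_pdivrMr//; lra.
  apply: (@le_trans _ _ ((41 / 10) ^+ 3 * 2)).
    by apply: ler_wpM2l => //; rewrite exprn_ge0// divr_ge0.
  have -> : 140 = 70 * 2 :> R by rewrite -natrM.
  rewrite ler_pM2r//.
  have -> : (41 / 10 : R) ^+ 3 = (41 / 10) * ((41 / 10) * (41 / 10)) by ring.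
  lra.
apply: le_trans (lerD h2 h1) _; rewrite /pair_error.
move: t1 {t2 t3 h1 h2}; set p := _ / D => p0.
rewrite -mulrDr; apply: ler_wpM2l => //.
by rewrite [leLHS]addrC -[leRHS]addrA lerDr.
Qed.

End pair_remainder.

(** * The integral of the error *)

Section error_integral.
Context {R : realType}.
Notation mu := (@lebesgue_measure R).

Lemma cauchy_decay_pair_error d : cauchy_decay (@pair_error R d).
Proof.
have g6 := @cauchy_decay_gaussX R 6; have g8 := @cauchy_decay_gaussX R 8.
have hV : cauchy_decay (fun u : R => (1 + u ^+ 2)^-1).
  split; first by apply: continuous_measurable_fun; exact: (@continuous_oneDsqrV R).
  by exists 1 => u; rewrite div1r ger0_norm// invr_ge0 addr_ge0// sqr_ge0.
have h := cauchy_decayD (cauchy_decayD (cauchy_decayZ (10 / 9 / d%:R)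
   (cauchy_decayD (cauchy_decayZ (12^-1) g6) (cauchy_decayZ (576^-1) g8)))
   (cauchy_decayZ (d%:R ^- 2) g8)) (cauchy_decayZ (140 * d%:R ^+ 3 * (49 / 50) ^+ (d - 8)) hV).
rewrite (_ : pair_error d = (fun u => 10 / 9 / d%:R * (12^-1 * (u ^+ 6 * gauss u) + 576^-1 * (u ^+ 8 * gauss u))
   + d%:R ^- 2 * (u ^+ 8 * gauss u) + 140 * d%:R ^+ 3 * (49 / 50) ^+ (d - 8) * (1 + u ^+ 2)^-1))//.
by apply/funext => u; rewrite /pair_error; ring.
Qed.

Definition cauchy_mass : R := \int[mu]_u (1 + u ^+ 2)^-1.

(** Relative to the fourth moment [432 * gauss_mass], the sixth and eighth ones are 60 and 84 * 60,
    whence 5 = 60 / 12 and 35/4 = 84 * 60 / 576. *)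
Lemma Rintegral_pair_error d : \int[mu]_u pair_error d u =
  10 / 9 * (5 + 35 / 4) * (432 * gauss_mass) / d%:R +
  84 * 60 * (432 * gauss_mass) / d%:R ^+ 2 +
  140 * d%:R ^+ 3 * (49 / 50) ^+ (d - 8) * cauchy_mass.
Proof.
have g6 := @cauchy_decay_gaussX R 6; have g8 := @cauchy_decay_gaussX R 8.
have hV : mu.-integrable setT (EFin \o (fun u : R => (1 + u ^+ 2)^-1)).
  exact: integrable_oneDsqrV.
transitivity (\int[mu]_u ((10 / 9 / d%:R * 12^-1) * (u ^+ 6 * gauss u) +
    (10 / 9 / d%:R * 576^-1 + d%:R ^- 2) * (u ^+ 8 * gauss u)
   + (140 * d%:R ^+ 3 * (49 / 50) ^+ (d - 8)) * (1 + u ^+ 2)^-1)).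
  by apply: eq_Rintegral => u _; rewrite /pair_error; ring.
have i6 := cauchy_decay_integrable (cauchy_decayZ (10 / 9 / d%:R * 12^-1) g6).
have i8 := cauchy_decay_integrable (cauchy_decayZ (10 / 9 / d%:R * 576^-1 + d%:R ^- 2) g8).
have i68 := cauchy_decay_integrable (cauchy_decayD (cauchy_decayZ (10 / 9 / d%:R * 12^-1) g6)
  (cauchy_decayZ (10 / 9 / d%:R * 576^-1 + d%:R ^- 2) g8)).
have iV : mu.-integrable setT (EFin \o (fun u : R => 140 * d%:R ^+ 3 * (49 / 50) ^+ (d - 8) * (1 + u ^+ 2)^-1)).
  apply: (@eq_integrable _ _ _ mu setT measurableT
     (fun u => (140 * d%:R ^+ 3 * (49 / 50) ^+ (d - 8))%:E * ((1 + u ^+ 2)^-1)%:E)%E) => //.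
  exact: integrableZl.
rewrite RintegralD// RintegralD// !RintegralZl//; last 2 first.
- exact: cauchy_decay_integrable.
- exact: cauchy_decay_integrable.
rewrite gauss_moment6 gauss_moment8 -/cauchy_mass.
have -> : (576^-1 : R) = 4^-1 / 144 by rewrite -invfM -natrM.
have -> : (84 * (60 * (432 * gauss_mass)) : R) = 84 * 60 * (432 * gauss_mass) by ring.
set M := 432 * gauss_mass; set V := _ * cauchy_mass.
have [->|d0] := eqVneq (d%:R : R) 0.
  by rewrite !expr0n/= !invr0; ring.
field.
by [].
Qed.

Lemma geometric_vs_power (C e : R) : 0 < e -> 0 <= C ->
  exists N : nat, forall d, (N <= d)%N -> C * (d%:R ^+ 4 * (49 / 50) ^+ (d - 8)) <= e.
Proof.
move=> e0 C0.
(* Chosen so that the quantity is at most [A * e / n%:R] with n = d - 8. It uses d <= 9 n and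
   (49/50)^n <= exp (- n / 50), the latter bounded by the term of degree 5 of the exponential
   series. *)
pose A : R := C * (9 ^+ 4 * (5`!%:R * 50 ^+ 5)) / e.
have A0 : 0 <= A.
  have p1 : 0 <= (5`!%:R : R) * 50 ^+ 5 by apply: mulr_ge0; [exact: ler0n|exact: exprn_ge0].
  have p2 : 0 <= (9 : R) ^+ 4 by exact: exprn_ge0.
  exact: divr_ge0 (mulr_ge0 C0 (mulr_ge0 p2 p1)) (ltW e0).
exists (Num.bound A + 9)%N => d Nd.
pose n := (d - 8)%N.
have n1 : (1 <= n)%N by rewrite /n; lia.
have An : A <= n%:R.
  apply: (@le_trans _ _ (Num.bound A)%:R); first by rewrite ltW// archi_boundP.
  by rewrite ler_nat /n; lia.
have dn : (d%:R : R) <= 9 * n%:R by rewrite -natrM ler_nat /n; lia.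
have n0 : (0 : R) < n%:R by rewrite ltr0n.
have rho : (49 / 50 : R) ^+ n <= 5`!%:R * 50 ^+ 5 / n%:R ^+ 5.
  apply: (@le_trans _ _ (expR (- (n%:R / 50)))).
    have -> : - (n%:R / 50) = n%:R * (- 50^-1) :> R by ring.
    rewrite expRM_natl; apply: lerXn2r; rewrite ?nnegrE ?expR_ge0// ?divr_ge0//.
    by have := @expR_ge1Dx R (- 50^-1); lra.
  have h := @expR_ge1Dxn R (n%:R / 50) 4 (divr_ge0 (ltW n0) (ler0n _ 50)).
  have h5 : (n%:R / 50) ^+ 5 / 5`!%:R <= expR (n%:R / 50) :> R by apply: le_trans h; rewrite lerDr.
  have f0 : 0 < 5`!%:R :> R by rewrite ltr0n fact_gt0.
  have p0 : 0 < (50 : R) ^+ 5 by exact: exprn_gt0.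
  have q0 : 0 < (n%:R : R) ^+ 5 by exact: exprn_gt0.
  rewrite expRN -[leLHS]mul1r ler_pdivrMr ?expR_gt0//.
  apply: (@le_trans _ _ (5`!%:R * 50 ^+ 5 / n%:R ^+ 5 * ((n%:R / 50) ^+ 5 / 5`!%:R))).
    rewrite expr_div_n le_eqVlt; apply/orP; left; apply/eqP.
    move: f0 p0 q0; set x := 5`!%:R; set y := 50 ^+ 5; set z := _ ^+ 5 => f0 p0 q0.
    by field; rewrite !gt_eqF.
  by apply: ler_wpM2l h5; apply: divr_ge0 (ltW q0); apply: mulr_ge0; exact: ltW.
have d4 : (d%:R : R) ^+ 4 <= 9 ^+ 4 * n%:R ^+ 4.
  by rewrite -exprMn; apply: lerXn2r; rewrite ?nnegrE ?mulr_ge0 ?ler0n.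
have rho0 : 0 <= (49 / 50 : R) ^+ n by apply: exprn_ge0; rewrite divr_ge0.
apply: (@le_trans _ _ (C * (9 ^+ 4 * n%:R ^+ 4 * (5`!%:R * 50 ^+ 5 / n%:R ^+ 5)))).
  apply: ler_wpM2l => //.
  exact: ler_pM (exprn_ge0 _ (ler0n _ _)) rho0 d4 rho.
have -> : C * (9 ^+ 4 * n%:R ^+ 4 * (5`!%:R * 50 ^+ 5 / n%:R ^+ 5)) = A * e / n%:R.
  rewrite /A; move: (5`!%:R : R) (50 ^+ 5 : R) (9 ^+ 4 : R) => x y z.
  by field; rewrite !gt_eqF.
by rewrite ler_pdivrMr// mulrC ler_wpM2l// ltW.
Qed.

(** The first term has coefficient 10/9 * (5 + 35/4), about 15.28; the two others are eventually at
    most 4/10 and 3/10 of the unit, for a total below 16. *)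
Lemma pair_error_le : exists N : nat, forall d, (N <= d)%N ->
  \int[mu]_u pair_error d u <= 16 / d%:R * (432 * gauss_mass).
Proof.
have m0 := @gauss_mass_gt0 R.
have M0 : 0 < 432 * @gauss_mass R by apply: mulr_gt0 m0; rewrite ltr0n.
have Q0 : 0 <= cauchy_mass.
  by apply: Rintegral_ge0 => u _; rewrite invr_ge0 addr_ge0// sqr_ge0.
have C0 : 0 <= 140 * cauchy_mass / (432 * gauss_mass).
  by apply: divr_ge0 (ltW M0); exact: mulr_ge0.
have e0 : (0 : R) < 3 / 10 by rewrite divr_gt0.
have [N1 HN1] := geometric_vs_power e0 C0.
exists (maxn (N1 + 1) (Num.bound (84 * 60 * 10 / 4 : R)))%N => d.
rewrite geq_max => /andP[d1 d2].
have D0 : (0 : R) < d%:R by rewrite ltr0n; lia.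
have h1 : 140 * cauchy_mass / (432 * gauss_mass) * (d%:R ^+ 4 * (49 / 50) ^+ (d - 8)) <= 3 / 10.
  by apply: HN1; lia.
have h2 : (84 * 60 * 10 / 4 : R) <= d%:R.
  apply: (@le_trans _ _ (Num.bound (84 * 60 * 10 / 4 : R))%:R); last by rewrite ler_nat.
  apply: ltW; apply: archi_boundP.
  exact: divr_ge0 (mulr_ge0 (mulr_ge0 (ler0n _ 84) (ler0n _ 60)) (ler0n _ 10)) (ler0n _ 4).
rewrite Rintegral_pair_error.
move: h1 M0; set M := 432 * gauss_mass => h1 M0.
set q := (49 / 50) ^+ (d - 8) in h1 *.
have h3 : 140 * d%:R ^+ 3 * q * cauchy_mass <= 3 / 10 * M / d%:R.
  rewrite ler_pdivlMr//.
  have -> : 140 * d%:R ^+ 3 * q * cauchy_mass * d%:R = 140 * cauchy_mass / M * (d%:R ^+ 4 * q) * M.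
    by field; rewrite gt_eqF.
  by rewrite ler_pM2r.
have h4 : 84 * 60 * M / d%:R ^+ 2 <= 4 / 10 * M / d%:R.
  have -> : 84 * 60 * M / d%:R ^+ 2 = (84 * 60 / d%:R) * (M / d%:R).
    by field; rewrite gt_eqF.
  have -> : 4 / 10 * M / d%:R = 4 / 10 * (M / d%:R) by ring.
  apply: ler_wpM2r; first by rewrite divr_ge0// ltW.
  by rewrite ler_pdivrMr//; move: h2; set D := d%:R; lra.
apply: (le_trans (lerD (lerD (lexx _) h4) h3)).
have -> : 10 / 9 * (5 + 35 / 4) * M / d%:R + 4 / 10 * M / d%:R + 3 / 10 * M / d%:R =
   (10 / 9 * (5 + 35 / 4) + 4 / 10 + 3 / 10) * (M / d%:R) by ring.
have -> : 16 / d%:R * M = 16 * (M / d%:R) by ring.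
apply: ler_wpM2r; first by rewrite divr_ge0// ltW.
by clear; lra.
Qed.

End error_integral.

Section pair_move.
Context {R : realType}.
Notation mu := (@lebesgue_measure R).

Definition sinc_fourier d (t : R) (b : 'I_d -> R) : R :=
  \int[mu]_u (\prod_(k < d) sinc (b k * u / 2) * cos (t * u)).

(** The box bears on squares: an equalizing move replaces two squares by values lying between them,
    hence never leaves it. *)
Definition near_diagonal d (b : 'I_d -> R) : Prop :=
  [/\ forall k, 0 < b k, forall k, 99 / 100 <= d%:R * b k ^+ 2 <= 101 / 100
    & \sum_k b k ^+ 2 = 1].

Lemma sinc_fourier_pair_increment n (b b' : 'I_n.+2 -> R) (i j : 'I_n.+2) (t c : R) :
  (6 < n)%N -> i != j -> near_diagonal b -> (forall k, 0 < b' k) ->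
  (forall k, k != i -> k != j -> b' k = b k) ->
  b' i ^+ 2 + b' j ^+ 2 = b i ^+ 2 + b j ^+ 2 -> b i * b j <= b' i * b' j ->
  c = ((b' i * b' j) ^+ 2 - (b i * b j) ^+ 2) / 1440 ->
  `|sinc_fourier t b' - sinc_fourier t b - c * gauss_cos 4 t| <=
  c * \int[mu]_u pair_error n.+2 u.
Proof.
move=> n6 ij [b0 box b1] b'0 b'b ss le_p cE.
have c0 : 0 <= c.
  rewrite cE.
  apply: mulr_ge0; last by rewrite invr_ge0 ler0n.
  by rewrite subr_ge0; apply: lerXn2r; rewrite ?nnegrE ?mulr_ge0// ltW.
pose q := other_sinc b i j.
have prodE (a : 'I_n.+2 -> R) u : (forall k, k != i -> k != j -> a k = b k) ->
    \prod_(k < n.+2) sinc (a k * u / 2) =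
    sinc (a i * u / 2) * sinc (a j * u / 2) * q u.
  move=> ab; rewrite (bigD1 i)//= (bigD1 j)/=; last by rewrite eq_sym.
  rewrite mulrA; congr (_ * _); apply: eq_bigr => k /andP[ki kj].
  by rewrite ab.
have mcos := measurable_cos_dilate t.
have cosb u : `|cos (t * u)| <= 1 by exact: cos_max.
have d1 : cauchy_decay (fun u => \prod_(k < n.+2) sinc (b k * u / 2) * cos (t * u)).
  exact: cauchy_decayM (cauchy_decay_prod_sinc b0) mcos cosb.
have d2 : cauchy_decay (fun u => \prod_(k < n.+2) sinc (b' k * u / 2) * cos (t * u)).
  exact: cauchy_decayM (cauchy_decay_prod_sinc b'0) mcos cosb.
have d3 := cauchy_decayZ c (cauchy_decay_gauss_cos 4 t).
have d12 := cauchy_decayB d2 d1; have d123 := cauchy_decayB d12 d3.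
have dE := cauchy_decayZ c (@cauchy_decay_pair_error R n.+2).
have -> : sinc_fourier t b' - sinc_fourier t b - c * gauss_cos 4 t =
  \int[mu]_u (\prod_(k < n.+2) sinc (b' k * u / 2) * cos (t * u) -
     \prod_(k < n.+2) sinc (b k * u / 2) * cos (t * u) -
     c * (u ^+ 4 * gauss u * cos (t * u))).
  rewrite RintegralB//; [|exact: cauchy_decay_integrable..].
  rewrite RintegralB//; [|exact: cauchy_decay_integrable..].
  rewrite RintegralZl//; exact: cauchy_decay_integrable (cauchy_decay_gauss_cos 4 t).
apply: le_trans (le_normr_Rintegral measurableT (cauchy_decay_integrable d123)) _.
rewrite -RintegralZl//; last exact: cauchy_decay_integrable (@cauchy_decay_pair_error R n.+2).
apply: le_Rintegral => //.
- exact: cauchy_decay_integrable (cauchy_decay_norm d123).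
- exact: cauchy_decay_integrable dE.
move=> u _.
rewrite (prodE b)// (prodE b')//.
set s' := _ * sinc (b' j * u / 2); set s0 := _ * sinc (b j * u / 2).
have -> : s' * q u * cos (t * u) - s0 * q u * cos (t * u) - c * (u ^+ 4 * gauss u * cos (t * u)) =
   ((s' - s0) * q u - c * (u ^+ 4 * gauss u)) * cos (t * u) by ring.
rewrite normrM; apply: (@le_trans _ _ (`|(s' - s0) * q u - c * (u ^+ 4 * gauss u)| * 1)).
  by apply: ler_wpM2l.
rewrite mulr1.
pose s := (b i ^+ 2 + b j ^+ 2) / 2.
have s2 : b i ^+ 2 + b j ^+ 2 = 2 * s by rewrite /s; field.
have s2' : b' i ^+ 2 + b' j ^+ 2 = 2 * s by rewrite ss.
have [h1 h2 h3] := sinc_pair_increment u (b0 i) (b0 j) (b'0 i) (b'0 j) s2 s2' le_p.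
by apply: other_sinc_pair => //; rewrite cE.
Qed.

Lemma sinc_fourier_pair_sign n (b b' : 'I_n.+2 -> R) (i j : 'I_n.+2) (t : R) :
  (6 < n)%N -> i != j -> near_diagonal b -> (forall k, 0 < b' k) ->
  (forall k, k != i -> k != j -> b' k = b k) ->
  b' i ^+ 2 + b' j ^+ 2 = b i ^+ 2 + b j ^+ 2 -> b i * b j < b' i * b' j ->
  \int[mu]_u pair_error n.+2 u <= 16 / n.+2%:R * (432 * gauss_mass) ->
  (16 / n.+2%:R < (1 - 24 * t ^+ 2 + 48 * t ^+ 4) * expR (- 6 * t ^+ 2) ->
     sinc_fourier t b < sinc_fourier t b') /\
  ((1 - 24 * t ^+ 2 + 48 * t ^+ 4) * expR (- 6 * t ^+ 2) < - (16 / n.+2%:R) ->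
     sinc_fourier t b' < sinc_fourier t b).
Proof.
move=> n6 ij nb b'0 b'b ss lt_p err.
have := sinc_fourier_pair_increment t n6 ij nb b'0 b'b ss (ltW lt_p) erefl.
have [b0 _ _] := nb.
have M0 : 0 < 432 * @gauss_mass R by apply: mulr_gt0 (@gauss_mass_gt0 R); rewrite ltr0n.
set c := _ / 1440.
have c0 : 0 < c.
  apply: mulr_gt0; last by rewrite invr_gt0 ltr0n.
  by rewrite subr_gt0; apply: ltrXn2r; rewrite // ltW// mulr_gt0.
have -> : gauss_cos 4 t = (432 * gauss_mass) * ((1 - 24 * t ^+ 2 + 48 * t ^+ 4) * expR (- 6 * t ^+ 2)).
  by rewrite gauss_cos4E !mulrA.
move: err; set P := (_ * expR _); set M := 432 * gauss_mass in M0 *; set E := Rintegral _ _ _.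
set k := 16 / _; set W := sinc_fourier t b; set W' := sinc_fourier t b'.
move=> err; rewrite ler_norml => /andP[h1 h2].
have h3 : c * E <= c * (k * M) by rewrite ler_pM2l.
split=> h.
  have h4 : c * (k * M) < c * (M * P) by rewrite ltr_pM2l// mulrC ltr_pM2l.
  by move: h1 h3 h4; clear; lra.
have h4 : c * (M * P) < - (c * (k * M)).
  by rewrite -mulrN ltr_pM2l// -mulNr mulrC ltr_pM2r.
by move: h2 h3 h4; clear; lra.
Qed.

End pair_move.

(** * The sign of the quartic *)

Section ranges.
Context {R : realType}.
Implicit Types (t D w : R).

Lemma expRN_ge_pow8 (x : R) : 0 <= x <= 8 -> (1 - x / 8) ^+ 8 <= expR (- x).
Proof.
move=> /andP[x0 x8].
have -> : - x = 8%:R * (- (x / 8)) by field.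
rewrite expRM_natl; apply: lerXn2r; rewrite ?nnegrE ?expR_ge0//.
  by lra.
by have := @expR_ge1Dx R (- (x / 8)).
Qed.

Lemma expRN_ge_pow8_le (x y c : R) : 0 <= x <= y -> y <= 8 ->
  c <= ((((1 - y / 8) ^+ 2) ^+ 2) ^+ 2) -> c <= expR (- x).
Proof.
move=> /andP[x0 xy] y8 cy; apply: le_trans cy _.
rewrite -!exprM; apply: le_trans (expRN_ge_pow8 _) _.
  by rewrite (le_trans x0 xy).
by rewrite ler_expR lerN2.
Qed.

Lemma sqrt23_bounds : let w : R := Num.sqrt (2 / 3) in
  [/\ w ^+ 2 = 2 / 3, 81 / 100 <= w & w <= 82 / 100].
Proof.
move=> w.
have w2 : w ^+ 2 = 2 / 3 by rewrite sqr_sqrtr// divr_ge0.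
have w0 : 0 <= w by exact: sqrtr_ge0.
by split => //; nra.
Qed.

Lemma gamma_bounds : let w : R := Num.sqrt (2 / 3) in
  [/\ gamma_minus R ^+ 2 = (1 - w) / 4, gamma_plus R ^+ 2 = (1 + w) / 4,
    21 / 100 <= gamma_minus R <= 22 / 100 & 67 / 100 <= gamma_plus R <= 68 / 100].
Proof.
move=> w; have [w2 w81 w82] := sqrt23_bounds.
rewrite -/w in w2 w81 w82.
have gm : gamma_minus R ^+ 2 = (1 - w) / 4.
  rewrite /gamma_minus -/w exprMn sqr_sqrtr; last by lra.
  by field.
have gp : gamma_plus R ^+ 2 = (1 + w) / 4.
  rewrite /gamma_plus -/w exprMn sqr_sqrtr; last by lra.
  by field.
have m0 : 0 <= gamma_minus R by rewrite /gamma_minus mulr_ge0 ?invr_ge0 ?sqrtr_ge0.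
have p0 : 0 <= gamma_plus R by rewrite /gamma_plus mulr_ge0 ?invr_ge0 ?sqrtr_ge0.
split => //; apply/andP; split; nra.
Qed.

Lemma quarticE t : 1 - 24 * t ^+ 2 + 48 * t ^+ 4 =
  48 * (t ^+ 2 - gamma_minus R ^+ 2) * (t ^+ 2 - gamma_plus R ^+ 2).
Proof.
have [-> -> _ _] := gamma_bounds; have [w2 _ _] := sqrt23_bounds.
move: w2; set w := Num.sqrt _ => w2.
have -> : 48 * (t ^+ 2 - (1 - w) / 4) * (t ^+ 2 - (1 + w) / 4) =
  48 * t ^+ 4 - 24 * t ^+ 2 + 3 * (1 - w ^+ 2) by field.
by rewrite w2; field.
Qed.

Section quartic_sign.
(** [g] and [p] stand for the two roots, of which only rational enclosures are used here, and [u]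
    for 1 / d. *)
Variables (g p u : R).
Hypotheses (g_bnd : 21 / 100 <= g <= 22 / 100) (p_bnd : 67 / 100 <= p <= 68 / 100)
  (u_bnd : 0 < u <= 1 / 100 * (1 / 100)).

Let mulle (x y z w : R) : 0 <= x -> 0 <= z -> x <= y -> z <= w -> x * z <= y * w.
Proof. exact: ler_pM. Qed.

Let lb3 (x y z a b c : R) : 0 <= a -> 0 <= b -> 0 <= c -> a <= x -> b <= y -> c <= z ->
  48 * a * b * c <= 48 * x * y * z.
Proof.
move=> a0 b0 c0 ax by_ cz.
have h48 : 0 <= 48 :> R by exact: ler0n.
apply: ler_pM => //; first by rewrite !mulr_ge0.
by apply: ler_pM => //; [rewrite mulr_ge0 | apply: ler_wpM2l].
Qed.

Lemma quartic_low t : 0 <= t <= g - 76 * u ->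
  16 * u < 48 * (t ^+ 2 - g ^+ 2) * (t ^+ 2 - p ^+ 2) * expR (- 6 * t ^+ 2).
Proof.
move=> /andP[t0 tg].
have [g1 g2] := andP g_bnd; have [p1 p2] := andP p_bnd; have [u0 u1] := andP u_bnd.
have X : 15 * u <= g ^+ 2 - t ^+ 2.
  have h : 76 * u * g <= (g - t) * (g + t) by apply: mulle; lra.
  have h' : 21 / 100 * u <= g * u by apply: mulle; lra.
  nra.
have Y : 4 / 10 <= p ^+ 2 - t ^+ 2.
  have h : t * t <= g * g by apply: mulle; lra.
  nra.
have E : 1 / 2 <= expR (- 6 * t ^+ 2).
  apply: le_trans (expR_ge1Dx _).
  nra.
have := lb3 (ltac:(lra) : 0 <= 15 * u) (ltac:(lra) : 0 <= 4 / 10) (ltac:(lra) : 0 <= 1 / 2) X Y E.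
have -> : 48 * (g ^+ 2 - t ^+ 2) * (p ^+ 2 - t ^+ 2) =
  48 * (t ^+ 2 - g ^+ 2) * (t ^+ 2 - p ^+ 2) by ring.
move: (48 * (t ^+ 2 - g ^+ 2) * (t ^+ 2 - p ^+ 2) * expR (- 6 * t ^+ 2)) => Z.
lra.
Qed.

(** The tightest use of 76, near the larger root, where the Gaussian factor is small: 48 * 33 *
    36/100 * 4/125 is about 18.2. The product of the distances to the roots is least at the ends of
    the interval, which gives 76 * 44/100 > 33. *)
Lemma quartic_mid t : g + 76 * u <= t <= p - 76 * u ->
  48 * (t ^+ 2 - g ^+ 2) * (t ^+ 2 - p ^+ 2) * expR (- 6 * t ^+ 2) < - (16 * u).
Proof.
move=> /andP[gt tp].
have [g1 g2] := andP g_bnd; have [p1 p2] := andP p_bnd; have [u0 u1] := andP u_bnd.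
have X : 33 * u <= (t - g) * (p - t).
  have h : 0 <= (t - g - 76 * u) * (p - 76 * u - t) by apply: mulr_ge0; lra.
  have h' : 76 * u * (44 / 100) <= 76 * u * (p - g - 76 * u) by apply: mulle; lra.
  nra.
have Y : 36 / 100 <= (t + g) * (t + p).
  have h : 42 / 100 * (88 / 100) <= (t + g) * (t + p) by apply: mulle; lra.
  lra.
have E : 4 / 125 <= expR (- 6 * t ^+ 2).
  rewrite mulNr; apply: (@expRN_ge_pow8_le _ (139 / 50)); [|lra|lra].
  have h : t * t <= 68 / 100 * (68 / 100) by apply: mulle; lra.
  by apply/andP; split; nra.
have := lb3 (ltac:(lra) : 0 <= 33 * u) (ltac:(lra) : 0 <= 36 / 100) (ltac:(lra) : 0 <= 4 / 125) X Y E.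
have -> : 48 * ((t - g) * (p - t)) * ((t + g) * (t + p)) * expR (- 6 * t ^+ 2) =
  - (48 * (t ^+ 2 - g ^+ 2) * (t ^+ 2 - p ^+ 2) * expR (- 6 * t ^+ 2)) by ring.
move: (48 * (t ^+ 2 - g ^+ 2) * (t ^+ 2 - p ^+ 2) * expR (- 6 * t ^+ 2)) => Z.
lra.
Qed.

Lemma quartic_high t : p + 76 * u <= t <= 3 / 4 ->
  16 * u < 48 * (t ^+ 2 - g ^+ 2) * (t ^+ 2 - p ^+ 2) * expR (- 6 * t ^+ 2).
Proof.
move=> /andP[pt t1].
have [g1 g2] := andP g_bnd; have [p1 p2] := andP p_bnd; have [u0 u1] := andP u_bnd.
have X : 4 / 10 <= t ^+ 2 - g ^+ 2.
  have h : p * p <= t * t by apply: mulle; lra.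
  nra.
have Y : 101 * u <= t ^+ 2 - p ^+ 2.
  have h : 76 * u * (134 / 100) <= (t - p) * (t + p) by apply: mulle; lra.
  lra.
have E : 3 / 250 <= expR (- 6 * t ^+ 2).
  rewrite mulNr; apply: (@expRN_ge_pow8_le _ (27 / 8)); [|lra|lra].
  have h : t * t <= 3 / 4 * (3 / 4) by apply: mulle; lra.
  by apply/andP; split; nra.
have := lb3 (ltac:(lra) : 0 <= 4 / 10) (ltac:(lra) : 0 <= 101 * u) (ltac:(lra) : 0 <= 3 / 250) X Y E.
move: (48 * (t ^+ 2 - g ^+ 2) * (t ^+ 2 - p ^+ 2) * expR (- 6 * t ^+ 2)) => Z.
lra.
Qed.

(** Here the left side has a positive lower bound independent of [u], so it suffices that d be
    large. The exponent 9 bounds 6 * (12/10)^2. *)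
Lemma quartic_higher t : 8 * u < expR (- 9%:R) -> 3 / 4 <= t <= 12 / 10 ->
  16 * u < 48 * (t ^+ 2 - g ^+ 2) * (t ^+ 2 - p ^+ 2) * expR (- 6 * t ^+ 2).
Proof.
move=> u9 /andP[t1 t2].
have [g1 g2] := andP g_bnd; have [p1 p2] := andP p_bnd; have [u0 u1] := andP u_bnd.
have tt : 9 / 16 <= t * t.
  have h : 3 / 4 * (3 / 4) <= t * t by apply: mulle; lra.
  lra.
have X : 1 / 2 <= t ^+ 2 - g ^+ 2.
  have h : g * g <= 22 / 100 * (22 / 100) by apply: mulle; lra.
  nra.
have Y : 9 / 100 <= t ^+ 2 - p ^+ 2.
  have h : p * p <= 68 / 100 * (68 / 100) by apply: mulle; lra.
  nra.
have E : expR (- 9%:R) <= expR (- 6 * t ^+ 2).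
  rewrite ler_expR.
  have h : t * t <= 12 / 10 * (12 / 10) by apply: mulle; lra.
  nra.
have := lb3 (ltac:(lra) : 0 <= 1 / 2) (ltac:(lra) : 0 <= 9 / 100) (expR_ge0 _) X Y E.
move: u9; move: (expR (- 9%:R)) => e u9.
move: (48 * (t ^+ 2 - g ^+ 2) * (t ^+ 2 - p ^+ 2) * expR (- 6 * t ^+ 2)) => Z.
lra.
Qed.

(** The Gaussian factor may drop to [u], the order of the error, so the quartic alone must exceed
    16: it is at least 48 * 1/2 * 9/10 = 21.6. *)
Lemma quartic_top t : 12 / 10 <= t -> 6 * t ^+ 2 <= ln (u^-1) ->
  16 * u < 48 * (t ^+ 2 - g ^+ 2) * (t ^+ 2 - p ^+ 2) * expR (- 6 * t ^+ 2).
Proof.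
move=> t1 tu.
have [g1 g2] := andP g_bnd; have [p1 p2] := andP p_bnd; have [u0 u1] := andP u_bnd.
have tt : 144 / 100 <= t * t.
  have h : 12 / 10 * (12 / 10) <= t * t by apply: mulle; lra.
  lra.
have X : 1 / 2 <= t ^+ 2 - g ^+ 2.
  have h : g * g <= 22 / 100 * (22 / 100) by apply: mulle; lra.
  nra.
have Y : 9 / 10 <= t ^+ 2 - p ^+ 2.
  have h : p * p <= 68 / 100 * (68 / 100) by apply: mulle; lra.
  nra.
have E : u <= expR (- 6 * t ^+ 2).
  by rewrite -{1}(@lnK _ u) ?posrE// ler_expR -[leLHS]opprK -lnV ?posrE// mulNr lerN2.
have := lb3 (ltac:(lra) : 0 <= 1 / 2) (ltac:(lra) : 0 <= 9 / 10) (ltW u0) X Y E.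
move: (48 * (t ^+ 2 - g ^+ 2) * (t ^+ 2 - p ^+ 2) * expR (- 6 * t ^+ 2)) => Z.
lra.
Qed.

End quartic_sign.

Lemma quartic_sign_ranges : exists N, forall d t, (N <= d)%N -> 0 <= t ->
  (t \in `[0, gamma_minus R - 76 / d%:R]
     \/ t \in `[gamma_plus R + 76 / d%:R, Num.sqrt (ln d%:R / 6)] ->
   16 / d%:R < (1 - 24 * t ^+ 2 + 48 * t ^+ 4) * expR (- 6 * t ^+ 2)) /\
  (t \in `[gamma_minus R + 76 / d%:R, gamma_plus R - 76 / d%:R] ->
   (1 - 24 * t ^+ 2 + 48 * t ^+ 4) * expR (- 6 * t ^+ 2) < - (16 / d%:R)).
Proof.
have e9 : 0 < expR (- 9%:R) :> R by exact: expR_gt0.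
exists (maxn (Num.bound (8 / expR (- 9%:R) : R)) (100 * 100)) => d t.
rewrite geq_max => /andP[dN d4] t0.
have d1 : 100 * 100 <= d%:R :> R by rewrite -natrM ler_nat.
have D0 : 0 < d%:R :> R by apply: lt_le_trans d1; rewrite -natrM ltr0n.
have u0 : 0 < d%:R^-1 :> R by rewrite invr_gt0.
have u_bnd : (0 : R) < (d%:R : R)^-1 <= 1 / 100 * (1 / 100).
  apply/andP; split => //; apply: (@le_trans _ _ ((100 * 100)^-1)).
    by rewrite lef_pV2 ?posrE// -natrM ltr0n.
  by rewrite invfM !div1r.
have u9 : 8 * d%:R^-1 < expR (- 9%:R) :> R.
  rewrite ltr_pdivrMr// mulrC -ltr_pdivrMr//.
  apply: lt_le_trans (archi_boundP _) _; first by rewrite divr_ge0// ltW.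
  by rewrite ler_nat.
have [_ _ gb pb] := gamma_bounds.
rewrite quarticE; split => [[|]|]; rewrite in_itv/=.
- exact: quartic_low.
- move=> /andP[pt ts].
  have [t1|t1] := leP t (3 / 4); first by apply: quartic_high => //; rewrite pt.
  have [t2|t2] := leP t (12 / 10).
    by apply: quartic_higher => //; rewrite (ltW t1) t2.
  apply: quartic_top => //; first exact: ltW.
  rewrite invrK.
  have lnd : 0 <= ln (d%:R : R) / 6 by rewrite divr_ge0// ln_ge0//; apply: le_trans d1; rewrite -natrM ler1n.
  have : t ^+ 2 <= Num.sqrt (ln d%:R / 6) ^+ 2 by apply: lerXn2r; rewrite ?nnegrE ?sqrtr_ge0.
  by rewrite sqr_sqrtr//; lra.
- exact: quartic_mid.
Qed.

End ranges.

(** * Reaching the diagonal *)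

Section equalization.
Context {R : realType}.

Lemma sumr0_exists_neg (I : finType) (F : I -> R) (k : I) :
  \sum_i F i = 0 -> F k != 0 -> exists i, F i < 0.
Proof.
move=> F0 Fk; apply: contrapT => noneg.
have Fge i : true -> 0 <= F i.
  by move=> _; rewrite leNgt; apply/negP => Fi; apply: noneg; exists i.
by move/eqP: Fk; apply; exact: (psumr_eq0P Fge F0).
Qed.

(* If x < v < y, then v * (x + y - v) - x * y = (v - x) * (y - v) > 0: the product
   increases when the squares x and y are replaced by v = 1 / d and x + y - v. *)
Lemma equalize_coordinate (d : nat) (b : 'I_d -> R) (k : 'I_d) :
  near_diagonal b -> b k ^+ 2 != d%:R^-1 ->
  exists (b' : 'I_d -> R) (i j : 'I_d),
    [/\ near_diagonal b', i != j, forall l, l != i -> l != j -> b' l = b l,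
      b' i ^+ 2 + b' j ^+ 2 = b i ^+ 2 + b j ^+ 2 & b i * b j < b' i * b' j] /\
    (#|[pred l | b' l ^+ 2 != d%:R^-1]| < #|[pred l | b l ^+ 2 != d%:R^-1]|)%N.
Proof.
move=> [b0 bnd b1] bk.
have d0 : 0 < d%:R :> R by rewrite ltr0n; exact: leq_ltn_trans (ltn_ord k).
pose u : R := d%:R^-1; rewrite -/u in bk *.
have u0 : 0 < u by rewrite invr_gt0.
have sumu : \sum_(l < d) (b l ^+ 2 - u) = 0.
  rewrite sumrB b1 sumr_const card_ord -mulr_natl /u divff ?subrr//.
  by rewrite gt_eqF.
have nz : b k ^+ 2 - u != 0 by rewrite subr_eq0.
have [i bi] := sumr0_exists_neg sumu nz.
have [j] : exists j, u - b j ^+ 2 < 0.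
  apply: (@sumr0_exists_neg _ (fun l => u - b l ^+ 2) k).
    apply: (@eq_trans _ _ (- \sum_(l < d) (b l ^+ 2 - u))); last by rewrite sumu oppr0.
    by rewrite -sumrN; apply: eq_bigr => l _; rewrite opprB.
  by rewrite subr_eq0 eq_sym.
rewrite subr_lt0 in bi; rewrite subr_lt0 => bj.
have ij : i != j by apply/eqP => e; move: bi; rewrite e ltNge ltW.
pose v := b i ^+ 2 + b j ^+ 2 - u.
have vu : b i ^+ 2 < v by rewrite /v; lra.
have vj : v < b j ^+ 2 by rewrite /v; lra.
have v0 : 0 < v by apply: le_lt_trans vu; exact: sqr_ge0.
pose b' l := if l == i then Num.sqrt u else if l == j then Num.sqrt v else b l.
have b'i : b' i = Num.sqrt u by rewrite /b' eqxx.
have b'j : b' j = Num.sqrt v by rewrite /b' eq_sym (negbTE ij) eqxx.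
have b'l l : l != i -> l != j -> b' l = b l by rewrite /b' => /negbTE -> /negbTE ->.
have b'i2 : b' i ^+ 2 = u by rewrite b'i sqr_sqrtr// ltW.
have b'j2 : b' j ^+ 2 = v by rewrite b'j sqr_sqrtr// ltW.
exists b', i, j; split; first split => //.
- split.
  + move=> l; rewrite /b'; case: eqP => _; first by rewrite sqrtr_gt0.
    by case: eqP => _; rewrite ?sqrtr_gt0.
  + move=> l; have [->|li] := eqVneq l i.
      by rewrite b'i2 /u divff ?gt_eqF//; apply/andP; split; lra.
    have [->|lj] := eqVneq l j; last by rewrite b'l.
    have /andP[bi1 _] := bnd i; have /andP[_ bj2] := bnd j.
    rewrite b'j2; apply/andP; split.
      by apply: le_trans bi1 _; apply: ler_wpM2l; rewrite ltW.
    by apply: le_trans bj2; apply: ler_wpM2l; rewrite ltW.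
  + rewrite -b1 (bigD1 i)//= (bigD1 j) 1?eq_sym//= addrA b'i2 b'j2.
    rewrite [RHS](bigD1 i)//= [in RHS](bigD1 j) 1?eq_sym//= addrA; congr (_ + _).
      by rewrite /v; ring.
    by apply: eq_bigr => l /andP[li lj]; rewrite b'l.
- by rewrite b'i2 b'j2 /v; ring.
- rewrite b'i b'j -sqrtrM ?(ltW u0)//.
  rewrite -(@ltr_pXn2r _ 2%N)// ?nnegrE ?sqrtr_ge0 ?mulr_ge0 ?ltW//.
  rewrite sqr_sqrtr ?mulr_ge0 ?ltW// exprMn /v.
  by move: (b i ^+ 2) (b j ^+ 2) bi bj => x y bi bj; nra.
- apply: proper_card; apply/properP; split.
    apply/fintype.subsetP => l; rewrite !inE; have [->|li] := eqVneq l i; first by rewrite b'i2 eqxx.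
    have [->|lj] := eqVneq l j; first by rewrite (gt_eqF bj).
    by rewrite b'l.
  by exists i; rewrite !inE ?b'i2 ?eqxx// (lt_eqF bi).
Qed.

(** The bound [err] depends on the dimension only and every intermediate vector is again
    [near_diagonal], so the strict inequalities of the successive moves chain. *)
Lemma sinc_fourier_diagonal_sign (n : nat) (b : 'I_n.+2 -> R) t : (6 < n)%N ->
  near_diagonal b -> (exists k, b k ^+ 2 != n.+2%:R^-1) ->
  \int[@lebesgue_measure R]_u pair_error n.+2 u <= 16 / n.+2%:R * (432 * gauss_mass) ->
  let c := fun _ : 'I_n.+2 => Num.sqrt n.+2%:R^-1 in
  (16 / n.+2%:R < (1 - 24 * t ^+ 2 + 48 * t ^+ 4) * expR (- 6 * t ^+ 2) ->
     sinc_fourier t b < sinc_fourier t c) /\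
  ((1 - 24 * t ^+ 2 + 48 * t ^+ 4) * expR (- 6 * t ^+ 2) < - (16 / n.+2%:R) ->
     sinc_fourier t c < sinc_fourier t b).
Proof.
move=> n6 nb kb err c.
have [m] := ubnP #|[pred l | b l ^+ 2 != n.+2%:R^-1]|.
elim: m b nb kb => // m IH b nb [k bk] bm.
have [b' [i [j [[nb' ij b'l b'2 b'lt] card]]]] := equalize_coordinate nb bk.
have b'0 : forall l, 0 < b' l by case: nb'.
have [max min] := sinc_fourier_pair_sign t n6 ij nb b'0 b'l b'2 b'lt err.
have [allc|/existsNP[l /negP b'nd]] := pselect (forall l, b' l ^+ 2 == n.+2%:R^-1).
  have <- : b' = c; last by split.
  apply/funext => l; rewrite /c -(eqP (allc l)) sqrtr_sqr ger0_norm//.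
  exact: ltW.
have [max' min'] := IH b' nb' (ex_intro _ l b'nd) (leq_trans card bm).
by split => h; [exact: lt_trans (max h) (max' h)|exact: lt_trans (min' h) (min h)].
Qed.

End equalization.

(** * Neighborhood of a diagonal direction *)

Section diagonal.
Context {R : realType}.

(** A diagonal has coordinates 1 and - 1, so all squares of [a] equal [k ^+ 2]; the norm and the
    sign then determine [a]. *)
Lemma diagonal_entries d (a : 'rV[R]_d) i : nonneg_sphere a ->
  orthogonal_to_diagonal a -> a 0 i = Num.sqrt d%:R^-1.
Proof.
move=> [a1 a0] [v [vv [k ak]]].
have a2 j : a 0 j * a 0 j = k ^+ 2.
  by rewrite ak !mxE; have [->|->] := vv j; ring.
have d0 : 0 < d%:R :> R by rewrite ltr0n; exact: leq_ltn_trans (ltn_ord i).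
move: a1; rewrite /dot; under eq_bigr do rewrite a2.
rewrite sumr_const card_ord => dk; have {}dk : d%:R * k ^+ 2 = 1 by rewrite mulr_natl.
have -> : d%:R^-1 = k ^+ 2 :> R.
  by apply: (mulfI (lt0r_neq0 d0)); rewrite dk divff ?gt_eqF.
by rewrite -(a2 i) -expr2 sqrtr_sqr ger0_norm.
Qed.

Lemma near_diagonal_nbhs n (a : 'rV[R]_n.+1) : (forall i, a 0 i = Num.sqrt n.+1%:R^-1) ->
  \forall b \near within (@nonneg_sphere R n.+1) (nbhs a), near_diagonal ((b : 'rV[R]_n.+1) 0).
Proof.
move=> aE; pose s : R := Num.sqrt n.+1%:R^-1.
have s0 : 0 < s by rewrite sqrtr_gt0 invr_gt0 ltr0n.
have s2 : n.+1%:R * s ^+ 2 = 1 by rewrite sqr_sqrtr ?invr_ge0// divff.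
(* A relative tolerance of 1/256 on the coordinates fits in the box, as (255/256)^2 > 99/100 and
   (257/256)^2 < 101/100. *)
apply/nbhs_ballP; exists (s / 16 / 16); first by rewrite /= !divr_gt0.
move=> b [_ ab] [b1 b0].
have bs k : s * (15 / 16 + 15 / 16 / 16) < b 0 k < s * (1 + 1 / 16 / 16).
  have := ab 0 k; rewrite /ball /= aE -/s ltr_distlC => /andP[h1 h2].
  by apply/andP; split; lra.
split.
- move=> k; have /andP[h _] := bs k; apply: lt_trans h.
  by rewrite mulr_gt0.
- move=> k; have /andP[/ltW h1 /ltW h2] := bs k.
  have l1 : (s * (15 / 16 + 15 / 16 / 16)) ^+ 2 <= b 0 k ^+ 2.
    by apply: lerXn2r; rewrite ?nnegrE// mulr_ge0// ltW.
  have l2 : b 0 k ^+ 2 <= (s * (1 + 1 / 16 / 16)) ^+ 2.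
    by apply: lerXn2r; rewrite ?nnegrE// mulr_ge0// ltW.
  have N0 : 0 <= n.+1%:R :> R by exact: ler0n.
  apply/andP; split.
    by apply: le_trans (ler_wpM2l N0 l1); rewrite exprMn mulrA s2; lra.
  by apply: le_trans (ler_wpM2l N0 l2) _; rewrite exprMn mulrA s2; lra.
- by rewrite -b1; apply: eq_bigr => k _; rewrite expr2.
Qed.

Lemma lt_section_volume n t (a b : 'rV[R]_n.+2) :
  dot a a = 1 -> dot b b = 1 -> (forall i, 0 < a 0 i) -> (forall i, 0 < b 0 i) ->
  (section_volume t a < section_volume t b)%E = (sinc_fourier t (a 0) < sinc_fourier t (b 0)).
Proof.
move=> a1 b1 a0 b0; rewrite !section_volume_fourier// lte_fin ltr_pM2l//.
by rewrite invr_gt0 mulr_gt0 ?fejer_mass_gt0.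
Qed.

End diagonal.

Theorem theorem1p6 (R : realType) :
  let K : R := 76 in
  exists N : nat, forall d : nat, (N <= d)%N -> forall t : R, 0 <= t ->
  forall a : 'rV[R]_d, nonneg_sphere a -> orthogonal_to_diagonal a ->
  (t \in `[0, gamma_minus R - K / d%:R]
     \/ t \in `[gamma_plus R + K / d%:R, Num.sqrt (ln d%:R / 6)] ->
   strict_local_max (@nonneg_sphere R d) (section_volume t) a)
  /\
  (t \in `[gamma_minus R + K / d%:R, gamma_plus R - K / d%:R] ->
   strict_local_min (@nonneg_sphere R d) (section_volume t) a).
Proof.
move=> K; have [N1 err] := @pair_error_le R; have [N2 sign] := @quartic_sign_ranges R.
(* At least nine coordinates: two that move, six that provide decay in the tail, and one more. *)
exists (maxn 9 (maxn N1 N2)) => d.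
rewrite !geq_max => /and3P[d9 dN1 dN2] t t0 a sa da.
have {err} err := err d dN1; have {sign} [pos neg] := sign d t dN2 t0.
case: d d9 a sa da err pos neg {dN1 dN2} => [//|[//|n]] n6 a sa da err pos neg.
have aE i : a 0 i = Num.sqrt n.+2%:R^-1 by exact: diagonal_entries.
have ac : a 0 = fun=> Num.sqrt n.+2%:R^-1 by apply/funext.
have a0 i : 0 < a 0 i by rewrite aE sqrtr_gt0 invr_gt0 ltr0n.
have [a1 _] := sa.
have off (b : 'rV[R]_n.+2) : near_diagonal (b 0) -> b <> a -> exists k, b 0 k ^+ 2 != n.+2%:R^-1.
  move=> [b0 _ _] ba; apply: contrapT => /forallNP bk; apply: ba.
  apply/rowP => k; have /negP/negPn/eqP := bk k.
  by rewrite aE => <-; rewrite sqrtr_sqr ger0_norm// ltW.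
have unit (b : 'rV[R]_n.+2) : near_diagonal (b 0) -> dot b b = 1.
  by move=> [_ _ <-]; apply: eq_bigr => k _; rewrite expr2.
split => [/pos|/neg] tsign; apply: filterS (near_diagonal_nbhs aE) => b nb ba;
  have [b0 _ _] := nb; rewrite lt_section_volume ?(unit b)// ac;
  have [lt_c gt_c] := sinc_fourier_diagonal_sign t n6 nb (off _ nb ba) err.
- exact: lt_c.
- exact: gt_c.
Qed.
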